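(* Let $X=(X_1,\dots,X_d)$ be a random vector in $\mathbb{S}=[0,\infty)^d$ and let $I\subset\{1,\dots,d\}$ be non-empty. Let $F_i(x)=\mathbb{P}(X_i\le x)$ and $\overline F_i=1-F_i$ for $i\in I$ and $x\in[0,\infty)$. Assume there exists a function $b$, regularly varying at infinity with index $\alpha>0$, such that $\lim_{t\to\infty}b(t)\overline F_i(t)=c_i\in(0,\infty)$ for all $i\in I$. The following statements are equivalent: (a) For every $i\in I$, $\mathcal{L}(X/X_i\mid X_i>t)$ converges weakly to $\mathcal{L}(\Theta_i)$ as $t\to\infty$ for some random vector $\Theta_i=(\Theta_{i,j})_{j=1}^d$ on $\mathbb{S}$. (b) For every $i\in I$, $\mathcal{L}(X_i/t,\,X/X_i\mid X_i>t)$ converges weakly to $\mathrm{Pa}(\alpha)\otimes\mathcal{L}(\Theta_i)$ as $t\to\infty$ for some random vector $\Theta_i$ on $\mathbb{S}$. (c) For every $i\in I$, $\mathcal{L}(X/t\mid X_i>t)$ converges weakly to $\mathcal{L}(Y_i)$ as $t\to\infty$ for some random vector $Y_i=(Y_{i,j})_{j=1}^d$ on $\mathbb{S}$. (d) For every $i\in I$ there exists $\nu_i\in\mathcal{M}_{0,i}$ such that $b(t)\,\mathbb{P}(X/t\in\cdot)\to\nu_i$ in $\mathcal{M}_{0,i}$ as $t\to\infty$. (e) There exists $\nu\in\mathcal{M}_{0,I}$ such that $b(t)\,\mathbb{P}(X/t\in\cdot)\to\nu$ in $\mathcal{M}_{0,I}$ as $t\to\infty$. In that case, the limiting objects are connected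 as follows: for all $i\in I$, (i) $Y_i$ is equal in distribution to $Y_{i,i}\Theta_i$, where $\mathcal{L}(Y_{i,i})=\mathrm{Pa}(\alpha)$ and $Y_{i,i}$ and $\Theta_i$ are independent; (ii) $\nu_i$ is equal to the restriction of $\nu$ to $\mathbb{S}_{0,i}$; (iii) $\mathbb{P}(Y_i\in\cdot)=c_i^{-1}\,\nu(\cdot\cap\{x:x_i>1\})$; (iv) for every Borel measurable $f:\mathbb{S}_{0,I}\to[0,\infty]$, $$\int_{\mathbb{S}_{0,I}}f(x)\,\mathbf 1\{x_i>0\}\,\mathrm d\nu(x)=c_i\,\mathbb{E}\left[\int_0^\infty f(z\Theta_i)\,\alpha z^{-\alpha-1}\,\mathrm dz\right].$$
   Context: $\mathcal{L}(Z\mid A)$ denotes the conditional law of $Z$ given the event $A$. A positive, measurable function $b$ defined on a neighbourhood of infinity is regularly varying with index $\tau$ if $b(\lambda t)/b(t)\to\lambda^\tau$ as $t\to\infty$ for all $\lambda>0$. $\mathrm{Pa}(\alpha)$ is the Pareto law on $[1,\infty)$: $\mathbb{P}(Z>z)=z^{-\alpha}$ for $z\ge1$. $\otimes$ denotes product measure. For non-empty $I\subset\{1,\dots,d\}$ and $x\in\mathbb{S}$ write $x_I=(x_i)_{i\in I}$ and $\mathbb{S}_{0,I}=\{x\in\mathbb{S}:\max(x_I)>0\}$. $\mathcal{M}_{0,I}$ is the set of Borel measures $\nu$ on $\mathbb{S}_{0,I}$ such that $\nu(B)<\infty$ for every Borel set $B$ contained in $\{x\in\mathbb{S}:\max(x_I)\ge\varepsilon\}$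 for some $\varepsilon>0$. $\mathcal{C}_{0,I}$ is the set of bounded continuous $f:\mathbb{S}_{0,I}\to\mathbb{R}$ for which there is $\varepsilon>0$ with $f(x)=0$ whenever $\max(x_I)\le\varepsilon$. $\mathcal{M}_{0,I}$ carries the smallest topology making $\nu\mapsto\int f\,\mathrm d\nu$ continuous for all $f\in\mathcal{C}_{0,I}$; convergence in $\mathcal{M}_{0,I}$ is with respect to this topology, and the measures $b(t)\mathbb{P}(X/t\in\cdot)$ are understood as restricted to $\mathbb{S}_{0,I}$. For $I=\{i\}$ one writes $\mathbb{S}_{0,i}$, $\mathcal{M}_{0,i}$, $\mathcal{C}_{0,i}$. *)

(* Defs.v *)
From HB Require Import structures.
From mathcomp Require Import all_boot all_order all_algebra.
From mathcomp Require Import all_classical all_reals all_analysis.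
From mathcomp Require Import measurable_realfun.

Set Implicit Arguments.
Unset Strict Implicit.
Unset Printing Implicit Defensive.

Import Order.TTheory GRing.Theory Num.Theory.
Import numFieldNormedType.Exports.

Local Open Scope classical_set_scope.
Local Open Scope ring_scope.

(** No compatibility is imposed between the two structures; in the instances
    below (R, matrices, and products of these) the sigma-algebra is the Borel
    one. *)
#[short(type="measurableTopologicalType")]
HB.structure Definition MeasurableTopological dT :=
  { T of Measurable dT T & Topological T }.

Definition open_mx (R : realType) (m n : nat) : set (set 'M[R]_(m, n)) :=
  [set U | open U].

HB.instance Definition _ (R : realType) (m n : nat) :=
  @isMeasurable.Build (sigma_display (@open_mx R m n)) 'M[R]_(m, n)
    <<s @open_mx R m n >> (@sigma_algebra0 _ setT _) (@sigma_algebraC _ _)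
    (@sigma_algebra_bigcup _ setT _).

HB.instance Definition _ (R : realType) := Measurable.on R.

HB.instance Definition _ d1 d2 (T1 : measurableTopologicalType d1)
  (T2 : measurableTopologicalType d2) := Measurable.on (T1 * T2)%type.

Section borel_matrix.
Variable R : realType.
Implicit Types d : nat.

Lemma open_measurable_mx m n (U : set 'M[R]_(m, n)) : open U -> measurable U.
Proof. by move=> oU; exact: sub_sigma_algebra. Qed.

Lemma measurable_open_rV dT (T : measurableType dT) m n (f : T -> 'M[R]_(m, n)) :
  (forall U, open U -> measurable (f @^-1` U)) -> measurable_fun setT f.
Proof.
move=> h; apply: (@measurability _ _ _ _ _ f (@open_mx R m n) erefl).
by move=> _ [U oU <-]; rewrite setTI; exact: h.
Qed.

Lemma open_from_nbhs (T : topologicalType) (A : set T) :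
  (forall x, A x -> nbhs x A) -> open A.
Proof. by rewrite openE. Qed.

Lemma measurable_coord d (j : 'I_d) :
  measurable_fun [set: 'rV[R]_d] (fun x => x ord0 j).
Proof.
apply: (measurability _ (RGenOpens.measurableE R)).
move=> _ [_ [a [b ->] <-]]; rewrite setTI; apply: open_measurable_mx.
by apply: open_comp; [move=> x _; exact: coord_continuous|exact: interval_open].
Qed.

Lemma cvg_mx (T : Type) (F : set_system T) {FF : Filter F} m n
    (f : T -> 'M[R]_(m, n)) (M : 'M[R]_(m, n)) :
  (forall i j, f t i j @[t --> F] --> M i j) -> f t @[t --> F] --> M.
Proof.
move=> h A [P PM PA].
have : \forall t \near F, forall i j, P i j (f t i j).
  apply: filter_forall => i; apply: filter_forall => j.
  exact: h (PM i j).
by apply: filterS => t Pt; exact: PA.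
Qed.

Lemma measurable_scale d (a : R) :
  measurable_fun [set: 'rV[R]_d] (fun x => a *: x).
Proof.
apply: measurable_open_rV => U oU; apply: open_measurable_mx.
apply: open_comp => // x _; apply: (@cvg_mx _ (nbhs x) _) => i j.
under eq_fun do rewrite mxE.
rewrite mxE; apply: cvgM; first exact: cvg_cst.
exact: coord_continuous.
Qed.

Lemma measurable_ratio d (i : 'I_d) :
  measurable_fun [set: 'rV[R]_d] (fun x => (x ord0 i)^-1 *: x).
Proof.
apply: measurable_open_rV => U oU.
set f := fun x => _; set D := [set x : 'rV[R]_d | x ord0 i != 0].
have oD : open D.
  apply: (@open_comp _ _ (fun x : 'rV[R]_d => x ord0 i) [set y | y != 0]).
    by move=> x _; exact: coord_continuous.
  exact: open_neq.
have mE : measurable ([set x : 'rV[R]_d | x ord0 i = 0] `&` [set x | U 0]).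
  apply: measurableI; last first.
    have [U0|U0] := pselect (U 0).
      have -> // : [set x : 'rV[R]_d | U 0] = setT by apply/seteqP; split.
    have -> // : [set x : 'rV[R]_d | U 0] = set0 by apply/seteqP; split.
  have -> : [set x : 'rV[R]_d | x ord0 i = 0] = ~` D; last first.
    by apply: measurableC; exact: open_measurable_mx.
  by apply/seteqP; split => x /=; rewrite /D/=; [move=> ->; rewrite eqxx|
    move/negP; rewrite negbK => /eqP].
have -> : f @^-1` U = (D `&` f @^-1` U) `|`
    ([set x : 'rV[R]_d | x ord0 i = 0] `&` [set x | U 0]).
  apply/seteqP; split => x /=; rewrite /f /D/=.
    have [x0|x0] := eqVneq (x ord0 i) 0; last by left.
    by rewrite x0 invr0 scale0r; right.
  by move=> [[]//|[-> ]]; rewrite invr0 scale0r.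
apply: measurableU => //; apply: open_measurable_mx.
apply: open_from_nbhs => x [Dx Ux].
have cf : {for x, continuous f}.
  apply: (@cvg_mx _ (nbhs x) _) => k j; under eq_fun do rewrite mxE.
  rewrite mxE; apply: cvgM; last exact: coord_continuous.
  by apply: cvgV => //; exact: coord_continuous.
apply: filterI; first exact: open_nbhs_nbhs.
by apply: cf; exact: open_nbhs_nbhs.
Qed.

End borel_matrix.


Section maps.
Variables (R : realType) (d : nat).

Definition coord (j : 'I_d) (x : 'rV[R]_d) : R := x ord0 j.

Definition divs (t : R) (x : 'rV[R]_d) : 'rV[R]_d := t^-1 *: x.

(** [self_norm i x] is x / x_i; its value 0 when x_i = 0 plays no role below,
    where it is only used on events {X_i > t} with t > 0. *)
Definition self_norm (i : 'I_d) (x : 'rV[R]_d) : 'rV[R]_d :=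
  divs (coord i x) x.

Definition polar (i : 'I_d) (t : R) (x : 'rV[R]_d) : R * 'rV[R]_d :=
  (coord i x / t, self_norm i x).

HB.instance Definition _ (j : 'I_d) :=
  isMeasurableFun.Build _ _ _ _ (coord j) (@measurable_coord R d j).

HB.instance Definition _ (t : R) :=
  isMeasurableFun.Build _ _ _ _ (divs t) (@measurable_scale R d t^-1).

HB.instance Definition _ (i : 'I_d) :=
  isMeasurableFun.Build _ _ _ _ (self_norm i) (@measurable_ratio R d i).

Lemma measurable_polar i t : measurable_fun setT (polar i t).
Proof.
apply: measurable_fun_pair; last exact: measurable_ratio.
apply: measurable_funM; [exact: measurable_coord|exact: measurable_cst].
Qed.

HB.instance Definition _ (i : 'I_d) (t : R) :=
  isMeasurableFun.Build _ _ _ _ (polar i t) (measurable_polar i t).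

End maps.

Section spaces.
Variables (R : realType) (d : nat).

Definition orthant : set 'rV[R]_d := [set x | forall j, 0 <= x ord0 j].

(** On the orthant the starting value 0 of the iterated maximum is harmless. *)
Definition max_on (I : {set 'I_d}) (x : 'rV[R]_d) : R :=
  \big[Num.max/0]_(i in I) x ord0 i.

Definition S0 (I : {set 'I_d}) : set 'rV[R]_d :=
  orthant `&` [set x | 0 < max_on I x].

Lemma measurable_orthant : measurable orthant.
Proof.
rewrite (_ : orthant = \bigcap_(j in [set: 'I_d]) [set x | 0 <= x ord0 j]).
  apply: fin_bigcap_measurable => // j _.
  have := @measurable_coord R d j measurableT _ (measurable_itv `[0, +oo[).
  rewrite setTI; move=> h; apply: (eq_ind _ measurable h).
  by apply/seteqP; split => x /=; rewrite in_itv/= andbT.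
by apply/seteqP; split => x h j; [move=> _|]; apply: h.
Qed.

Lemma measurable_max_on I : measurable_fun setT (max_on I).
Proof.
rewrite /max_on; elim: (index_enum _) => [|i s IH].
  by under eq_fun do rewrite big_nil; exact: measurable_cst.
under eq_fun do rewrite big_cons.
case: (i \in I) => //.
by apply: measurable_maxr => //; exact: measurable_coord.
Qed.

Lemma measurable_S0 I : measurable (S0 I).
Proof.
apply: measurableI; first exact: measurable_orthant.
have := @measurable_max_on I measurableT _ (measurable_itv `]0, +oo[).
rewrite setTI; move=> h; apply: (eq_ind _ measurable h).
by apply/seteqP; split => x /=; rewrite in_itv/= andbT.
Qed.

End spaces.
Arguments orthant {R d}.
Arguments S0 {R d}.

(** Random vectors with values in the orthant, on an arbitrary probability
    space. *)
Record orvec (R : realType) (d : nat) := Orvec {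
  rv_disp : measure_display;
  rv_space : measurableType rv_disp;
  rv_prob : probability rv_space R;
  rv_fun :> {mfun rv_space >-> 'rV[R]_d};
  rv_orthant : forall w, orthant (rv_fun w) }.

Section laws.
Variables (R : realType) (d : nat).
Implicit Types (X Y Theta : orvec R d) (i : 'I_d) (t : R).

Definition law X : probability 'rV[R]_d R := distribution (rv_prob X) X.

Definition component X i : {RV (rv_prob X) >-> R} :=
  [the {mfun _ >-> _} of coord i \o X].

Definition law_component X i : probability R R :=
  distribution (rv_prob X) (component X i).

Definition survival X i t : R := 1 - fine (cdf (component X i) t).

Definition exceed X i t : set (rv_space X) := [set w | t < X w ord0 i].
Arguments exceed : clear implicits.

Lemma measurable_exceed X i t : measurable (exceed X i t).
Proof.
have := @measurable_funPTI _ _ _ _ (component X i) _ (measurable_itv `]t, +oo[).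
move=> h; apply: (eq_ind _ measurable h).
by apply/seteqP; split => w /=; rewrite in_itv/= andbT.
Qed.

(** The conditional law of g(X) given X_i > t, i.e. the image under g(X) of
    P( . /\ X_i > t) / P(X_i > t).  When P(X_i > t) = 0, [mnormalize] returns
    the unconditional probability; this does not happen for the t that matter,
    as P(X_i > t) is ultimately positive in the theorem. *)
Definition cond_law X i t dT (T : measurableType dT)
    (g : {mfun 'rV[R]_d >-> T}) : probability T R :=
  distribution
    (mnormalize (mrestr (rv_prob X) (@measurable_exceed X i t)) (rv_prob X))
    [the {mfun _ >-> _} of g \o X].

End laws.
Arguments exceed {R d} X i t.

(** Weak convergence on the subspace E, as t tends to infinity, of a family of
    laws on E, encoded as measures on the ambient space; the values of the test
    function f outside E are irrelevant. *)
Definition weak_cvg (R : realType) dT (T : measurableTopologicalType dT)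
    (E : set T) (mu_ : R -> {measure set T -> \bar R})
    (mu : {measure set T -> \bar R}) : Prop :=
  forall f : T -> R, {within E, continuous f} ->
    (exists M, forall x, E x -> `|f x| <= M) ->
  (\int[mu_ t]_(x in E) f x) @[t --> +oo] --> \int[mu]_(x in E) f x.

Section pareto.
Variable R : realType.

Definition pareto_quantile (alpha : R) (u : measurableTypeR R) : R :=
  u `^ (- alpha^-1).

HB.instance Definition _ (alpha : R) :=
  isMeasurableFun.Build _ _ _ _ (pareto_quantile alpha)
    (@measurable_powR R (- alpha^-1)).

(** The Pareto law, realized as the law of U^(-1/alpha) with U uniform on
    [0, 1]; see [pareto_survival]. *)
Definition pareto (alpha : R) : probability R R :=
  distribution (uniform_prob (@ltr01 R)) (pareto_quantile alpha).

Let one_powR (alpha : R) : 1 `^ alpha = 1. Proof. by rewrite powR1. Qed.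

Lemma pareto_quantile_gt (alpha z u : R) : 0 < alpha -> 0 < z -> 0 < u ->
  (z < pareto_quantile alpha u) = (u < z `^ (- alpha)).
Proof.
move=> a0 z0 u0; rewrite /pareto_quantile !powRN.
set w := u `^ alpha^-1; have w0 : 0 < w by exact: powR_gt0.
have -> : u = w `^ alpha by rewrite -powRrM mulVf ?gt_eqF// powRr1// ltW.
rewrite -[w^-1]div1r -[(_ `^ _)^-1]div1r !ltr_pdivlMr ?powR_gt0//.
rewrite -powRM ?(ltW z0) ?(ltW w0)// [w * z]mulrC.
have zw0 : 0 <= z * w by rewrite mulr_ge0// ltW.
apply/idP/idP => [zw|]; last first.
  apply: contraTT; rewrite -!leNgt => zw.
  by rewrite -(one_powR alpha); apply: ge0_ler_powR; rewrite ?nnegrE// ltW.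
by rewrite -[ltRHS](one_powR alpha); apply: gt0_ltr_powR => //; rewrite nnegrE.
Qed.

Lemma pareto_survival (alpha z : R) : 0 < alpha -> 1 <= z ->
  pareto alpha [set y | z < y] = (z `^ (- alpha))%:E.
Proof.
move=> a0 z1; have z0 : 0 < z by exact: lt_le_trans z1.
have za1 : z `^ (- alpha) <= 1.
  rewrite powRN invf_le1 ?powR_gt0//.
  by rewrite -(one_powR alpha); apply: ge0_ler_powR; rewrite ?nnegrE// ltW.
rewrite /pareto /distribution /pushforward /=.
rewrite /uniform_prob integral_uniform_pdf.
set D := (X in integral _ X).
have -> : D = `]0, z `^ (- alpha)[%classic.
  apply/seteqP; split => u; rewrite /D/= !in_itv/=.
    move=> [+ /andP[+ u1]]; rewrite le_eqVlt => + /predU1P[u0|u0].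
      rewrite -u0 /pareto_quantile powR0 ?oppr_eq0 ?invr_eq0 ?gt_eqF//.
      by rewrite ltNge ltW.
    by rewrite pareto_quantile_gt// u0.
  move=> /andP[u0 uz]; rewrite pareto_quantile_gt// (ltW u0); split => //=.
  exact: le_trans (ltW uz) za1.
rewrite (eq_integral (cst 1%E)); last first.
  move=> u; rewrite inE/= in_itv/= => /andP[u0 uz].
  by rewrite /uniform_pdf subr0 invr1 (ltW u0)/= (le_trans (ltW uz) za1).
rewrite integral_cst//= mul1e lebesgue_measure_itv/= lte_fin powR_gt0//.
by rewrite oppr0 adde0.
Qed.

End pareto.

(** A positive measurable function on a neighbourhood of infinity is given by a
    total function, restricted to some half-line. *)
Definition regularly_varying (R : realType) (b : R -> R) (tau : R) : Prop :=
  (exists a : R, measurable_fun `]a, +oo[ b /\ forall t, a < t -> 0 < b t) /\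
  (forall lambda, 0 < lambda ->
    b (lambda * t) / b t @[t --> +oo] --> lambda `^ tau).

Section M0.
Variables (R : realType) (d : nat).
Implicit Types I : {set 'I_d}.

(** Measures on S0 I are encoded as measures on R^d that vanish outside
    S0 I. *)
Record M0 I := MkM0 {
  m0_measure :> {measure set 'rV[R]_d -> \bar R};
  m0_carrier : m0_measure (~` S0 I) = 0%E;
  m0_finite : forall (B : set 'rV[R]_d) (e : R), measurable B -> 0 < e ->
    B `<=` orthant `&` [set x | e <= max_on I x] -> (m0_measure B < +oo)%E }.

(** Only the restriction of [c0_fun] to S0 I matters. *)
Record C0 I := MkC0 {
  c0_fun :> 'rV[R]_d -> R;
  c0_continuous : {within S0 I, continuous c0_fun};
  c0_bounded : exists M, forall x, S0 I x -> `|c0_fun x| <= M;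
  c0_vanish : exists2 e : R, 0 < e &
    forall x, S0 I x -> max_on I x <= e -> c0_fun x = 0 }.

Definition m0_integral I (f : C0 I) (nu : M0 I) : R :=
  \int[nu]_(x in S0 I) f x.

HB.instance Definition _ I := gen_eqMixin (M0 I).
HB.instance Definition _ I := gen_choiceMixin (M0 I).

(** The smallest topology making all maps [m0_integral f] continuous. *)
HB.instance Definition _ I := Topological.copy (M0 I)
  (sup_topology (fun f : C0 I =>
    Topological.on (initial_topology (@m0_integral I f)))).

Section restrict.
Variables (I : {set 'I_d}) (mu : {finite_measure set 'rV[R]_d -> \bar R}).

Let restr : {measure set 'rV[R]_d -> \bar R} := mrestr mu (measurable_S0 I).

Lemma restr_carrier : restr (~` S0 I) = 0%E.
Proof. by rewrite /restr/= /mrestr setICl measure0. Qed.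

Lemma restr_finite (B : set 'rV[R]_d) (e : R) : measurable B -> 0 < e ->
  B `<=` orthant `&` [set x | e <= max_on I x] -> (restr B < +oo)%E.
Proof.
move=> mB _ _; rewrite /restr/= /mrestr ltey_eq fin_num_measure//.
by apply: measurableI => //; exact: measurable_S0.
Qed.

Definition m0_restrict : M0 I := MkM0 restr_carrier restr_finite.

End restrict.

(** The measure b(t) P(X/t in . ) restricted to S0 I.  The absolute value is
    there to have a measure for all t; b is positive near infinity. *)
Definition scaled_law (X : orvec R d) (b : R -> R) I (t : R) : M0 I :=
  m0_restrict I (mscale `|b t|%:nng
    (distribution (rv_prob X) [the {mfun _ >-> _} of divs t \o X])).

End M0.

Section modes.
Variables (R : realType) (d : nat).
Implicit Types (X Y Theta : orvec R d) (i : 'I_d) (b : R -> R) (alpha : R).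

Definition cvg_self_norm X i Theta : Prop :=
  weak_cvg orthant (fun t => cond_law X i t (self_norm i)) (law Theta).

Definition cvg_polar X alpha i Theta : Prop :=
  @weak_cvg R _ (R * 'rV[R]_d)%type ([set z | 0 <= z] `*` orthant)
    (fun t => cond_law X i t (polar i t)) (pareto alpha \x law Theta)%E.

Definition cvg_exceed X i Y : Prop :=
  weak_cvg orthant (fun t => cond_law X i t (divs t)) (law Y).

Definition cvg_M0 X b (I : {set 'I_d}) (nu : M0 R I) : Prop :=
  scaled_law X b I t @[t --> +oo] --> nu.

End modes.

(* Main.v *)
(** Write V = X / X_i. Since
    P(X_i > zt, V in B | X_i > t) is the product of P(V in B | X_i > zt) and of
    P(X_i > zt) / P(X_i > t), which tends to z^(-alpha), weak convergence of V
    alone implies that of (X_i / t, V), with independent limits: the test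
    function is approximated from below by functions that are piecewise constant
    in the first variable, and complementing it gives the other inequality. The
    continuous map (u, v) |-> u v gives the limit of X / t, from which V is
    recovered by x |-> x / max(1, x_i). A test function g on S0 {i} vanishes for
    x_i <= e, so that b(t) E g(X / t) = b(t) P(X_i > et) E[g(X / t) | X_i > et]
    has a limit, expressed with the measure alpha z^(-alpha-1) dz times the law
    of Theta_i. Conversely, the indicator of x_i > 1 is replaced by a continuous
    ramp, at a cost controlled by the tail of X_i. Limits on S0 {i} and S0 J
    agree on the intersection and are glued with a cutoff function of x_i. *)

From HB Require Import structures.
Require Import Defs.
From mathcomp Require Import all_boot all_order all_algebra.
From mathcomp Require Import all_classical all_reals all_analysis.
From mathcomp Require Import measurable_realfun.
From mathcomp Require Import ring lra.

Import Order.TTheory GRing.Theory Num.Theory.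
Import numFieldNormedType.Exports.

Local Open Scope classical_set_scope.
Local Open Scope ring_scope.

Set Implicit Arguments.
Unset Strict Implicit.
Unset Printing Implicit Defensive.

(** * Uniqueness of measures *)

(** Weak convergence is handled through bounded continuous functions on the whole space, and
    convergence in [M0] through continuous functions vanishing where [max_on] is small. Two
    obstacles shape the proof. The sigma-algebra of [R * V] is the product one, so that even
    continuous functions on it must be shown measurable. And convergence of integrals does not by
    itself produce a limit, so each limit is constructed, mostly as the image of a known measure.
    The measure alpha z^(-alpha-1) dz is infinite near 0, but it is self-similar: above a level e it
    is e^(-alpha) times the Pareto law scaled by e. Integrals of test functions thus become
    integrals against a probability. That the i-th coordinate of Theta_i is 1 almost surely is
    inherited from X_i / X_i = 1; it makes z the i-th coordinate of z Theta_i, whence the finiteness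
    of nu_i and the Pareto law of Y_{i,i}. Limits are identified by one uniqueness statement, for
    measures finite on {w > e} with w continuous: w = 1 for laws, and the minimum of two [max_on]
    for limits on two spaces. *)

Section continuous_real_functions.
Context {R : realType} {T : topologicalType}.
Implicit Types f g : T -> R.

Lemma ctsD f g : continuous f -> continuous g -> continuous (fun x => f x + g x).
Proof. by move=> cf cg x; apply: cvgD; [exact: cf|exact: cg]. Qed.

Lemma ctsB f g : continuous f -> continuous g -> continuous (fun x => f x - g x).
Proof. by move=> cf cg x; apply: cvgB; [exact: cf|exact: cg]. Qed.

Lemma ctsM f g : continuous f -> continuous g -> continuous (fun x => f x * g x).
Proof. by move=> cf cg x; apply: cvgM; [exact: cf|exact: cg]. Qed.

Lemma cts_min f g :
  continuous f -> continuous g -> continuous (fun x => Num.min (f x) (g x)).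
Proof. by move=> cf cg x; apply: continuous_min; [exact: cf|exact: cg]. Qed.

Lemma cts_max f g :
  continuous f -> continuous g -> continuous (fun x => Num.max (f x) (g x)).
Proof. by move=> cf cg x; apply: continuous_max; [exact: cf|exact: cg]. Qed.

Lemma ctsV f : (forall x, f x != 0) -> continuous f -> continuous (fun x => (f x)^-1).
Proof. by move=> f0 cf x; apply: cvgV => //; exact: cf. Qed.

Lemma cts_scale d (s : T -> R) (f : T -> 'rV[R]_d) :
  continuous s -> continuous f -> continuous (fun x => s x *: f x).
Proof.
move=> cs cf x; apply: (@cvg_mx _ _ (nbhs x) _) => i j; under eq_fun do rewrite mxE.
rewrite mxE; apply: cvgM; first exact: cs.
by apply: (cvg_comp f (fun y : 'rV[R]_d => y i j)); [exact: cf|exact: coord_continuous].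
Qed.

End continuous_real_functions.

Section continuous_comp_pair.
Context {S T U : topologicalType}.

Lemma cts_comp (f : S -> T) (g : T -> U) :
  continuous f -> continuous g -> continuous (fun x => g (f x)).
Proof. by move=> cf cg x; apply: continuous_comp; [exact: cf|exact: cg]. Qed.

Lemma cts_pair (f : S -> T) (g : S -> U) :
  continuous f -> continuous g -> continuous (fun x => (f x, g x)).
Proof. by move=> cf cg x; apply: cvg_pair; [exact: cf|exact: cg]. Qed.

Lemma cts_fst : continuous (@fst S T). Proof. by move=> x; exact: cvg_fst. Qed.

Lemma cts_snd : continuous (@snd S T). Proof. by move=> x; exact: cvg_snd. Qed.

Lemma cts_id : continuous (fun x : S => x). Proof. by move=> x; exact: cvg_id. Qed.

End continuous_comp_pair.

Section continuous_functions.
Context {R : realType} {d : nat}.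
Local Notation V := 'rV[R]_d.

Lemma continuous_measurable_rV (f : V -> R) :
  continuous f -> measurable_fun setT f.
Proof.
move=> cf; apply: (measurability _ (RGenOpens.measurableE R)).
move=> _ [_ [a [b ->] <-]]; rewrite setTI; apply: open_measurable_mx.
by apply: open_comp; [move=> x _; exact: cf|exact: interval_open].
Qed.

Lemma continuous_measurable_rV2 (f : V -> V) :
  continuous f -> measurable_fun setT f.
Proof.
move=> cf; apply: measurable_open_rV => U oU; apply: open_measurable_mx.
by apply: open_comp => // x _; exact: cf.
Qed.

(** [rho] is the distance to the complement of [U]. The distance used takes extended real values and
    has to be shown finite; the empty complement, over which the infimum is +oo, is therefore a
    separate case. *)
Lemma open_gt0P (U : set V) : open U -> exists rho : V -> R,
  [/\ continuous rho, (forall x, 0 <= rho x) & U = [set x | 0 < rho x]].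
Proof.
move=> oU; have [UT|/set0P[a Ua]] := eqVneq (~` U) set0.
  exists (fun=> 1); split=> [|x|]; [exact: cst_continuous|exact: ler01|].
  by rewrite -[U]setCK UT setC0; apply/seteqP; split => // x _; exact: ltr01.
have efin (x y : V) : edist (x, y) \is a fin_num.
  apply/edist_finP => /=; set M := \sum_i `|x ord0 i - y ord0 i|.
  have M0 : 0 <= M by exact: sumr_ge0.
  exists (M + 1); first by rewrite ltr_wpDl.
  split=> [|i j]; first by rewrite ltr_wpDl.
  rewrite /ball/= (ord1 i); apply: (@le_lt_trans _ _ M); last by rewrite ltrDl.
  by rewrite /M (bigD1 j)//= lerDl sumr_ge0.
have dfin (x : V) : edist_inf (~` U) x \is a fin_num.
  rewrite ge0_fin_numE ?edist_inf_ge0//; apply: le_lt_trans.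
    by apply: ereal_inf_lbound; exists a.
  by rewrite ltey_eq efin.
exists (fun x => fine (edist_inf (~` U) x)); split => [x|x|].
- apply: (@fine_cvg _ _ (nbhs x) _ (edist_inf (~` U))); rewrite fineK//.
  exact: edist_inf_continuous.
- by rewrite fine_ge0// edist_inf_ge0.
- apply/seteqP; split => x /=; last first.
    by move=> x0; apply: contrapT => Ux; rewrite edist_inf0 ?ltxx in x0.
  move=> Ux; have /nbhs_ballP[e /= e0 eU] : nbhs x U by exact: open_nbhs_nbhs.
  rewrite -lte_fin fineK//; apply: (@lt_le_trans _ _ e%:E); first by rewrite lte_fin.
  apply: le_ereal_inf_tmp => _ [y Uy <-]; rewrite leNgt; apply/negP => /edist_lt_ball.
  by move/eU.
Qed.

End continuous_functions.

Section monotone_limits.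
Context {dT} {T : measurableType dT} {R : realType}.
Variable mu : {measure set T -> \bar R}.

Lemma integrable_bounded (D : set T) (f : T -> R) :
  measurable D -> (mu D < +oo)%E -> measurable_fun D f ->
  (exists M, forall x, D x -> `|f x| <= M) -> mu.-integrable D (EFin \o f).
Proof.
move=> mD Dfin mf [M fM]; apply: measurable_bounded_integrable => //.
exists M; split; first exact: num_real.
by move=> N MN x Dx /=; apply: (le_trans (fM _ Dx)); exact: ltW.
Qed.

Lemma bounded_cvg_Rintegral (D : set T) (f_ : nat -> T -> R) (f : T -> R) (M : R) :
  measurable D -> (mu D < +oo)%E -> (forall n, measurable_fun D (f_ n)) ->
  (forall n x, D x -> `|f_ n x| <= M) ->
  (forall x, D x -> f_ n x @[n --> \oo] --> f x) ->
  (\int[mu]_(x in D) f_ n x) @[n --> \oo] --> \int[mu]_(x in D) f x.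
Proof.
move=> mD Dfin mf_ fM cf.
have mf : measurable_fun D f by exact: measurable_fun_cvg cf.
have fM' x : D x -> `|f x| <= M.
  move=> Dx; have cfx : `|f_ n x| @[n --> \oo] --> `|f x| by apply: cvg_norm; exact: cf.
  rewrite -(cvg_lim _ cfx)//; apply: limr_le; first by apply/cvg_ex; exists `|f x|.
  by near=> n; exact: fM.
have intf : mu.-integrable D (EFin \o f) by apply: integrable_bounded => //; exists M.
apply: fine_cvg; rewrite fineK ?integrable_fin_num//.
apply: (@dominated_cvg _ _ _ _ _ _ _ _ (cst M%:E)) => //.
- by move=> n; apply/measurable_EFinP.
- by move=> x Dx; apply: cvg_EFin; [exact: nearW|exact: cf].
- by apply: (integrable_bounded (f := cst M)) => //; exists `|M|.
Unshelve. all: by end_near. Qed.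

(** Continuity from below. It carries equalities known on the sets {w > e}, where the measures to be
    compared are finite, over to {w > 0}, where they may be infinite. *)
Lemma measure_bigcup_gt0 (w : T -> R) (B : set T) :
  measurable_fun setT w -> measurable B ->
  mu (B `&` [set x | k.+1%:R^-1 < w x]) @[k --> \oo] -->
  mu (B `&` [set x | 0 < w x]).
Proof.
move=> mw mB.
have mW a : measurable [set x | a < w x].
  rewrite (_ : [set x | _] = w @^-1` `]a, +oo[); last first.
    by apply/seteqP; split => x /=; rewrite in_itv/= andbT.
  by rewrite -[X in measurable X]setTI; exact: mw.
have -> : B `&` [set x | 0 < w x] = \bigcup_k (B `&` [set x | k.+1%:R^-1 < w x]).
  rewrite -setI_bigcupr; congr (_ `&` _); apply/seteqP; split => x /=.
    move=> w0; exists (Num.trunc (w x)^-1) => //=.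
    rewrite invf_plt ?posrE//.
    exact: truncnS_gt.
  by move=> [k _ /=]; apply: lt_trans; rewrite invr_gt0.
apply: nondecreasing_cvg_mu.
- by move=> k; exact: measurableI.
- by apply: bigcupT_measurable => k; exact: measurableI.
- move=> m n mn; apply/subsetPset; apply: setIS => x /=.
  by apply: le_lt_trans; rewrite lef_pV2 ?posrE// ler_nat.
Qed.

End monotone_limits.

Definition mpush {d1 d2} {T1 : measurableType d1} {T2 : measurableType d2}
    {R : realType} (mu : {measure set T1 -> \bar R}) (f : T1 -> T2)
    (mf : measurable_fun setT f) : {measure set T2 -> \bar R} :=
  measure_function_pushforward__canonical__measure_function_Measure mu mf.

Section integral_mrestr.
Context {dT} {T : measurableType dT} {R : realType}.
Variable mu : {measure set T -> \bar R}.

Lemma ge0_integral_mrestr (A D : set T) (mA : measurable A) (f : T -> \bar R) :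
  measurable D -> measurable_fun D f -> (forall x, D x -> (0 <= f x)%E) ->
  (\int[mrestr mu mA]_(x in D) f x = \int[mu]_(x in D `&` A) f x)%E.
Proof.
move=> mD mf f0; rewrite [LHS](@ge0_negligible_integral _ _ _ _ _ (~` A))//; first last.
- by rewrite /= /mrestr setICl measure0.
- exact: measurableC.
rewrite setDE setCK; apply: eq_measure_integral => B mB BDA.
by rewrite /= /mrestr setIidl// => x /BDA[].
Qed.

End integral_mrestr.

Section uniqueness.
Context {R : realType} {d : nat}.
Local Notation V := 'rV[R]_d.
Implicit Types mu : {measure set V -> \bar R}.

Lemma cvg_minn1 (a : R) : 0 <= a ->
  Num.min 1 (n%:R * a) @[n --> \oo] --> ((0 < a)%R%:R : R).
Proof.
rewrite le_eqVlt => /predU1P[<-|a0].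
  by rewrite ltxx/=; under eq_fun do rewrite mulr0 min_r//; exact: cvg_cst.
rewrite a0; apply: cvg_near_cst; near=> n; rewrite min_l//.
rewrite -ler_pdivrMr// mul1r; near: n; exact: nbhs_infty_ger.
Unshelve. all: by end_near. Qed.

(** The functions [min 1 (n rho) * min 1 (n (w - e)^+)] converge to the indicator
    of [U `&` {w > e}], where [U = {rho > 0}] is open. *)
Lemma measure_unique_continuous (w : V -> R) mu1 mu2 :
  continuous w ->
  (forall e, 0 < e -> (mu1 [set x | (e < w x)%R] < +oo)%E) ->
  (forall e, 0 < e -> (mu2 [set x | (e < w x)%R] < +oo)%E) ->
  (forall f : V -> R, continuous f -> (forall x, 0 <= f x <= 1) ->
    (exists2 e, 0 < e & forall x, w x <= e -> f x = 0) ->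
    \int[mu1]_x f x = \int[mu2]_x f x) ->
  forall B, measurable B ->
    mu1 (B `&` [set x | 0 < w x]) = mu2 (B `&` [set x | 0 < w x]).
Proof.
move=> cw fin1 fin2 eqf.
have oW (e : R) : open [set x | e < w x].
  apply: (@open_comp _ _ w [set y | e < y]); last exact: open_gt.
  by move=> x _; exact: cw.
have mW (e : R) : measurable [set x | e < w x] by exact: open_measurable_mx.
have eqU (e : R) (U : set V) : 0 < e -> open U ->
    mu1 (U `&` [set x | e < w x]) = mu2 (U `&` [set x | e < w x]).
  move=> e0 oU; have [rho [crho rho0 UE]] := open_gt0P oU.
  pose f (n : nat) x := Num.min 1 (n%:R * rho x) * Num.min 1 (n%:R * Num.max 0 (w x - e)).
  have cf n : continuous (f n).
    apply: ctsM; apply: cts_min; try exact: cst_continuous; apply: ctsM => //;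
      try exact: cst_continuous; apply: cts_max; try exact: cst_continuous.
    by apply: ctsB => //; exact: cst_continuous.
  have f01 n x : 0 <= f n x <= 1.
    have M0 : 0 <= Num.max 0 (w x - e) by rewrite le_max lexx.
    rewrite mulr_ge0 ?le_min ?ler01 ?mulr_ge0//=.
    by rewrite mulr_ile1 ?le_min ?ler01 ?mulr_ge0 ?ge_min ?lexx.
  have f0 n x : w x <= e -> f n x = 0.
    by move=> we; rewrite /f [Num.max _ _]max_l ?subr_le0// mulr0 [X in _ * X]min_r ?mulr0.
  have key mu : (mu [set x | (e < w x)%R] < +oo)%E ->
      fine (mu (U `&` [set x | e < w x])) =
      lim ((\int[mu]_(x in [set x | e < w x]) f n x) @[n --> \oo]).
    move=> fin; apply/esym/cvg_lim => //.
    have -> : fine (mu (U `&` [set x | e < w x])) =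
        \int[mu]_(x in [set x | e < w x]) (\1_U x).
      by rewrite /Rintegral integral_indic//; exact: open_measurable_mx.
    apply: (@bounded_cvg_Rintegral _ _ _ _ _ _ _ 1) => //.
    - by move=> n; apply: measurable_funTS; exact: continuous_measurable_rV.
    - by move=> n x _; have /andP[? ?] := f01 n x; rewrite ger0_norm.
    - move=> x /= ewx; rewrite (_ : \1_U x = ((0 < rho x)%R%:R : R) *
          ((0 < Num.max 0 (w x - e))%R%:R)); last first.
        rewrite lt_max ltxx subr_gt0 ewx mulr1 indicE; congr (_%:R : R); congr nat_of_bool.
        by apply/idP/idP; rewrite UE inE.
      by apply: cvgM; apply: cvg_minn1 => //; rewrite le_max lexx.
  have fU mu : (mu [set x | (e < w x)%R] < +oo)%E ->
      mu (U `&` [set x | e < w x]) \is a fin_num.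
    move=> fin; rewrite ge0_fin_numE// (le_lt_trans _ fin)//.
    by apply: le_measure; rewrite ?inE//; apply: measurableI => //; exact: open_measurable_mx.
  have [F1 F2] := (fin1 e e0, fin2 e e0).
  rewrite -[LHS]fineK ?fU// -[RHS]fineK ?fU// key// key//.
  congr (limn _)%:E; apply/funext => n.
  have restr mu : \int[mu]_(x in [set x | e < w x]) f n x = \int[mu]_x f n x.
    rewrite Rintegral_mkcond; apply: eq_Rintegral => x _; rewrite patchE.
    by case: ifPn => //; rewrite notin_setE/= => /negP; rewrite -leNgt => /f0 ->.
  by rewrite !restr; apply: eqf => //; exists e => //; exact: f0.
move=> B mB.
(* Restricted to {w > e} both measures are finite, so the open sets, a generating class stable under
   intersection, determine them. It then remains to let e run through 1 / (k + 1). *)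
have eqB (e : R) : 0 < e -> mu1 (B `&` [set x | e < w x]) = mu2 (B `&` [set x | e < w x]).
  move=> e0; rewrite -!/(mrestr _ (mW e) B).
  apply: (measure_unique (@open_mx R 1 d) (fun=> setT)) => //.
  - by move=> U1 U2; exact: openI.
  - by move=> _; exact: openT.
  - by rewrite bigcup_const.
  - by move=> U oU; rewrite /= /mrestr; exact: eqU.
  - by move=> _; rewrite /= /mrestr setTI; exact: fin1.
have mw := continuous_measurable_rV cw.
have := @measure_bigcup_gt0 _ _ _ mu2 _ _ mw mB.
under eq_fun do rewrite -eqB ?invr_gt0//.
move=> h2; have h1 := @measure_bigcup_gt0 _ _ _ mu1 _ _ mw mB.
exact: (cvg_unique _ h1 h2).
Qed.

End uniqueness.

(** * Product with the real line and densities *)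

Section product_with_line.
Context {R : realType} {d : nat}.
Local Notation V := 'rV[R]_d.

(** A function continuous on [R * V] is the pointwise limit of the functions
    [(u, y) |-> h (floor (n u) / n, y)]. *)
Lemma continuous_measurable_prod (h : R * V -> R) :
  continuous h -> measurable_fun setT h.
Proof.
move=> ch; pose r n (u : R) : R := (Num.floor (n.+1%:R * u))%:~R / n.+1%:R.
apply: (@measurable_fun_cvg _ _ _ _ (fun n z => h (r n z.1, z.2))).
  move=> n _ A mA; rewrite setTI.
  (* Once the first variable is rounded, the preimage is a countable union of rectangles, one for
     each cell, and so belongs to the product sigma-algebra. *)
  rewrite (_ : _ @^-1` _ = \bigcup_(k : int)
     ([set u | Num.floor (n.+1%:R * u) = k] `*`
      [set y | A (h (k%:~R / n.+1%:R, y))])); last first.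
    apply/seteqP; split=> [[u y] /= Ah|[u y] [k _ [/= <-]]//].
    by exists (Num.floor (n.+1%:R * u)).
  apply: countable_bigcupT_measurable; first exact: countableP.
  move=> k; apply: measurableX.
    rewrite (_ : [set u | _] = `[k%:~R / n.+1%:R, (k + 1)%:~R / n.+1%:R[%classic)//.
    apply/seteqP; split=> u /=; rewrite in_itv/= ler_pdivrMr// ltr_pdivlMr// [u * _]mulrC.
      by move=> <-; rewrite floor_le_tmp floorD1_gt.
    by move=> ku; apply/eqP; rewrite floor_eq.
  have mhk : measurable_fun setT (fun y => h (k%:~R / n.+1%:R, y)).
    apply: continuous_measurable_rV.
    apply: (cts_comp (f := fun y : V => (k%:~R / n.+1%:R : R, y))) => //.
    by apply: cts_pair; [exact: cst_continuous|exact: cts_id].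
  by rewrite -[X in measurable X]setTI; exact: mhk.
move=> [u y] _; apply: (@cvg_comp _ _ _ (fun n => (r n u, y)) h _ (nbhs (u, y)));
  last exact: ch.
apply: (@cvg_pair _ _ _ _ (nbhs u) (nbhs y)); last exact: cvg_cst.
apply/cvgrPdist_le => e e0; near=> n; rewrite /r.
rewrite -[u in u - _](mulKf (_ : n.+1%:R != 0))// mulrC -mulrBl normrM.
rewrite [X in _ * X]ger0_norm// ler_pdivrMr//.
apply: (@le_trans _ _ 1).
  rewrite ger0_norm ?subr_ge0 ?floor_le_tmp// lerBlDl.
  by rewrite ltW// -[X in _ + X]/(1%:~R) -intrD floorD1_gt.
rewrite mulrC -ler_pdivrMr// div1r.
apply: (@le_trans _ _ n%:R); last by rewrite ler_nat.
near: n; exact: nbhs_infty_ger.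
Unshelve. all: by end_near. Qed.

Definition scale2 (z : R * V) : V := z.1 *: z.2.

Lemma continuous_scale2 : continuous scale2.
Proof. by apply: cts_scale; [exact: cts_fst|exact: cts_snd]. Qed.

(** [continuous_measurable_prod] concerns real-valued functions; writing an open set of [V] as {rho
    > 0} reduces the vector-valued map to that case. *)
Lemma measurable_scale2 : measurable_fun setT scale2.
Proof.
apply: measurable_open_rV => U oU.
have [rho [crho _ ->]] := open_gt0P oU.
have mh : measurable_fun setT (fun z : R * V => rho (scale2 z)).
  by apply: continuous_measurable_prod; apply: cts_comp => //; exact: continuous_scale2.
rewrite (_ : _ @^-1` _ = (fun z : R * V => rho (scale2 z)) @^-1` `]0, +oo[).
  by rewrite -[X in measurable X]setTI; exact: mh.
by apply/seteqP; split=> z /=; rewrite in_itv/= andbT.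
Qed.

HB.instance Definition _ :=
  isMeasurableFun.Build _ _ _ _ scale2 measurable_scale2.

End product_with_line.

Section density.
Context {R : realType}.
Variables (g : R -> R) (mg : measurable_fun setT g).
Local Notation leb := (@lebesgue_measure R).

(** The measure with density [g^+], as the image of the Lebesgue measure of the
    plane restricted to the region below the graph of [g]. *)
Definition subgraph : set (measurableTypeR R * measurableTypeR R) :=
  [set z | 0 < z.2 < g z.1].

Lemma measurable_subgraph : measurable subgraph.
Proof.
have m2 : measurable_fun setT (snd : measurableTypeR R * measurableTypeR R -> R).
  exact: measurable_snd.
have mg1 : measurable_fun setT (fun z : measurableTypeR R * measurableTypeR R => g z.1).
  by apply: measurableT_comp => //; exact: measurable_fst.
rewrite (_ : subgraph = [set z | 0 < z.2] `&` [set z | z.2 < g z.1]); last first.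
  by apply/seteqP; split=> z /=; [move=> /andP|move=> [? ?]; apply/andP].
apply: measurableI.
  have := measurable_fun_ltr (@measurable_cst _ _ _ _ setT (0 : R)) m2.
  by move=> /(_ measurableT [set true]); rewrite setTI; exact.
have := measurable_fun_ltr m2 mg1.
by move=> /(_ measurableT [set true]); rewrite setTI; exact.
Qed.

Definition abscissa (z : measurableTypeR R * measurableTypeR R) : R := z.1.

Lemma measurable_abscissa : measurable_fun setT abscissa.
Proof. exact: measurable_fst. Qed.

Let mdens : {measure set R -> \bar R} :=
  mpush (mrestr (leb \x leb)%E measurable_subgraph) measurable_abscissa.

Definition mdensity : set R -> \bar R := mdens.

HB.instance Definition _ := isMeasure.Build _ _ _ mdensity
  (measure0 mdens) (measure_ge0 mdens) (@measure_semi_sigma_additive _ _ _ mdens).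

(** Over the points with |x| <= n and g x <= n, the subgraph lies in the rectangle [-n, n] x [0, n].
    Sigma-finiteness is what allows products with the law of Theta and Tonelli's theorem. *)
Lemma mdensity_sigma_finite : sigma_finite setT mdensity.
Proof.
exists (fun n => `[- n%:R, n%:R]%classic `&` g @^-1` `]-oo, n%:R]%classic).
  apply/seteqP; split=> // x _; exists (Num.truncn (Num.max `|x| (g x))).+1 => //=.
  rewrite !in_itv/= -ler_norml.
  have := ltW (truncnS_gt (Num.max `|x| (g x))).
  by rewrite ge_max => /andP[].
move=> n.
have mgn : measurable (g @^-1` `]-oo, n%:R]%classic).
  by rewrite -[X in measurable X]setTI; exact: mg.
have mF : measurable (`[- n%:R, n%:R]%classic `&` g @^-1` `]-oo, n%:R]%classic).
  exact: measurableI.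
split => //.
apply: (@le_lt_trans _ _ ((leb \x leb)%E
    ((`[- n%:R, n%:R]%classic : set R) `*` (`[0, n%:R]%classic : set R)))).
  set F := (X in mdensity X).
  rewrite -[mdensity F]/((leb \x leb)%E (abscissa @^-1` F `&` subgraph)).
  apply: (@le_measure _ _ _ (leb \x leb)%E).
  - rewrite inE; apply: measurableI; last exact: measurable_subgraph.
    by rewrite -[X in measurable X]setTI; exact: measurable_abscissa.
  - by rewrite inE; apply: measurableX; exact: measurable_itv.
  - move=> [x y] [[/= xn]]; rewrite in_itv/= => gn /andP[y0 yg].
    split => //=; rewrite in_itv/=; apply/andP; split; first exact: ltW.
    exact: le_trans (ltW yg) gn.
have fin (a b : R) : (leb `[a, b]%classic < +oo)%E.
  by rewrite lebesgue_measure_itv/=; case: ifPn => _; rewrite ?ltry// -EFinD ltry.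
rewrite product_measure1E//; apply: lte_mul_pinfty => //; last exact: fin.
by rewrite ge0_fin_numE// fin.
Qed.

HB.instance Definition _ :=
  Measure_isSigmaFinite.Build _ _ _ mdensity mdensity_sigma_finite.

(** Tonelli's theorem in the plane: the section of the subgraph over x is the interval ]0, g x[, of
    length g x when g x >= 0. *)
Lemma ge0_integral_mdensity (D : set R) (f : R -> \bar R) :
  measurable D -> measurable_fun D f -> (forall x, D x -> (0 <= f x)%E) ->
  (forall x, D x -> 0 <= g x) ->
  (\int[mdensity]_(x in D) f x = \int[leb]_(x in D) (f x * (g x)%:E))%E.
Proof.
move=> mD mf f0 g0.
have mfst : measurable (abscissa @^-1` D).
  by rewrite -[X in measurable X]setTI; exact: measurable_fst.
have mff : measurable_fun setT (fun z : measurableTypeR R * measurableTypeR R =>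
    (f \_ D) z.1 * (\1_subgraph z)%:E)%E.
  apply: emeasurable_funM.
    apply: measurableT_comp; last exact: measurable_fst.
    exact/(measurable_restrictT _ _).1.
  by apply/measurable_EFinP; exact: (measurable_indic measurable_subgraph).
have fD0 x : (0 <= (f \_ D) x)%E by rewrite patchE; case: ifPn => // /set_mem/f0.
rewrite [LHS](ge0_integral_pushforward measurable_abscissa)//; last by move=> x /set_mem; exact: f0.
rewrite ge0_integral_mrestr//; last 2 first.
- apply: measurable_comp mD _ mf _ => //; last exact: measurable_funTS measurable_fst.
  by move=> _ [z Dz <-].
- by move=> x; exact: f0.
rewrite integral_mkcond.
transitivity (\int[leb \x leb]_z ((f \_ D) z.1 * (\1_subgraph z)%:E))%E.
  apply: eq_integral => z _; rewrite !patchE indicE /= in_setI.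
  rewrite (_ : (z \in abscissa @^-1` D) = (z.1 \in D)); last by apply/idP/idP; rewrite !inE.
  by case: (z.1 \in D); case: (z \in subgraph); rewrite /= ?mule1 ?mule0 ?mul0e.
rewrite fubini_tonelli1//; last by move=> z; rewrite mule_ge0.
rewrite [RHS]integral_mkcond; apply: eq_integral => x _; rewrite /fubini_F/= [in RHS]patchE.
under eq_integral do rewrite patchE.
case: ifPn => xD; last by rewrite integral0_eq// => y _; rewrite mul0e.
rewrite ge0_integralZl//; last 2 first.
- apply/measurable_EFinP; apply: measurableT_comp (measurable_indic measurable_subgraph) _.
  exact: measurable_pair1.
- by move: xD => /set_mem/f0.
congr (_ * _)%E.
rewrite (_ : (fun y => _) = (fun y => (\1_(`]0, g x[%classic) y)%:E)); last first.
  apply/funext => y; rewrite !indicE.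
  have -> // : ((x, y) \in subgraph) = (y \in (`]0%R, g x[%classic : set R)).
  by apply/idP/idP; rewrite !inE/= ?in_itv.
transitivity (leb [set` `]0%R, g x[]); first by rewrite integral_indic// setIT.
rewrite lebesgue_measure_itv/= lte_fin.
case: ltP => [_|]; first by rewrite oppr0 adde0.
by move=> gx0; congr EFin; apply/eqP; rewrite eq_le gx0 andbT; apply: g0; exact: set_mem.
Qed.

End density.

(** * The measure alpha z^(-alpha-1) dz *)

Section pareto_tail_measure.
Context {R : realType}.
Variable alpha : R.
Hypothesis alpha_gt0 : 0 < alpha.
Local Notation leb := (@lebesgue_measure R).

(** Cut to the positive half-line because [powR] takes conventional values at z <= 0, and the
    measure must not charge that side. *)
Definition pareto_density : R -> R :=
  (fun z => alpha * z `^ (- alpha - 1)) \_ (`]0, +oo[%classic : set R).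

Lemma measurable_pareto_density : measurable_fun setT pareto_density.
Proof.
apply/(measurable_restrictT _ _).1 => //.
apply: measurable_funM => //; apply: measurable_funTS; exact: measurable_powR.
Qed.

Lemma pareto_density_ge0 z : 0 <= pareto_density z.
Proof.
rewrite /pareto_density patchE; case: ifPn => // _.
by rewrite mulr_ge0 ?powR_ge0// ltW.
Qed.

Definition kappa : {sigma_finite_measure set R -> \bar R} :=
  mdensity measurable_pareto_density.

Lemma ge0_integral_kappa (f : R -> \bar R) :
  measurable_fun setT f -> (forall x, (0 <= f x)%E) ->
  (\int[kappa]_x f x =
   \int[leb]_(z in `]0%R, +oo[) (f z * (alpha * z `^ (- alpha - 1))%:E))%E.
Proof.
move=> mf f0; rewrite ge0_integral_mdensity//; last by move=> x _; exact: pareto_density_ge0.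
rewrite [RHS]integral_mkcond; apply: eq_integral => z _.
rewrite /pareto_density [in RHS]patchE patchE; case: ifPn => // _.
by rewrite mule0.
Qed.

(** Fundamental theorem of calculus on a half-line, with the primitive -z^(-alpha), which tends to 0
    at infinity. *)
Lemma kappa_gt a : 0 < a -> kappa `]a, +oo[%classic = (a `^ (- alpha))%:E.
Proof.
move=> a0.
have -> : kappa `]a, +oo[%classic = (\int[kappa]_z (\1_(`]a, +oo[%classic) z)%:E)%E.
  by rewrite integral_indic// setIT.
rewrite ge0_integral_kappa//; last by apply: measurableT_comp => //; exact: measurable_indic.
rewrite (_ : (a `^ (- alpha))%:E = (0%:E - (- a `^ (- alpha))%:E)%E); last first.
  by rewrite -EFinB sub0r opprK.
have dF (x : R) : 0 < x -> is_derive x 1 (fun z => - z `^ (- alpha)) (alpha * x `^ (- alpha - 1)).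
  move=> x0; rewrite -[alpha * _]opprK -mulNr; apply: is_deriveN.
  exact: is_derive1_powR.
have cpow (r x : R) : 0 < x -> z `^ r @[z --> x] --> x `^ r.
  move=> x0; have : derivable (fun z : R => z `^ r) x 1.
    by apply: derivable_powR; rewrite in_itv/= x0.
  by move=> /derivable1_diffP/differentiable_continuous.
rewrite -(@ge0_continuous_FTC2y _ (fun z => alpha * z `^ (- alpha - 1))
  (fun z => - z `^ (- alpha)) a); first last.
- by move=> x; rewrite in_itv/= andbT => ax; rewrite derive1E; have [_ ->] := dF x (lt_trans a0 ax).
- by apply: cvg_at_right_filter; apply: cvgN; exact: cpow.
- by move=> x ax; have [] := dF x (lt_trans a0 ax).
- rewrite -[X in _ --> X]oppr0; apply: cvgN.
  apply/cvgrPdist_lt => e e0; near=> z.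
  have z0 : 0 < z by near: z; exact: nbhs_pinfty_gt.
  rewrite sub0r normrN ger0_norm ?powR_ge0// powRN invf_plt ?posrE ?powR_gt0//.
  have e1 : 0 < e^-1 by rewrite invr_gt0.
  have -> : e^-1 = (e^-1 `^ alpha^-1) `^ alpha.
    by rewrite -powRrM mulVf ?gt_eqF// powRr1// ltW.
  apply: gt0_ltr_powR => //; rewrite ?nnegrE ?powR_ge0 ?ltW//.
- apply: continuous_in_subspaceT => x; rewrite inE/= in_itv/= andbT => ax.
  by apply: cvgM; [exact: cvg_cst|apply: cpow; exact: lt_le_trans ax].
- by move=> x ax; rewrite mulr_ge0 ?powR_ge0// ltW.
rewrite -integral_itv_obnd_cbnd; last first.
  apply/measurable_EFinP; apply: measurable_funM => //; apply: measurable_funTS; exact: measurable_powR.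
rewrite integral_mkcond [RHS]integral_mkcond; apply: eq_integral => z _.
rewrite !patchE indicE.
have [az|az] := boolP (z \in `]a, +oo[%classic); last first.
  by case: ifPn => //; rewrite mul0e.
have zz : z \in (`]0, +oo[%classic : set R).
  by move: az; rewrite !inE/= !in_itv/= !andbT; exact: lt_trans.
by rewrite zz mul1e.
Unshelve. all: by end_near. Qed.

Lemma pareto_gt z :
  pareto alpha `]z, +oo[%classic = ((Num.max 1 z) `^ (- alpha))%:E.
Proof.
have E y : `]y, +oo[%classic = [set x : R | y < x].
  by apply/seteqP; split=> x /=; rewrite in_itv/= andbT.
rewrite E; have [z1|z1] := leP z 1; last first.
  by rewrite pareto_survival// ltW.
have P1 : pareto alpha [set x : R | 1 < x] = 1%E by rewrite pareto_survival// powR1.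
rewrite powR1; apply/eqP; rewrite eq_le; apply/andP; split.
  by apply: probability_le1; rewrite -E; exact: measurable_itv.
rewrite -[X in (X <= _)%E]P1; apply: le_measure; rewrite ?inE -?E.
- exact: measurable_itv.
- exact: measurable_itv.
- by move=> x; rewrite !E/=; exact: le_lt_trans.
Qed.

(** The self-similarity of [kappa]. Both sides are finite measures in A that agree on half-lines,
    because max(x, e) = e max(1, x / e). *)
Lemma kappa_pareto (e : R) (A : set R) : 0 < e -> measurable A ->
  kappa (A `&` `]e, +oo[%classic) =
    ((e `^ (- alpha))%:E * pareto alpha [set u : R | A (e * u)%R])%E.
Proof.
move=> e0 mA.
have me : measurable_fun setT (fun u : R => e * u) by exact: measurable_funM.
pose k : {nonneg R} := NngNum (powR_ge0 e (- alpha)).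
have mI : measurable (`]e, +oo[%classic : set R) by exact: measurable_itv.
suff : mrestr kappa mI A = mscale k (mpush (pareto alpha) me) A by [].
apply: (@measure_unique _ _ _ (@RGenOInfty.G R)
  (fun n => `](- n%:R), +oo[%classic : set R) _ _ _ _
  (mrestr kappa mI) (mscale k (mpush (pareto alpha) me))) => //.
- exact: RGenOInfty.measurableE.
- move=> _ _ [x ->] [y ->]; exists (Num.max x y).
  by apply/seteqP; split=> z /=; rewrite !in_itv/= !andbT gt_max => /andP.
- by move=> n; exists (- n%:R).
- apply/seteqP; split=> // x _; exists (Num.truncn `|x|).+1 => //=.
  rewrite in_itv/= andbT ltrNl; apply: le_lt_trans (truncnS_gt _).
  by rewrite -normrN ler_norm.
- move=> _ [x ->]; change (kappa (`]x, +oo[ `&` `]e, +oo[) =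
    ((e `^ (- alpha))%:E * pareto alpha ((fun u => e * u)%R @^-1` `]x, +oo[))%E).
  have -> : `]x, +oo[ `&` `]e, +oo[ = (`](Num.max x e), +oo[%classic : set R).
    by apply/seteqP; split=> z /=; rewrite !in_itv/= !andbT gt_max => /andP.
  have m0 : 0 < Num.max x e by rewrite lt_max e0 orbT.
  rewrite kappa_gt//.
  have -> : (fun u : R => e * u) @^-1` `]x, +oo[ = `](x / e), +oo[%classic.
    by apply/seteqP; split=> z /=; rewrite !in_itv/= !andbT ltr_pdivrMr// mulrC.
  have m1 : 0 <= Num.max 1 (x / e) by rewrite le_max ler01.
  rewrite pareto_gt -EFinM -powRM ?m1 ?(ltW e0)//.
  congr (_ `^ _)%:E; rewrite maxr_pMr ?ltW// mulr1 mulrCA divff ?gt_eqF// mulr1.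
  by rewrite maxC.
- move=> n; apply: (@le_lt_trans _ _ (kappa `]e, +oo[%classic)).
    rewrite /mrestr; apply: (@le_measure _ _ _ kappa); rewrite ?inE//; apply: measurableI => //; exact: measurable_itv.
  by rewrite kappa_gt// ltry.
Qed.

End pareto_tail_measure.

(** * Weak convergence of polar coordinates *)

Section cell_infimum.
Context {R : realType} {V : topologicalType}.
Variable h : R * V -> R.
Hypothesis ch : continuous h.
Hypothesis h0 : forall z, 0 <= h z.

Definition cell_inf (a b : R) (y : V) : R := inf [set h (s, y) | s in `[a, b]].

Let has_lb a b y : has_lbound [set h (s, y) | s in `[a, b]].
Proof. by exists 0 => _ [s _ <-]. Qed.

Lemma cell_inf_le a b y s : a <= s <= b -> cell_inf a b y <= h (s, y).
Proof. by move=> asb; apply: ge_inf => //; exists s => //=; rewrite in_itv. Qed.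

Lemma le_cell_inf a b y L : a <= b ->
  (forall s, a <= s <= b -> L <= h (s, y)) -> L <= cell_inf a b y.
Proof.
move=> ab hL; apply: lb_le_inf; last first.
  by move=> _ [s + <-]; rewrite /= in_itv/=; exact: hL.
by exists (h (a, y)); exists a => //=; rewrite in_itv/= lexx.
Qed.

(** Compactness of [a, b] makes h (s, y) close to h (s, y0) uniformly in s, and an infimum moves by
    no more than the uniform distance. *)
Lemma cell_inf_continuous a b : a <= b -> continuous (cell_inf a b).
Proof.
move=> ab y0; apply/cvgrPdist_le => e e0.
have hK : \forall y \near y0, `[a, b]%classic `<=` (fun s => `|h (s, y0) - h (s, y)| <= e).
  have /compact_near_coveringP := @segment_compact R a b; apply => s _.
  have cg : continuous (fun z : R * V => h (z.1, y0) - h z).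
    apply: ctsB => //; apply: (cts_comp (f := fun z : R * V => (z.1, y0))) => //.
    by apply: cts_pair; [exact: cts_fst|exact: cst_continuous].
  have /cvgrPdist_le/(_ _ e0) := cg (s, y0).
  by rewrite subrr; apply: filterS => -[s' y] /=; rewrite sub0r normrN.
near=> y.
have hy s : a <= s <= b -> `|h (s, y0) - h (s, y)| <= e.
  by move=> sab; have : (`[a, b]%classic `<=` (fun s => `|h (s, y0) - h (s, y)| <= e));
    [near: y|apply; rewrite /= in_itv].
rewrite ler_norml; apply/andP; split.
  rewrite lerBrDl; apply: le_cell_inf => // s sab.
  have := hy _ sab; have := cell_inf_le y sab; rewrite ler_norml.
  move=> ? /andP[? ?]; lra.
rewrite lerBlDr -lerBlDl; apply: le_cell_inf => // s sab.
have := hy _ sab; have := cell_inf_le y0 sab; rewrite ler_norml.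
move=> ? /andP[? ?]; lra.
Unshelve. all: by end_near. Qed.

End cell_infimum.

Section polar_convergence.
Context {R : realType} {d : nat}.
Local Notation V := 'rV[R]_d.
Local Notation D := [set z : R * V | 1 < z.1].
Variables (mu_ : R -> probability (R * V)%type R) (mu : probability (R * V)%type R).

Let mgt (a : R) : measurable [set z : R * V | a < z.1].
Proof.
rewrite (_ : [set _ | _] = fst @^-1` `]a, +oo[%classic).
  by rewrite -[X in measurable X]setTI; exact: measurable_fst.
by apply/seteqP; split => x /=; rewrite in_itv/= andbT.
Qed.

Let step (a : R) (m : V -> R) (z : R * V) : R := \1_[set z | a < z.1] z * m z.2.

(** Indicators of upper tails in the first variable times continuous functions of the second: these
    are the integrals that convergence of the second component alone controls. *)
Hypothesis cvg_step : forall a m, 1 <= a -> continuous m ->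
  (exists M, forall y, `|m y| <= M) ->
  \int[mu_ t]_z step a m z @[t --> +oo] --> \int[mu]_z step a m z.
Hypothesis mu_1 : \forall t \near +oo, mu_ t (~` D) = 0.
Hypothesis mu1 : mu (~` D) = 0.

(** Measurability and boundedness accompany the convergence so that linearity of the integral
    applies when such functions are added or subtracted. *)
Let good (s : R * V -> R) := [/\ measurable_fun setT s, exists M, forall z, `|s z| <= M &
  \int[mu_ t]_z s z @[t --> +oo] --> \int[mu]_z s z].

Let bounded_int (P : probability (R * V)%type R) (s : R * V -> R) :
  measurable_fun setT s -> (exists M, forall z, `|s z| <= M) -> P.-integrable setT (EFin \o s).
Proof.
move=> ms [M sM]; apply: integrable_bounded => //; last by exists M.
by apply: (le_lt_trans (probability_le1 P _)); rewrite ?ltry.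
Qed.

Let good_step a m : 1 <= a -> continuous m -> (exists M, forall y, `|m y| <= M) ->
  good (step a m).
Proof.
move=> a1 cm [M mM]; split; last by apply: cvg_step => //; exists M.
- apply: measurable_funM; first exact: measurable_indic.
  apply: measurableT_comp; last exact: measurable_snd.
  exact: continuous_measurable_rV.
- exists M => z; rewrite /step normrM indicE.
  by case: (_ \in _); rewrite ?normr1 ?mul1r// normr0 mul0r (le_trans _ (mM z.2)).
Qed.

Let goodB s1 s2 : good s1 -> good s2 -> good (fun z => s1 z - s2 z).
Proof.
move=> [m1 b1 c1] [m2 b2 c2]; split; first exact: measurable_funB.
  move: b1 b2 => [M1 b1] [M2 b2]; exists (M1 + M2) => z.
  by rewrite (le_trans (ler_normB _ _))// lerD.
under eq_fun do rewrite RintegralB ?bounded_int//.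
by rewrite RintegralB ?bounded_int//; exact: cvgB.
Qed.

Let goodD s1 s2 : good s1 -> good s2 -> good (fun z => s1 z + s2 z).
Proof.
move=> [m1 b1 c1] [m2 b2 c2]; split; first exact: measurable_funD.
  move: b1 b2 => [M1 b1] [M2 b2]; exists (M1 + M2) => z.
  by rewrite (le_trans (ler_normD _ _))// lerD.
under eq_fun do rewrite RintegralD ?bounded_int//.
by rewrite RintegralD ?bounded_int//; exact: cvgD.
Qed.

Let good_sum N (s : nat -> R * V -> R) : (forall k, good (s k)) ->
  good (fun z => \sum_(0 <= k < N) s k z).
Proof.
move=> gs; elim: N => [|N IH].
  under eq_fun do rewrite big_nil.
  split => //; first by exists 0 => z; rewrite normr0.
  under eq_fun do rewrite Rintegral_cst// mul0r.
  by rewrite Rintegral_cst// mul0r; exact: cvg_cst.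
by under eq_fun do rewrite big_nat_recr//=; exact: goodD.
Qed.

(** [below h n] approximates [h] from below by functions that are constant in the
    first variable on the cells of the grid. Taking the infimum of [h] over a
    cell keeps the dependence on the second variable continuous, so that no
    tightness of the second marginals is needed. *)
Let grid (n k : nat) : R := 1 + k%:R / n.+1%:R.

Let below (h : R * V -> R) (n : nat) (z : R * V) : R :=
  \sum_(0 <= k < n.+1 * n.+1)
    (step (grid n k) (cell_inf h (grid n k) (grid n k.+1)) z -
     step (grid n k.+1) (cell_inf h (grid n k) (grid n k.+1)) z).

Let grid_le n k : grid n k <= grid n k.+1.
Proof. by rewrite lerD2l ler_pM2r ?invr_gt0// ler_nat. Qed.

Let grid_ge1 n k : 1 <= grid n k.
Proof. by rewrite lerDl divr_ge0. Qed.

Section lower_bound.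
Variables (h : R * V -> R) (M : R).
Hypotheses (ch : continuous h) (h0 : forall z, 0 <= h z) (hM : forall z, h z <= M).

Let good_below n : good (below h n).
Proof.
have cont k := cell_inf_continuous ch h0 (grid_le n k).
have bnd k : exists M, forall y, `|cell_inf h (grid n k) (grid n k.+1) y| <= M.
  exists M => y; rewrite ger0_norm; last by apply: le_cell_inf.
  apply: le_trans (hM (grid n k, y)); apply: cell_inf_le => //.
  by rewrite lexx grid_le.
by apply: good_sum => k; apply: goodB; apply: good_step.
Qed.

Let ind n k (u : R) : R := (grid n k < u)%R%:R.

Let belowE n z : below h n z = \sum_(0 <= k < n.+1 * n.+1)
  (ind n k z.1 - ind n k.+1 z.1) * cell_inf h (grid n k) (grid n k.+1) z.2.
Proof.
apply: eq_bigr => k _; rewrite /step !indicE mulrBl.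
by congr (_%:R * _ - _%:R * _); congr nat_of_bool; apply/idP/idP; rewrite inE.
Qed.

(** The indicator of a cell is the difference of two tail indicators, so the sum telescopes; the
    first tail starts at 1, hence contributes 1. *)
Let sum_ind n u L : 1 < u ->
  \sum_(0 <= k < n.+1 * n.+1) (ind n k u - ind n k.+1 u) * L =
  (1 - ind n (n.+1 * n.+1) u) * L.
Proof.
move=> u1; rewrite -mulr_suml; congr (_ * _).
under eq_bigr do rewrite -opprB; rewrite sumrN telescope_sumr// opprB.
by rewrite /ind {1}/grid mul0r addr0 u1.
Qed.

Let ind_cell n k u (x y : R) : (grid n k < u <= grid n k.+1 -> x <= y) ->
  (ind n k u - ind n k.+1 u) * x <= (ind n k u - ind n k.+1 u) * y.
Proof.
rewrite /ind => H; case: (ltP (grid n k.+1) u) => [ku|ku].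
  by rewrite (le_lt_trans (grid_le n k) ku) subrr !mul0r.
rewrite subr0; case: (ltP (grid n k) u) => [ku'|]; last by rewrite !mul0r.
by rewrite !mul1r H// ku' ku.
Qed.

Let below_le n z : D z -> below h n z <= h z.
Proof.
move=> z1; rewrite belowE.
apply: (@le_trans _ _ (\sum_(0 <= k < n.+1 * n.+1) (ind n k z.1 - ind n k.+1 z.1) * h z)).
  apply: ler_sum => k _; apply: ind_cell => /andP[ku uk].
  rewrite [in leRHS](surjective_pairing z).
  by apply: cell_inf_le => //; rewrite (ltW ku).
rewrite sum_ind// -[leRHS]mul1r ler_wpM2r// gerBl /ind; exact: ler0n.
Qed.

(** Past the last cell [below] is 0, which the factor on the left records. The choice L = h z - e
    serves for convergence, L = 0 for nonnegativity. *)
Let below_ge n z L : D z -> (forall s, `|s - z.1| <= n.+1%:R^-1 -> L <= h (s, z.2)) ->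
  (1 - ind n (n.+1 * n.+1) z.1) * L <= below h n z.
Proof.
move=> z1 hL; rewrite belowE -sum_ind//; apply: ler_sum => k _; apply: ind_cell => /andP[ku uk].
apply: le_cell_inf => // s /andP[ks sk]; apply: hL.
have dk : grid n k.+1 = grid n k + n.+1%:R^-1.
  by rewrite /grid -addrA -[X in _ + (_ + X)]mul1r -mulrDl natr1.
rewrite ler_norml; apply/andP; split.
  rewrite lerBrDl -lerBrDr opprK.
  by rewrite (le_trans uk)// dk lerD2r.
by rewrite lerBlDl (le_trans sk)// dk lerD2r ltW.
Qed.

(** The (n + 1)^2 cells of width 1 / (n + 1) cover ]1, n + 2]: each point of [D] is eventually
    covered, by cells that shrink while h is continuous there. *)
Let below_cvg z : D z -> below h n z @[n --> \oo] --> h z.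
Proof.
move=> z1; apply/cvgrPdist_le => e e0.
have /cvgrPdist_le/(_ _ e0)/nbhs_ballP[r /= r0 hr] : {for z.1, continuous (fun s => h (s, z.2))}.
  apply: (cts_comp (f := fun s => (s, z.2)) (g := h)) => //.
  by apply: cts_pair; [exact: cts_id|exact: cst_continuous].
near=> n.
have nr : n.+1%:R^-1 < r.
  by near: n; exact: (near_infty_natSinv_lt (PosNum r0)).
have nz : z.1 <= grid n (n.+1 * n.+1).
  rewrite /grid natrM mulfK//; apply: (@le_trans _ _ n%:R).
    by near: n; exact: nbhs_infty_ger.
  by rewrite -natr1 addrCA lerDl addr_ge0.
have lo : h z - e <= below h n z.
  have -> : h z - e = (1 - ind n (n.+1 * n.+1) z.1) * (h z - e).
    by rewrite /ind ltNge nz/= subr0 mul1r.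
  apply: below_ge => // s sz; rewrite lerBlDl -lerBlDr.
  apply: le_trans (ler_norm _) _; rewrite {1}(surjective_pairing z); apply: hr.
  by rewrite /ball/= distrC (le_lt_trans sz).
rewrite ger0_norm; first by rewrite lerBlDl -lerBlDr.
by rewrite subr_ge0 below_le.
Unshelve. all: by end_near. Qed.

Let int_D (P : probability (R * V)%type R) (s : R * V -> R) : measurable_fun setT s ->
  (exists M, forall z, `|s z| <= M) -> P (~` D) = 0 ->
  \int[P]_z s z = \int[P]_(z in D) s z.
Proof.
move=> ms bs P0; rewrite /Rintegral (@negligible_integral _ _ _ _ _ (~` D))//.
- by rewrite setDE setCK setTI.
- exact: measurableC.
- exact: bounded_int.
Qed.

Let mh : measurable_fun setT h. Proof. exact: continuous_measurable_prod. Qed.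

Let bh : exists M, forall z, `|h z| <= M.
Proof. by exists M => z; rewrite ger0_norm. Qed.

(** A bound of Fatou type. Some [below h n] loses at most e / 2 of the limit integral; its own
    integrals converge, at the cost of another e / 2; and it stays below h on [D], which carries all
    the laws for large t. *)
Lemma polar_lower_bound e : 0 < e ->
  \forall t \near +oo, \int[mu]_z h z - e <= \int[mu_ t]_z h z.
Proof.
move=> e0; have e20 : 0 < e / 2 by rewrite divr_gt0.
have [n hn] : exists n, \int[mu]_z h z - e / 2 <= \int[mu]_z below h n z.
  have : \int[mu]_(z in D) below h n z @[n --> \oo] --> \int[mu]_(z in D) h z.
    apply: (@bounded_cvg_Rintegral _ _ _ _ _ _ _ M) => //.
    - by rewrite (le_lt_trans (probability_le1 _ _))// ltry.
    - by move=> n; apply: measurable_funTS; have [] := good_below n.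
    - move=> n z Dz; rewrite ger0_norm; first exact: le_trans (below_le n Dz) (hM z).
      apply: le_trans (below_ge Dz (L := 0) _); first by rewrite mulr0.
      by move=> s _.
  move=> /cvgrPdist_le/(_ _ e20)[n _ /(_ n (leqnn _))/= hn]; exists n.
  have [mb bb _] := good_below n.
  rewrite !int_D// lerBlDl -lerBlDr.
  exact: le_trans (ler_norm _) hn.
have [mb bb /cvgrPdist_le/(_ _ e20) cb] := good_below n.
near=> t.
apply: (@le_trans _ _ (\int[mu_ t]_z below h n z)).
  rewrite [e]splitr opprD addrA lerBlDl -lerBlDr.
  apply: (@le_trans _ _ (\int[mu]_z below h n z - \int[mu_ t]_z below h n z)).
    by rewrite lerB.
  by apply: le_trans (ler_norm _) _; near: t; exact: cb.
have t1 : mu_ t (~` D) = 0 by near: t; exact: mu_1.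
rewrite !int_D//; apply: le_Rintegral => //.
- by apply: integrableS (bounded_int _ mb bb).
- by apply: integrableS (bounded_int _ mh bh).
- by move=> z Dz; exact: below_le.
Unshelve. all: by end_near. Qed.

End lower_bound.

Lemma polar_weak_cvg (h : R * V -> R) : continuous h ->
  (exists M : R, forall z, `|h z| <= M) ->
  \int[mu_ t]_z h z @[t --> +oo] --> \int[mu]_z h z.
Proof.
move=> ch [M hM].
have mh : measurable_fun setT h by exact: continuous_measurable_prod.
have ih (P : probability (R * V)%type R) : P.-integrable setT (EFin \o h).
  by apply: bounded_int => //; exists M.
have ic (P : probability (R * V)%type R) : P.-integrable setT (EFin \o (cst M : R * V -> R)).
  by apply: bounded_int => //; exists `|M|.
have cM (P : probability (R * V)%type R) : \int[P]_z (cst M z) = M.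
  have -> : \int[P]_z (cst M z) = M * fine (P setT) by exact: Rintegral_cst.
  have -> : P setT = 1%E by exact: probability_setT.
  by rewrite /= mulr1.
apply/cvgrPdist_le => e e0.
(* Both h + M and M - h take values in [0, 2 M]; they yield the lower and the upper estimate for
   h. *)
have lo := @polar_lower_bound (fun z => h z + M) (M + M) _ _ _ e e0.
have up := @polar_lower_bound (fun z => M - h z) (M + M) _ _ _ e e0.
near=> t; rewrite ler_norml; apply/andP; split.
  have : \int[mu]_z (M - h z) - e <= \int[mu_ t]_z (M - h z).
    near: t; apply: up.
    - by apply: ctsB => //; exact: cst_continuous.
    - by move=> z; rewrite subr_ge0 (le_trans (ler_norm _) (hM z)).
    - by move=> z; rewrite lerD2l (le_trans (ler_norm _))// normrN.
  rewrite !(RintegralB _ (ic _) (ih _))// !cM; lra.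
have : \int[mu]_z (h z + M) - e <= \int[mu_ t]_z (h z + M).
  near: t; apply: lo.
  - by apply: ctsD => //; exact: cst_continuous.
  - by move=> z; rewrite -lerBlDr sub0r; have /ler_normlP[] := hM z; rewrite lerNl.
  - by move=> z; rewrite lerD2r (le_trans (ler_norm _) (hM z)).
rewrite !(RintegralD _ (ih _) (ic _))// !cM; lra.
Unshelve. all: by end_near. Qed.

End polar_convergence.

(** * Change of measure *)

Section change_of_measure.
Context {d1 d2} {T1 : measurableType d1} {T2 : measurableType d2} {R : realType}.
Implicit Types mu : {measure set T1 -> \bar R}.

Lemma integral_mrestr mu (A : set T1) (mA : measurable A) (f : T1 -> \bar R) :
  measurable_fun setT f -> (\int[mrestr mu mA]_x f x = \int[mu]_(x in A) f x)%E.
Proof.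
move=> mf; rewrite [LHS]integralE [RHS]integralE !ge0_integral_mrestr ?setTI//.
- exact: measurable_funeneg.
- exact: measurable_funepos.
Qed.

Lemma Rintegral_mrestr mu (A : set T1) (mA : measurable A) (f : T1 -> R) :
  measurable_fun setT f -> \int[mrestr mu mA]_x f x = \int[mu]_(x in A) f x.
Proof. by move=> mf; rewrite /Rintegral integral_mrestr//; exact/measurable_EFinP. Qed.

Lemma Rintegral_mscale mu (k : {nonneg R}) (D : set T1) (f : T1 -> R) :
  measurable D -> mu.-integrable D (EFin \o f) ->
  \int[mscale k mu]_(x in D) f x = k%:num * \int[mu]_(x in D) f x.
Proof.
move=> mD intf; have mf := measurable_int _ intf.
have E : (\int[mscale k mu]_(x in D) (f x)%:E = k%:num%:E * \int[mu]_(x in D) (f x)%:E)%E.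
  rewrite [LHS]integralE [X in (_ * X)%E]integralE !ge0_integral_mscale//; last 2 first.
  - exact: measurable_funeneg.
  - exact: measurable_funepos.
  rewrite -(fineK (integrable_pos_fin_num mD intf)).
  rewrite -(fineK (integrable_neg_fin_num mD intf)).
  by rewrite muleBr.
by rewrite /Rintegral E fineM//; exact: integrable_fin_num.
Qed.

Lemma Rintegral_mpush mu (phi : T1 -> T2) (mphi : measurable_fun setT phi) (f : T2 -> R) :
  measurable_fun setT f -> mu.-integrable setT (EFin \o (f \o phi)) ->
  \int[mpush mu mphi]_x f x = \int[mu]_x f (phi x).
Proof.
move=> mf intf; rewrite /Rintegral; congr fine.
rewrite [LHS](@integral_pushforward _ _ _ _ _ _ mphi mu setT (EFin \o f))//.
exact/measurable_EFinP.
Qed.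

Lemma eq_measure_Rintegral (mu nu : {measure set T1 -> \bar R}) (D : set T1) (f : T1 -> R) :
  (forall A, measurable A -> A `<=` D -> mu A = nu A) ->
  \int[mu]_(x in D) f x = \int[nu]_(x in D) f x.
Proof. by move=> H; rewrite /Rintegral (eq_measure_integral nu). Qed.

Lemma Rintegral_support mu (D : set T1) (f : T1 -> R) :
  (forall x, ~ D x -> f x = 0) -> \int[mu]_x f x = \int[mu]_(x in D) f x.
Proof.
move=> fD; rewrite [RHS]Rintegral_mkcond; apply: eq_Rintegral => x _.
by rewrite patchE; case: ifPn => //; rewrite notin_setE => /fD.
Qed.

Lemma Rintegral_conull mu (D : set T1) (f : T1 -> R) : measurable D ->
  mu.-integrable setT (EFin \o f) -> mu (~` D) = 0%E ->
  \int[mu]_x f x = \int[mu]_(x in D) f x.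
Proof.
move=> mD intf mu0; rewrite /Rintegral (@negligible_integral _ _ _ _ _ (~` D))//.
  by rewrite setDE setCK setTI.
exact: measurableC.
Qed.

Lemma mnormalizeE mu (P : probability T1 R) (a : R) (A : set T1) :
  0 < a -> mu setT = a%:E -> mnormalize mu P A = (a^-1%:E * mu A)%E.
Proof.
move=> a0 E; rewrite /mnormalize E/= eqe gt_eqF//=.
by rewrite muleC.
Qed.

End change_of_measure.

Section probability_integrals.
Context {dT} {T : measurableType dT} {R : realType}.
Implicit Types P : probability T R.

Lemma prob_integrable P (D : set T) (f : T -> R) : measurable D ->
  measurable_fun setT f -> (exists M : R, forall x, `|f x| <= M) ->
  P.-integrable D (EFin \o f).
Proof.
move=> mD mf [M fM]; apply: integrable_bounded => //; last by exists M.
- by apply: (le_lt_trans (probability_le1 P _)); rewrite ?ltry.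
- exact: measurable_funTS.
Qed.

Lemma Rintegral_prob_cst P (r : R) : \int[P]_x r = r.
Proof.
have -> : \int[P]_x r = r * fine (P setT) by exact: Rintegral_cst.
have -> : P setT = 1%E by exact: probability_setT.
by rewrite /= mulr1.
Qed.

End probability_integrals.

Section product_integrals.
Context {d1 d2} {T1 : measurableType d1} {T2 : measurableType d2} {R : realType}.
Variables (P : probability T1 R) (Q : probability T2 R).

Lemma Rintegral_prod_mul (f : T1 -> R) (g : T2 -> R) :
  measurable_fun setT f -> measurable_fun setT g ->
  (exists M : R, forall x, `|f x| <= M) -> (exists M : R, forall x, `|g x| <= M) ->
  \int[(P \x Q)%E]_z (f z.1 * g z.2) = \int[P]_x f x * \int[Q]_y g y.
Proof.
move=> mf mg bf bg.
have mfg : measurable_fun setT (fun z : T1 * T2 => f z.1 * g z.2).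
  apply: measurable_funM.
    by apply: measurableT_comp => //; exact: measurable_fst.
  by apply: measurableT_comp => //; exact: measurable_snd.
have bfg : exists M : R, forall z : T1 * T2, `|f z.1 * g z.2| <= M.
  move: bf bg => [M1 fM] [M2 gM]; exists (M1 * M2) => z.
  by rewrite normrM ler_pM.
have ifg : (P \x Q)%E.-integrable setT (EFin \o (fun z : T1 * T2 => f z.1 * g z.2)).
  by apply: prob_integrable.
have ig : Q.-integrable setT (EFin \o g) by exact: prob_integrable.
have if_ : P.-integrable setT (EFin \o f) by exact: prob_integrable.
rewrite {1}/Rintegral -(@integral12_prod_meas1 _ _ _ _ _ _ _ _ ifg).
rewrite /fubini_F/=.
under eq_integral => x _.
  under eq_integral do rewrite EFinM.
  rewrite integralZl// -[X in (_ * X)%E]fineK; last exact: integrable_fin_num.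
  over.
rewrite integralZr// fineM//; last exact: integrable_fin_num.
Qed.

End product_integrals.

Lemma measure_setI_conull d (T : measurableType d) {R : realType}
    (mu : {measure set T -> \bar R})
    (D A : set T) :
  measurable D -> measurable A -> mu (~` D) = 0%E -> mu (A `&` D) = mu A.
Proof.
move=> mD mA D0; rewrite -[in RHS](setIT A) -(setUv D) setIUr measureU//.
- rewrite [X in (_ + X)%E](_ : _ = 0%E) ?adde0//.
  apply: (@subset_measure0 _ _ _ mu _ (~` D)).
  + by apply: measurableI => //; exact: measurableC.
  + exact: measurableC.
  + exact: subIsetr.
  + exact: D0.
- exact: measurableI.
- by apply: measurableI => //; exact: measurableC.
- by rewrite setIACA setICr setI0.
Qed.

Section weak_convergence.
Context {R : realType} {dT} {T : measurableTopologicalType dT}.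
Variables (E : set T) (r : T -> T).
Hypotheses (mE : measurable E) (cr : continuous r) (rE : forall x, E (r x))
  (rid : forall x, E x -> r x = x)
  (cm : forall f : T -> R, continuous f -> measurable_fun setT f).

(** This trades test functions continuous only on the subspace [E] for globally continuous ones with
    the same values on [E]. *)
Lemma continuous_retract (f : T -> R) :
  {within E, continuous f} -> continuous (f \o r).
Proof.
move=> /subspace_continuousP cf x.
apply: cvg_comp; last exact: cf (rE x).
move=> A EA; have H : nbhs x (r @^-1` (fun y => E y -> A y)) by exact: cr.
by apply: filterS H => y /= /(_ (rE y)).
Qed.

Lemma weak_cvgP (mu_ : R -> probability T R) (mu : probability T R) :
  (\forall t \near +oo, mu_ t (~` E) = 0%E) -> mu (~` E) = 0%E ->
  weak_cvg E mu_ mu <-> (forall f : T -> R, continuous f ->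
    (exists M : R, forall x, `|f x| <= M) ->
    (\int[mu_ t]_x f x) @[t --> +oo] --> \int[mu]_x f x).
Proof.
move=> mu_0 mu0; split=> H f cf bf.
  have intf (P : probability T R) : P.-integrable setT (EFin \o f).
    by apply: prob_integrable => //; exact: cm.
  rewrite (Rintegral_conull mE (intf mu) mu0).
  have cfE : {within E, continuous f} by exact: continuous_subspaceT.
  have bfE : exists M : R, forall x, E x -> `|f x| <= M.
    by move: bf => [M fM]; exists M => x _.
  apply: cvg_trans (H f cfE bfE); apply: near_eq_cvg; near=> t.
  rewrite (Rintegral_conull mE (intf (mu_ t)))//.
  by near: t; exact: mu_0.
have cfr := continuous_retract cf.
have bfr : exists M : R, forall x, `|(f \o r) x| <= M.
  by move: bf => [M fM]; exists M => x; exact: fM.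
have intf (P : probability T R) : P.-integrable setT (EFin \o (f \o r)).
  by apply: prob_integrable => //; exact: cm.
have fE (P : probability T R) : P (~` E) = 0%E -> \int[P]_(x in E) f x = \int[P]_x (f \o r) x.
  move=> P0; rewrite (Rintegral_conull mE (intf P) P0).
  by apply: eq_Rintegral => x; rewrite inE => Ex /=; rewrite rid.
rewrite fE//; apply: cvg_trans (H _ cfr bfr); apply: near_eq_cvg; near=> t.
by rewrite fE//; near: t; exact: mu_0.
Unshelve. all: by end_near. Qed.

End weak_convergence.

(** * Convergence in M0 *)

Section orthant_geometry.
Context {R : realType} {d : nat}.
Local Notation V := 'rV[R]_d.
Implicit Types (I : {set 'I_d}) (x : V).

Lemma max_on_leP I x (e : R) :
  (max_on I x <= e) <-> (0 <= e /\ forall i, i \in I -> x ord0 i <= e).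
Proof. by split => [/bigmax_leP|/bigmax_leP]. Qed.

Lemma max_on_ge0 I x : 0 <= max_on I x.
Proof. by have [] := (max_on_leP I x (max_on I x)).1 (lexx _). Qed.

Lemma le_max_on I x i : i \in I -> x ord0 i <= max_on I x.
Proof. by have [_] := (max_on_leP I x (max_on I x)).1 (lexx _); apply. Qed.

Lemma max_on_gt0P I x : (0 < max_on I x) <-> exists2 i, i \in I & 0 < x ord0 i.
Proof.
split; last by move=> [i iI]; move/lt_le_trans; apply; exact: le_max_on.
move=> m0; apply: contrapT => H; move: m0; rewrite ltNge => /negP; apply.
apply/max_on_leP; split => // i iI; rewrite leNgt; apply/negP => xi.
by apply: H; exists i.
Qed.

Lemma max_on1_gt0 i x : (0 < max_on [set i]%SET x) = (0 < x ord0 i).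
Proof.
apply/idP/idP => [/max_on_gt0P[j]|xi]; first by rewrite finset.inE => /eqP ->.
by apply/max_on_gt0P; exists i => //; rewrite finset.inE.
Qed.

Lemma max_on1_le i x e : 0 <= e -> (max_on [set i]%SET x <= e) = (x ord0 i <= e).
Proof.
move=> e0; apply/idP/idP => [/max_on_leP[_]|xi]; first by apply; rewrite finset.inE.
by apply/max_on_leP; split => // j; rewrite finset.inE => /eqP ->.
Qed.

Lemma coord_cts (i : 'I_d) : continuous (fun x : V => x ord0 i).
Proof. exact: coord_continuous. Qed.

Lemma max_on_continuous I : continuous (@max_on R d I).
Proof.
rewrite /max_on; elim: (index_enum _) => [|i s IH].
  by under eq_fun do rewrite big_nil; exact: cst_continuous.
under eq_fun do rewrite big_cons; case: (i \in I) => //.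
by apply: cts_max => //; exact: coord_cts.
Qed.

(** A continuous retraction of the whole space onto the orthant. It preserves every [max_on], since
    that maximum starts from 0. *)
Definition pos x : V := \row_j Num.max 0 (x ord0 j).

Lemma pos_continuous : continuous pos.
Proof.
move=> x; apply: (@cvg_mx _ _ (nbhs x) _) => i j; under eq_fun do rewrite mxE.
rewrite mxE; have : continuous (fun x : V => Num.max 0 (x ord0 j)).
  by apply: cts_max; [exact: cst_continuous|exact: coord_cts].
exact.
Qed.

Lemma pos_orthant x : orthant (pos x).
Proof. by move=> j; rewrite mxE le_max lexx. Qed.

Lemma pos_id x : orthant x -> pos x = x.
Proof. by move=> ox; apply/rowP => j; rewrite mxE max_r. Qed.

Lemma max_on_pos I x : max_on I (pos x) = max_on I x.
Proof.
apply/eqP; rewrite eq_le; apply/andP; split; apply/max_on_leP; split; try exact: max_on_ge0.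
  move=> i iI; rewrite mxE ge_max max_on_ge0/=; exact: le_max_on.
move=> i iI; apply: le_trans (le_max_on (pos x) iI).
by rewrite mxE le_max lexx orbT.
Qed.

Lemma open_max_on_gt I (e : R) : open [set x : V | e < max_on I x].
Proof.
apply: (@open_comp _ _ (@max_on R d I) [set y | e < y]); last exact: open_gt.
by move=> x _; exact: max_on_continuous.
Qed.

Lemma open_max_on_lt I (e : R) : open [set x : V | max_on I x < e].
Proof.
apply: (@open_comp _ _ (@max_on R d I) [set y | y < e]); last exact: open_lt.
by move=> x _; exact: max_on_continuous.
Qed.

Lemma measurable_max_on_gt I (e : R) : measurable [set x : V | e < max_on I x].
Proof. by apply: open_measurable_mx; exact: open_max_on_gt. Qed.

Lemma measurable_coord_gt (i : 'I_d) (e : R) : measurable [set x : V | e < x ord0 i].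
Proof.
apply: open_measurable_mx; apply: (@open_comp _ _ (fun x : V => x ord0 i) [set y | e < y]).
  by move=> x _; exact: coord_cts.
exact: open_gt.
Qed.

Lemma S01E i : S0 [set i]%SET = orthant `&` [set x : V | 0 < x ord0 i].
Proof. by congr (_ `&` _); apply/seteqP; split => x /=; rewrite max_on1_gt0. Qed.

End orthant_geometry.

Section M0_convergence.
Context {R : realType} {d : nat}.
Local Notation V := 'rV[R]_d.
Implicit Types (I : {set 'I_d}).

(** These are the elements of [C0 R I], in the form of continuous functions on
    the whole space; see [C0_test] and [test_C0]. *)
Definition vanishing_test I (g : V -> R) :=
  [/\ continuous g, exists M : R, forall x, `|g x| <= M &
      exists2 e, 0 < e & forall x, max_on I x <= e -> g x = 0].

(** [m0_finite] speaks of subsets of the orthant; what lies outside is null by [m0_carrier]. *)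
Lemma m0_gt_fin I (nu : M0 R I) (e : R) : 0 < e -> (nu [set x | (e < max_on I x)%R] < +oo)%E.
Proof.
move=> e0; have mS := @measurable_S0 R d I; have mG := measurable_max_on_gt I e.
apply: (@le_lt_trans _ _ (nu ([set x | e < max_on I x] `&` S0 I))).
  rewrite -[X in (_ <= X)%E]adde0 -(m0_carrier nu).
  rewrite -[X in (nu X <= _)%E](setIT _) -(setUv (S0 I)) setIUr.
  apply: le_trans (measureU2 _ _ _) _; [exact: measurableI| |].
    by apply: measurableI => //; exact: measurableC.
  by apply: leeD => //; apply: measureIr => //; exact: measurableC.
apply: (@m0_finite _ _ _ nu _ e) => //; first exact: measurableI.
by move=> x [/= ex [ox _]]; split => //=; exact: ltW.
Qed.

Lemma vanishing_integrable I (nu : M0 R I) g : vanishing_test I g ->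
  nu.-integrable setT (EFin \o g).
Proof.
move=> [cg [M gM] [e e0 g0]].
have mG := measurable_max_on_gt I e.
have : nu.-integrable [set x | e < max_on I x] (EFin \o g).
  apply: integrable_bounded => //; first exact: m0_gt_fin.
    by apply: measurable_funTS; exact: continuous_measurable_rV.
  by exists M.
move=> /(integrable_mkcond _ mG).1; apply: eq_integrable => // x _ /=.
rewrite patchE; case: ifPn => //; rewrite notin_setE/= => /negP.
by rewrite -leNgt => /g0 ->.
Qed.

Lemma m0_integral_ext I (nu : M0 R I) (f : V -> R) g : vanishing_test I g ->
  {in S0 I, f =1 g} -> \int[nu]_(x in S0 I) f x = \int[nu]_x g x.
Proof.
move=> tg fg; rewrite (eq_Rintegral _ fg).
rewrite -Rintegral_conull//; [exact: measurable_S0|exact: vanishing_integrable|exact: m0_carrier].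
Qed.

(** Extend f by composition with [pos] where [max_on I] is positive, and by 0 elsewhere. The two
    pieces fit together continuously because f already vanishes for [max_on I] at most e. *)
Lemma C0_test I (f : C0 R I) : exists2 g, vanishing_test I g & {in S0 I, f =1 g}.
Proof.
have [M fM] := c0_bounded f; have [e e0 f0] := c0_vanish f.
pose g x := if 0 < max_on I x then f (pos x) else 0.
have Spos (x : V) : 0 < max_on I x -> S0 I (pos x).
  by move=> x0; split; [exact: pos_orthant|rewrite /= max_on_pos].
have g0 x : max_on I x <= e -> g x = 0.
  move=> xe; rewrite /g; case: ifPn => // x0; apply: f0; first exact: Spos.
  by rewrite max_on_pos.
exists g; last first.
  by move=> x; rewrite inE => -[ox /= x0]; rewrite /g x0 pos_id.
split; last by exists e.
- move=> x; have [x0|x0] := ltP 0 (max_on I x); last first.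
    have H : \forall y \near x, g y = 0.
      have : \forall y \near x, max_on I y < e.
        apply: open_nbhs_nbhs; split; first exact: open_max_on_lt.
        exact: le_lt_trans e0.
      by apply: filterS => y /ltW/g0.
    have gx0 : g x = 0 by rewrite g0// (le_trans x0)// ltW.
    rewrite /continuous_at gx0 => A A0; apply: filterS H => y /= ->; exact: nbhs_singleton.
  have H : \forall y \near x, 0 < max_on I y.
    by apply: open_nbhs_nbhs; split; first exact: open_max_on_gt.
  move=> A /=; rewrite /g x0 => Afx.
  have cf := (@subspace_continuousP _ (S0 I) _ (c0_fun f)).1 (@c0_continuous _ _ _ f) (pos x) (Spos x x0) A Afx.
  have := @pos_continuous R d x _ cf.
  move=> cf'; apply: filterS2 H cf' => y /= y0 /(_ (Spos y y0)).
  by rewrite y0.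
- exists `|M| => x; rewrite /g; case: ifPn => x0; last by rewrite normr0.
  exact: le_trans (fM _ (Spos x x0)) (ler_norm _).
Qed.

Lemma test_C0 I g : vanishing_test I g -> exists f : C0 R I, forall x, f x = g x.
Proof.
move=> [cg [M gM] [e e0 g0]].
have h1 : {within S0 I, continuous g} by exact: continuous_subspaceT.
have h2 : exists M, forall x, S0 I x -> `|g x| <= M by exists M => x _.
have h3 : exists2 e : R, 0 < e & forall x, S0 I x -> max_on I x <= e -> g x = 0.
  by exists e => // x _; exact: g0.
by exists (MkC0 h1 h2 h3).
Qed.

Lemma cvg_M0_C0 I (nu_ : R -> M0 R I) (nu : M0 R I) :
  nu_ t @[t --> +oo] --> nu <->
  forall f : C0 R I, m0_integral f (nu_ t) @[t --> +oo] --> m0_integral f nu.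
Proof.
split=> [H f|H].
  have /cvg_sup/(_ f) Hf := H.
  apply: (@cvg_comp _ _ _ nu_ (m0_integral f) _ _ _ Hf).
  exact: (@initial_continuous _ _ (m0_integral f)).
apply/cvg_sup => f A [_ [[B Bop <-] Bnu BA]].
have : nbhs (m0_integral f nu) B by exact: open_nbhs_nbhs.
move=> /(H f) Hf; suff : \forall t \near +oo, A (nu_ t) by [].
have : \forall t \near +oo, B (m0_integral f (nu_ t)) by exact: Hf.
by apply: filterS => t Bt; exact: BA.
Qed.

Lemma law_orthant (X : orvec R d) : law X (~` orthant) = 0%E.
Proof.
have -> : law X (~` orthant) = rv_prob X (X @^-1` (~` orthant)) by [].
rewrite (_ : _ @^-1` _ = set0) ?measure0//.
by apply/seteqP; split => // w /=; apply; exact: rv_orthant.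
Qed.

Lemma Rintegral_law (X : orvec R d) dT (T : measurableType dT) (h : V -> T) (f : T -> R) :
  measurable_fun setT h -> measurable_fun setT f -> (exists M : R, forall x, `|f x| <= M) ->
  \int[rv_prob X]_w f (h (X w)) = \int[law X]_x f (h x).
Proof.
move=> mh mf bf; have mfh : measurable_fun setT (f \o h) by exact: measurableT_comp.
have bfh : exists M : R, forall x, `|(f \o h) x| <= M.
  by move: bf => [M fM]; exists M => x; exact: fM.
rewrite /Rintegral (@integral_distribution _ _ _ _ _ _ (rv_fun X) (EFin \o (f \o h)))//.
  exact/measurable_EFinP.
apply: (@prob_integrable _ _ _ (rv_prob X) setT ((f \o h) \o X)) => //.
  by apply: measurableT_comp.
by move: bfh => [M fM]; exists M => x; exact: fM.
Qed.

Lemma m0_integral_scaled (X : orvec R d) (b : R -> R) I t (f : C0 R I) g :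
  vanishing_test I g -> {in S0 I, f =1 g} -> 0 < t ->
  m0_integral f (scaled_law X b I t) = `|b t| * \int[law X]_x g (t^-1 *: x).
Proof.
move=> tg fg t0; rewrite /m0_integral (m0_integral_ext _ tg fg).
have [cg bg [e e0 g0]] := tg.
have mg : measurable_fun setT g by exact: continuous_measurable_rV.
set D0 := distribution (rv_prob X) [the {mfun _ >-> _} of divs t \o X].
have mS := @measurable_S0 R d I.
transitivity (\int[mscale `|b t|%:nng D0]_(x in S0 I) g x).
  exact: (Rintegral_mrestr (mscale `|b t|%:nng D0) mS mg).
rewrite Rintegral_mscale//; last exact: prob_integrable.
congr (_ * _).
have D0o : D0 (~` orthant) = 0%E.
  rewrite /D0 /distribution /pushforward (_ : _ @^-1` _ = set0) ?measure0//.
  apply/seteqP; split => // w /=; apply => j; rewrite mxE.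
  by rewrite mulr_ge0 ?invr_ge0 ?(ltW t0)//; exact: rv_orthant.
transitivity (\int[D0]_x g x).
  rewrite (Rintegral_conull (D := orthant)) ?D0o//; last 2 first.
  - exact: measurable_orthant.
  - exact: prob_integrable.
  rewrite /S0 Rintegral_mkcondr; apply: eq_Rintegral => x _.
  rewrite patchE; case: ifPn => //; rewrite notin_setE/= => /negP.
  by rewrite -leNgt => x0; rewrite g0// (le_trans x0)// ltW.
rewrite -(@Rintegral_law X _ _ (divs t) g)//.
rewrite /Rintegral (@integral_distribution _ _ _ _ _ _ _ (EFin \o g))//.
  exact/measurable_EFinP.
have mgX : measurable_fun setT (g \o (divs t \o rv_fun X)).
  by apply: measurableT_comp => //; apply: measurableT_comp.
apply: (@prob_integrable _ _ _ (rv_prob X) setT _ measurableT mgX).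
by move: bg => [M gM]; exists M => x; exact: gM.
Qed.

(** From here on the topology of [M0] is used only through this criterion, in which neither
    subspaces nor restricted measures appear. *)
Lemma cvg_M0P (X : orvec R d) (b : R -> R) I (nu : M0 R I) :
  cvg_M0 X b nu <-> forall g, vanishing_test I g ->
    `|b t| * (\int[law X]_x g (t^-1 *: x)) @[t --> +oo] --> \int[nu]_x g x.
Proof.
rewrite /cvg_M0; split=> [/cvg_M0_C0 H g tg|H].
  have [f fg] := test_C0 tg.
  have fg' : {in S0 I, f =1 g} by move=> x _; exact: fg.
  have := H f; rewrite /m0_integral (m0_integral_ext _ tg fg').
  apply: cvg_trans; apply: near_eq_cvg; near=> t.
  by rewrite -(m0_integral_scaled X b tg fg')//; near: t; exact: nbhs_pinfty_gt.
apply/cvg_M0_C0 => f; have [g tg fg] := C0_test f.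
rewrite /m0_integral (m0_integral_ext _ tg fg).
apply: cvg_trans (H g tg); apply: near_eq_cvg; near=> t.
by rewrite -(m0_integral_scaled X b tg fg)//; near: t; exact: nbhs_pinfty_gt.
Unshelve. all: by end_near. Qed.

End M0_convergence.

(** * Conditional laws *)

Section conditional_laws.
Context {R : realType} {d : nat}.
Local Notation V := 'rV[R]_d.
Variables (X : orvec R d) (i : 'I_d).
Local Notation E t := [set x : V | t < x ord0 i].

Definition tail (t : R) : R := fine (law X (E t)).

Lemma tail_ge0 t : 0 <= tail t. Proof. exact: fine_ge0. Qed.

Lemma law_tail t : law X (E t) = (tail t)%:E.
Proof. by rewrite fineK// fin_num_measure//; exact: measurable_coord_gt. Qed.

Lemma survivalE t : survival X i t = tail t.
Proof.
rewrite /survival /tail /cdf.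
have mI : measurable (component X i @^-1` `]-oo, t]%classic).
  by rewrite -[X in measurable X]setTI; exact: measurable_funP.
have -> : law X (E t) = rv_prob X (~` (component X i @^-1` `]-oo, t]%classic)).
  congr (rv_prob X _); apply/seteqP; split => w /=; rewrite in_itv/= ltNge; by move/negP.
rewrite probability_setC// fineB ?fin_num_measure//.
Qed.

Lemma cond_lawE dT (T : measurableType dT) t (g : {mfun V >-> T}) (B : set T) :
  0 < tail t -> measurable B ->
  cond_law X i t g B = ((tail t)^-1%:E * law X (g @^-1` B `&` E t))%E.
Proof.
move=> t0 mB.
have mT : mrestr (rv_prob X) (measurable_exceed X i t) setT = (tail t)%:E.
  by rewrite -law_tail /mrestr setTI.
by rewrite -[LHS]/(mnormalize _ _ _) (mnormalizeE _ _ t0 mT).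
Qed.

(** The common form of the three conditional laws: they are compared by comparing integrands on {x_i
    > t} under one fixed law. *)
Lemma Rintegral_cond_law dT (T : measurableType dT) t (g : {mfun V >-> T}) (f : T -> R) :
  0 < tail t -> measurable_fun setT f -> (exists M : R, forall x, `|f x| <= M) ->
  \int[cond_law X i t g]_y f y = (\int[law X]_(x in E t) f (g x)) / tail t.
Proof.
move=> t0 mf bf.
have mE := measurable_coord_gt (R := R) i t.
have k0 : 0 <= (tail t)^-1 by rewrite invr_ge0 ltW.
pose k : {nonneg R} := NngNum k0.
have mg : measurable_fun setT g by [].
have mfg : measurable_fun setT (f \o g) by exact: measurableT_comp.
have bfg : exists M : R, forall x, `|(f \o g) x| <= M.
  by move: bf => [M fM]; exists M => x; exact: fM.
rewrite (eq_measure_Rintegral (nu := mpush (mscale k (mrestr (law X) mE)) mg)); last first.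
  move=> B mB _; transitivity ((tail t)^-1%:E * law X (g @^-1` B `&` E t))%E => //.
  exact: cond_lawE.
have ilaw : (mrestr (law X) mE).-integrable setT (EFin \o (f \o g)).
  apply: integrable_bounded => //.
  by apply: (le_lt_trans (probability_le1 (law X) (measurableI _ _ measurableT mE))); rewrite ltry.
  by move: bfg => [M fM]; exists M => x _; exact: fM.
rewrite Rintegral_mpush//; last first.
  apply/integrableP; split; first exact/measurable_EFinP.
  rewrite ge0_integral_mscale//; last first.
    by apply: measurableT_comp => //; exact/measurable_EFinP.
  by rewrite lte_mul_pinfty//; move/integrableP : ilaw => [].
by rewrite Rintegral_mscale// Rintegral_mrestr// mulrC.
Qed.

Lemma cond_law_null dT (T : measurableType dT) t (g : {mfun V >-> T}) (B : set T) :
  0 < tail t -> measurable B -> (forall x, orthant x -> t < x ord0 i -> ~ B (g x)) ->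
  cond_law X i t g B = 0%E.
Proof.
move=> t0 mB H; rewrite cond_lawE//.
suff -> : law X (g @^-1` B `&` E t) = 0%E by rewrite mule0.
apply: (@subset_measure0 _ _ _ (law X) _ (~` orthant)).
- by apply: measurableI; [rewrite -[X in measurable X]setTI; exact: measurable_funP|exact: measurable_coord_gt].
- by apply: measurableC; exact: measurable_orthant.
- by move=> x [/= Bx tx] ox; exact: H Bx.
- exact: law_orthant.
Qed.

End conditional_laws.

Section weak_convergence_modes.
Context {R : realType} {d : nat}.
Local Notation V := 'rV[R]_d.
Variables (X : orvec R d) (i : 'I_d).
Hypothesis tail_gt0 : \forall t \near +oo, 0 < tail X i t.

Lemma weak_cvg_orthantP (g : R -> {mfun V >-> V}) (Y : orvec R d) :
  (forall t x, 0 < t -> orthant x -> t < x ord0 i -> orthant (g t x)) ->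
  weak_cvg orthant (fun t => cond_law X i t (g t)) (law Y) <->
  (forall f : V -> R, continuous f -> (exists M : R, forall x, `|f x| <= M) ->
    \int[cond_law X i t (g t)]_x f x @[t --> +oo] --> \int[law Y]_x f x).
Proof.
move=> og; apply: (@weak_cvgP R _ V orthant pos (@measurable_orthant R d) pos_continuous
  pos_orthant (@pos_id R d) (@continuous_measurable_rV R d)); last exact: law_orthant.
near=> t; apply: cond_law_null.
- by near: t.
- by apply: measurableC; exact: measurable_orthant.
- by move=> x ox tx; apply; apply: og.
Unshelve. all: by end_near. Qed.

Lemma orthant_scale (a : R) (x : V) : 0 <= a -> orthant x -> orthant (a *: x).
Proof. by move=> a0 ox j; rewrite mxE mulr_ge0//; exact: ox. Qed.

Lemma cvg_self_normP Theta : cvg_self_norm X i Theta <->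
  (forall f : V -> R, continuous f -> (exists M : R, forall x, `|f x| <= M) ->
    \int[cond_law X i t (self_norm i)]_x f x @[t --> +oo] --> \int[law Theta]_x f x).
Proof.
apply: (weak_cvg_orthantP (g := fun _ => self_norm i)) => t x t0 ox _.
by apply: orthant_scale => //; rewrite invr_ge0; exact: ox.
Qed.

Lemma cvg_exceedP Y : cvg_exceed X i Y <->
  (forall f : V -> R, continuous f -> (exists M : R, forall x, `|f x| <= M) ->
    \int[cond_law X i t (divs t)]_x f x @[t --> +oo] --> \int[law Y]_x f x).
Proof.
apply: (weak_cvg_orthantP (g := fun t => divs t)) => t x t0 ox _.
by apply: orthant_scale => //; rewrite invr_ge0 ltW.
Qed.

Lemma prob_prodE {d1 d2} {T1 : measurableType d1} {T2 : measurableType d2}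
    (P : probability T1 R) (Q : probability T2 R) (A : set T1) (B : set T2) :
  measurable A -> measurable B ->
  ((P \x Q)%E : probability _ R) (A `*` B) = (P A * Q B)%E.
Proof. by move=> mA mB; apply: product_measure1E. Qed.

Lemma pareto_prod_gt1 alpha (Theta : orvec R d) : 0 < alpha ->
  ((pareto alpha \x law Theta)%E : probability _ R) (~` [set z | 1 < z.1]) = 0%E.
Proof.
move=> a0; rewrite (_ : ~` _ = (~` `]1, +oo[%classic) `*` setT); last first.
  by apply/seteqP; split => -[u y] /=; rewrite in_itv/= andbT; [|case].
rewrite prob_prodE//; last exact: measurableC.
by rewrite probability_setC// pareto_gt// maxxx powR1 subee// mul0e.
Qed.

Lemma pareto_prod_null alpha (Theta : orvec R d) : 0 < alpha ->
  ((pareto alpha \x law Theta)%E : probability _ R)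
    (~` ([set u | 0 <= u] `*` orthant)) = 0%E.
Proof.
move=> a0; have mO : measurable (~` (orthant : set V)).
  by apply: measurableC; exact: measurable_orthant.
have mE : measurable ([set z : R | 0 <= z] `*` (orthant : set V)).
  apply: measurableX; last exact: measurable_orthant.
  rewrite (_ : [set z | _] = `[0, +oo[%classic); first exact: measurable_itv.
  by apply/seteqP; split => x /=; rewrite in_itv/= andbT.
have m1 : measurable (~` [set z : R * V | 1 < z.1]).
  apply: measurableC; rewrite (_ : [set _ | _] = `]1, +oo[%classic `*` setT).
    by apply: measurableX => //; exact: measurable_itv.
  by apply/seteqP; split => -[u y] /=; rewrite in_itv/= andbT => //; case.
apply: (@subset_measure0 _ _ _ (pareto alpha \x law Theta)%E _
    (~` [set z | 1 < z.1] `|` (setT `*` ~` orthant))).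
- exact: measurableC.
- by apply: measurableU => //; exact: measurableX.
- move=> [u y] H /=; apply: contrapT => /not_orP[/contrapT/= u1 A]; apply: H.
  split => /=; first by rewrite ltW// (lt_trans _ u1).
  by apply: contrapT => oy; apply: A.
apply/eqP; rewrite eq_le measure_ge0 andbT.
apply: le_trans (measureU2 _ _ _) _ => //; first exact: measurableX.
rewrite [X in (X + _ <= _)%E](pareto_prod_gt1 Theta a0) add0e.
rewrite [X in (X <= _)%E](_ : _ = (pareto alpha setT * law Theta (~` orthant))%E);
  last exact: prob_prodE.
by rewrite law_orthant mule0.
Qed.

Lemma cvg_polarP alpha Theta : 0 < alpha -> cvg_polar X alpha i Theta <->
  (forall f : R * V -> R, continuous f -> (exists M : R, forall z, `|f z| <= M) ->
    \int[cond_law X i t (polar i t)]_z f z @[t --> +oo] -->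
    \int[(pareto alpha \x law Theta)%E]_z f z).
Proof.
move=> a0.
have mE : measurable ([set z : R | 0 <= z] `*` (orthant : set V)).
  apply: measurableX; last exact: measurable_orthant.
  rewrite (_ : [set z | _] = `[0, +oo[%classic); first exact: measurable_itv.
  by apply/seteqP; split => x /=; rewrite in_itv/= andbT.
pose r (z : R * V) : R * V := (Num.max 0 z.1, pos z.2).
apply: (@weak_cvgP R _ (R * V)%type _ r mE) => //.
- apply: cts_pair; first by apply: cts_max; [exact: cst_continuous|exact: cts_fst].
  by apply: cts_comp; [exact: cts_snd|exact: pos_continuous].
- by move=> z; split => /=; [rewrite le_max lexx|exact: pos_orthant].
- by move=> [u y] [/= u0 oy]; rewrite /r/= max_r// pos_id.
- exact: continuous_measurable_prod.
- near=> t; apply: cond_law_null.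
  + by near: t.
  + exact: measurableC.
  + move=> x ox tx; apply; split => /=.
      by apply: divr_ge0; [exact: ox|apply: ltW; near: t; exact: nbhs_pinfty_gt].
    by apply: orthant_scale => //; rewrite invr_ge0; exact: ox.
- exact: pareto_prod_null.
Unshelve. all: by end_near. Qed.

End weak_convergence_modes.

(** * Regular variation *)

Section orthant_vectors.
Context {R : realType} {d : nat}.
Local Notation V := 'rV[R]_d.

HB.instance Definition _ := isMeasurableFun.Build _ _ _ _ (@pos R d)
  (continuous_measurable_rV2 pos_continuous).

(** An [orvec] takes values in the orthant everywhere, not just almost surely; hence the vector
    [pos] on the space [V] itself, which is the identity on a set of full measure. *)
Lemma orvec_of_prob (Q : probability V R) : Q (~` orthant) = 0%E ->
  exists Y : orvec R d, forall B, measurable B -> law Y B = Q B.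
Proof.
move=> Q0; have mO := @measurable_orthant R d.
exists (@Orvec R d _ V Q [the {mfun V >-> V} of @pos R d] (@pos_orthant R d)) => B mB.
rewrite -[LHS]/(Q (pos @^-1` B)).
have mpB : measurable (pos @^-1` B).
  by rewrite -[X in measurable X]setTI; exact: measurable_funP.
rewrite -[LHS](measure_setI_conull mO mpB Q0) -[RHS](measure_setI_conull mO mB Q0).
congr (Q _).
by apply/seteqP; split => x [/= Bx ox]; split => //=; rewrite ?pos_id// in Bx *.
Qed.

(** A continuous substitute for [self_norm i]: the two agree at x / t and x when
    x_i > t, see [cap_norm_self_norm]. *)
Definition cap_norm (i : 'I_d) (x : V) : V := (Num.max 1 (x ord0 i))^-1 *: x.

Lemma cap_norm_continuous i : continuous (cap_norm i).
Proof.
apply: cts_scale; last exact: cts_id.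
apply: ctsV; last by apply: cts_max; [exact: cst_continuous|exact: coord_cts].
by move=> x; rewrite gt_eqF// lt_max ltr01.
Qed.

HB.instance Definition _ i := isMeasurableFun.Build _ _ _ _ (cap_norm i)
  (continuous_measurable_rV2 (@cap_norm_continuous i)).

Lemma cap_norm_orthant i x : orthant x -> orthant (cap_norm i x).
Proof. by move=> ox; apply: orthant_scale => //; rewrite invr_ge0 le_max ler01. Qed.

Lemma cap_norm_self_norm i (t : R) (x : V) : 0 < t -> t < x ord0 i ->
  cap_norm i (divs t x) = self_norm i x.
Proof.
move=> t0 tx; rewrite /cap_norm /self_norm /divs /coord mxE scalerA.
rewrite max_r; last by rewrite mulrC ler_pdivlMr// mul1r ltW.
by rewrite invfM invrK mulrAC mulfV ?gt_eqF// mul1r.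
Qed.

Lemma Rintegral_distribution dT (T : measurableType dT) d' (U : measurableType d')
  (P : probability T R) (h : {mfun T >-> U}) (f : U -> R) :
  measurable_fun setT f -> (exists M : R, forall x, `|f x| <= M) ->
  \int[distribution P h]_y f y = \int[P]_x f (h x).
Proof.
move=> mf bf; rewrite /Rintegral (@integral_distribution _ _ _ _ _ _ h (EFin \o f))//.
  exact/measurable_EFinP.
apply: (@prob_integrable _ _ _ P setT (f \o h)) => //; first exact: measurableT_comp.
by move: bf => [M fM]; exists M => x; exact: fM.
Qed.

End orthant_vectors.

Section regular_variation.
Context {R : realType} {d : nat}.
Local Notation V := 'rV[R]_d.
Variables (X : orvec R d) (i : 'I_d) (b : R -> R) (alpha c : R).
Hypotheses (alpha_gt0 : 0 < alpha) (b_rv : regularly_varying b alpha) (c_gt0 : 0 < c).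
Hypothesis tails : b t * tail X i t @[t --> +oo] --> c.
Local Notation T := (tail X i).
Local Notation E t := [set x : V | t < x ord0 i].

Lemma rv_gt0 : \forall t \near +oo, 0 < b t.
Proof.
have [[a [_ ba]] _] := b_rv; near=> t; apply: ba.
by near: t; apply: nbhs_pinfty_gt; exact: num_real.
Unshelve. all: by end_near. Qed.

Lemma tail_gt0 : \forall t \near +oo, 0 < T t.
Proof.
near=> t; have b0 : 0 < b t by near: t; exact: rv_gt0.
rewrite lt_neqAle tail_ge0 andbT eq_sym; apply/eqP => T0.
have : 0 < b t * T t by near: t; exact: (cvgr_gt _ tails).
by rewrite T0 mulr0 ltxx.
Unshelve. all: by end_near. Qed.

Lemma scaled_pinfty (a : R) : 0 < a -> a * t @[t --> +oo] --> +oo.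
Proof. by move=> a0; apply: gt0_cvgMry => //; exact: cvg_id. Qed.

Lemma near_scaled (a : R) (P : R -> Prop) : 0 < a ->
  (\forall t \near +oo, P t) -> \forall t \near +oo, P (a * t).
Proof. by move=> a0 H; exact: (scaled_pinfty a0). Qed.

(** Factor as b(t) / b(a t) times b(a t) T(a t). The first factor is regular variation with ratio 1
    / a, taken along a t. *)
Lemma rv_tail (a : R) : 0 < a -> b t * T (a * t) @[t --> +oo] --> c * a `^ (- alpha).
Proof.
move=> a0; have [_ rv] := b_rv.
have ai0 : 0 < a^-1 by rewrite invr_gt0.
have h1 : b t / b (a * t) @[t --> +oo] --> a `^ (- alpha).
  have := cvg_comp _ _ (scaled_pinfty a0) (rv _ ai0).
  have -> : a^-1 `^ alpha = a `^ (- alpha).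
    by rewrite -(powR_inv1 (ltW a0)) -powRrM mulN1r.
  apply: cvg_trans; apply: near_eq_cvg; near=> t => /=.
  by rewrite mulrA mulVf ?gt_eqF// mul1r.
have h2 : b (a * t) * T (a * t) @[t --> +oo] --> c.
  exact: cvg_comp _ _ (scaled_pinfty a0) tails.
have : b t / b (a * t) * (b (a * t) * T (a * t)) @[t --> +oo] --> c * a `^ (- alpha).
  by rewrite [X in _ --> X]mulrC; exact: cvgM.
apply: cvg_trans; apply: near_eq_cvg; near=> t => /=.
have b0 : 0 < b (a * t) by near: t; exact: (near_scaled (P := fun t => 0 < b t) a0 rv_gt0).
by rewrite mulrA -[b t / _ * _]mulrA mulVf ?gt_eqF// mulr1.
Unshelve. all: by end_near. Qed.

Lemma tail_ratio (a : R) : 0 < a -> T (a * t) / T t @[t --> +oo] --> a `^ (- alpha).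
Proof.
move=> a0; have c0 : c != 0 by rewrite gt_eqF.
have : b t * T (a * t) * (b t * T t)^-1 @[t --> +oo] --> c * a `^ (- alpha) * c^-1.
  by apply: cvgM; [exact: rv_tail|exact: cvgV].
rewrite mulrAC divff// mul1r; apply: cvg_trans; apply: near_eq_cvg; near=> t => /=.
have b0 : 0 < b t by near: t; exact: rv_gt0.
by rewrite invfM mulrACA divff ?gt_eqF// mul1r.
Unshelve. all: by end_near. Qed.

Lemma self_norm_polar Theta : cvg_self_norm X i Theta -> cvg_polar X alpha i Theta.
Proof.
move=> /(cvg_self_normP tail_gt0) HT; apply/(cvg_polarP tail_gt0 _ alpha_gt0).
apply: polar_weak_cvg.
- move=> a m a1 cm bm; have a0 : 0 < a by exact: lt_le_trans a1.
  have mm : measurable_fun setT m by exact: continuous_measurable_rV.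
  have mI : measurable_fun setT (\1_(`]a, +oo[%classic : set R) : R -> R).
    exact: measurable_indic.
  have bI : exists M : R, forall x, `|(\1_(`]a, +oo[%classic : set R) x : R)| <= M.
    by exists 1 => x; rewrite indicE; case: (_ \in _); rewrite ?normr1 ?normr0.
  pose F (z : R * V) : R := \1_(`]a, +oo[%classic : set R) z.1 * m z.2.
  have FE : (fun z : R * V => \1_[set z | a < z.1] z * m z.2) = F.
    apply/funext => z; rewrite /F !indicE.
    have -> // : (z \in [set z : R * V | a < z.1]) = (z.1 \in (`]a, +oo[%classic : set R)).
    by apply/idP/idP; rewrite !inE/= in_itv/= andbT.
  rewrite FE.
  have mF : measurable_fun setT F.
    apply: measurable_funM.
      by apply: (measurableT_comp mI); exact: measurable_fst.
    by apply: (measurableT_comp mm); exact: measurable_snd.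
  have bF : exists M : R, forall z, `|F z| <= M.
    move: bm => [M mM]; exists M => z; rewrite /F normrM indicE.
    by case: (_ \in _); rewrite ?normr1 ?mul1r// normr0 mul0r (le_trans _ (mM z.2)).
  have -> : \int[(pareto alpha \x law Theta)%E]_z F z = \int[law Theta]_y m y * a `^ (- alpha).
    rewrite Rintegral_prod_mul// mulrC; congr (_ * _).
    transitivity (fine (pareto alpha `]a, +oo[%classic)).
      by rewrite /Rintegral integral_indic// setIT.
    by rewrite pareto_gt// max_r.
  have : \int[cond_law X i (a * t) (self_norm i)]_x m x * (T (a * t) / T t)
      @[t --> +oo] --> \int[law Theta]_y m y * a `^ (- alpha).
    apply: cvgM; last exact: tail_ratio.
    exact: (cvg_comp _ _ (scaled_pinfty a0) (HT m cm bm)).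
  apply: cvg_trans; apply: near_eq_cvg; near=> t => /=.
  have t0 : 0 < t by near: t; exact: nbhs_pinfty_gt.
  have T0 : 0 < T t by near: t; exact: tail_gt0.
  have Ta0 : 0 < T (a * t) by near: t; exact: (near_scaled (P := fun t => 0 < T t) a0 tail_gt0).
  rewrite !Rintegral_cond_law// mulrA -[X in X / _]mulrA mulVf ?gt_eqF// mulr1.
  congr (_ / _); rewrite Rintegral_mkcond [RHS]Rintegral_mkcond; apply: eq_Rintegral => x _.
  rewrite !patchE /F /polar /= indicE.
  have -> : (Defs.coord i x / t \in (`]a, +oo[%classic : set R)) = (a * t < x ord0 i).
    apply/idP/idP; rewrite inE/= in_itv/= andbT ltr_pdivlMr//.
  have -> : (x \in E (a * t)) = (a * t < x ord0 i) by apply/idP/idP; rewrite inE.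
  have -> : (x \in E t) = (t < x ord0 i) by apply/idP/idP; rewrite inE.
  case: ltP => [ax|_]; last by rewrite mul0r; case: ifP.
  (* Here a >= 1 enters: {x_i > a t} is contained in the conditioning event {x_i > t}. *)
  rewrite mul1r (le_lt_trans _ ax)//.
  by rewrite ler_peMl// ltW.
- near=> t; have t0 : 0 < t by near: t; exact: nbhs_pinfty_gt.
  apply: cond_law_null.
  + by near: t; exact: tail_gt0.
  + apply: measurableC; rewrite (_ : [set _ | _] = `]1, +oo[%classic `*` setT).
      by apply: measurableX => //; exact: measurable_itv.
    by apply/seteqP; split => -[u y] /=; rewrite in_itv/= andbT => //; case.
  + move=> x ox tx; apply => /=; rewrite ltr_pdivlMr// mul1r//.
- exact: pareto_prod_gt1.
Unshelve. all: by end_near. Qed.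

Lemma polar_self_norm Theta : cvg_polar X alpha i Theta -> cvg_self_norm X i Theta.
Proof.
move=> /(cvg_polarP tail_gt0 _ alpha_gt0) HP; apply/(cvg_self_normP tail_gt0) => f cf bf.
have mf : measurable_fun setT f by exact: continuous_measurable_rV.
have cf2 : continuous (fun z : R * V => f z.2) by apply: cts_comp => //; exact: cts_snd.
have bf2 : exists M : R, forall z : R * V, `|f z.2| <= M.
  by move: bf => [M fM]; exists M => z; exact: fM.
have := HP _ cf2 bf2.
have -> : \int[(pareto alpha \x law Theta)%E]_z f z.2 = \int[law Theta]_y f y.
  have b1 : exists M : R, forall x : R, `|(cst 1 : R -> R) x| <= M.
    by exists 1 => x; rewrite normr1.
  have := @Rintegral_prod_mul _ _ _ _ _ (pareto alpha) (law Theta) (cst 1) f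
    (measurable_cst _) mf b1 bf.
  under eq_Rintegral do rewrite /= mul1r.
  by move=> ->; rewrite Rintegral_prob_cst mul1r.
apply: cvg_trans; apply: near_eq_cvg; near=> t => /=.
have T0 : 0 < T t by near: t; exact: tail_gt0.
by rewrite !Rintegral_cond_law//; exact: continuous_measurable_prod.
Unshelve. all: by end_near. Qed.

(** Scaling x / x_i by x_i / t gives back x / t. The limit is left as an integral, since it serves
    both to construct a vector Y and to identify the law of a given one. *)
Lemma polar_exceed Theta (f : V -> R) : cvg_polar X alpha i Theta ->
  continuous f -> (exists M : R, forall x, `|f x| <= M) ->
  \int[cond_law X i t (divs t)]_x f x @[t --> +oo] -->
    \int[(pareto alpha \x law Theta)%E]_z f (scale2 z).
Proof.
move=> /(cvg_polarP tail_gt0 _ alpha_gt0) HP cf bf.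
have mf : measurable_fun setT f by exact: continuous_measurable_rV.
have cf2 : continuous (fun z : R * V => f (scale2 z)).
  by apply: cts_comp => //; exact: continuous_scale2.
have bf2 : exists M : R, forall z : R * V, `|f (scale2 z)| <= M.
  by move: bf => [M fM]; exists M => z; exact: fM.
apply: cvg_trans (HP _ cf2 bf2); apply: near_eq_cvg; near=> t => /=.
have T0 : 0 < T t by near: t; exact: tail_gt0.
have t0 : 0 < t by near: t; exact: nbhs_pinfty_gt.
rewrite !Rintegral_cond_law//; last exact: continuous_measurable_prod.
congr (_ / _); apply: eq_Rintegral => x; rewrite inE/= => tx.
congr f; rewrite /scale2/= /self_norm /divs /coord scalerA.
by rewrite mulrAC divff ?mul1r// gt_eqF// (lt_trans t0 tx).
Unshelve. all: by end_near. Qed.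

Lemma polar_exceed_ex Theta : cvg_polar X alpha i Theta ->
  exists Y : orvec R d, cvg_exceed X i Y.
Proof.
move=> HP.
pose Q := distribution (pareto alpha \x law Theta)%E [the {mfun (R * V)%type >-> V} of scale2].
have mO := @measurable_orthant R d.
have Q0 : Q (~` orthant) = 0%E.
  apply: (@subset_measure0 _ _ _ (pareto alpha \x law Theta)%E _
    (~` ([set u | 0 <= u] `*` orthant))).
  - by rewrite -[X in measurable X]setTI; apply: measurable_scale2 => //; exact: measurableC.
  - apply: measurableC; apply: measurableX => //.
    rewrite (_ : [set z | _] = `[0, +oo[%classic); first exact: measurable_itv.
    by apply/seteqP; split => x /=; rewrite in_itv/= andbT.
  - by move=> [u y] /= H [/= u0 oy]; apply: H; exact: orthant_scale.
  - exact: pareto_prod_null.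
have [Y YE] := orvec_of_prob Q0; exists Y.
apply/(cvg_exceedP tail_gt0) => f cf bf.
rewrite (eq_measure_Rintegral (nu := Q)); last by move=> B mB _; exact: YE.
rewrite Rintegral_distribution//; last exact: continuous_measurable_rV.
exact: polar_exceed.
Qed.

Lemma exceed_self_norm Y : cvg_exceed X i Y ->
  exists Theta : orvec R d, cvg_self_norm X i Theta.
Proof.
move=> /(cvg_exceedP tail_gt0) HY.
pose Q := distribution (law Y) [the {mfun V >-> V} of cap_norm i].
have mO := @measurable_orthant R d.
have Q0 : Q (~` orthant) = 0%E.
  apply: (@subset_measure0 _ _ _ (law Y) _ (~` orthant)).
  - by rewrite -[X in measurable X]setTI; apply: measurable_funP => //; exact: measurableC.
  - exact: measurableC.
  - by move=> y /= H oy; apply: H; exact: cap_norm_orthant.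
  - exact: law_orthant.
have [Th TE] := orvec_of_prob Q0; exists Th.
apply/(cvg_self_normP tail_gt0) => f cf bf.
have mf : measurable_fun setT f by exact: continuous_measurable_rV.
rewrite (eq_measure_Rintegral (nu := Q)); last by move=> B mB _; exact: TE.
rewrite Rintegral_distribution//.
have cf2 : continuous (fun x : V => f (cap_norm i x)).
  by apply: cts_comp => //; exact: cap_norm_continuous.
have bf2 : exists M : R, forall x : V, `|f (cap_norm i x)| <= M.
  by move: bf => [M fM]; exists M => z; exact: fM.
apply: cvg_trans (HY _ cf2 bf2); apply: near_eq_cvg; near=> t => /=.
have T0 : 0 < T t by near: t; exact: tail_gt0.
have t0 : 0 < t by near: t; exact: nbhs_pinfty_gt.
rewrite !Rintegral_cond_law//; last exact: continuous_measurable_rV.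
congr (_ / _); apply: eq_Rintegral => x; rewrite inE/= => tx.
by rewrite cap_norm_self_norm.
Unshelve. all: by end_near. Qed.

End regular_variation.

(** * The limit measure in terms of Theta *)

Section product_sections.
Context {d1 d2} {T1 : measurableType d1} {T2 : measurableType d2} {R : realType}.
Variables (m1 : {sigma_finite_measure set T1 -> \bar R}) (Q : probability T2 R).

(** Tonelli's theorem: if the sections of two sets have proportional measures for almost every y, so
    do the sets. The first factors may differ, which allows [kappa] on one side and the Pareto law
    on the other. *)
Lemma prod_measure_section (m2 : {sigma_finite_measure set T1 -> \bar R})
    (k : R) (D : set T2) (A B : set (T1 * T2)) :
  0 <= k -> measurable A -> measurable B -> measurable D -> Q (~` D) = 0%E ->
  (forall y, D y -> m1 [set x | A (x, y)] = (k%:E * m2 [set x | B (x, y)])%E) ->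
  (m1 \x Q)%E A = (k%:E * (m2 \x Q)%E B)%E.
Proof.
move=> k0 mA mB mD D0 AB.
have sec (m : {sigma_finite_measure set T1 -> \bar R}) (C : set (T1 * T2)) :
    measurable C ->
    (m \x Q)%E C = (\int[Q]_y fubini_G m (fun z => (\1_C z)%:E) y)%E /\
    measurable_fun setT (fubini_G m (fun z => (\1_C z)%:E)) /\
    (forall y, (0 <= fubini_G m (fun z => (\1_C z)%:E) y)%E) /\
    (forall y, fubini_G m (fun z => (\1_C z)%:E) y = m [set x | C (x, y)]).
  move=> mC; have mI : measurable_fun setT (fun z : T1 * T2 => (\1_C z)%:E : \bar R).
    by apply/measurable_EFinP; exact: measurable_indic.
  have p0 z : (0 <= (\1_C z)%:E :> \bar R)%E by rewrite lee_fin.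
  split; [|split; [|split]].
  - by rewrite -fubini_tonelli2// integral_indic// setIT.
  - exact: measurable_fun_fubini_tonelli_G.
  - by move=> y; apply: integral_ge0.
  - move=> y; have mCy : measurable [set x | C (x, y)].
      rewrite (_ : [set x | _] = ysection C y); last by rewrite ysectionE.
      exact: measurable_ysection.
    rewrite /fubini_G/=.
    transitivity (\int[m]_x (\1_[set x | C (x, y)] x)%:E)%E; last first.
      by rewrite integral_indic// setIT.
    apply: eq_integral => x _; rewrite !indicE.
    have -> // : ((x, y) \in C) = (x \in [set x | C (x, y)]) by apply/idP/idP; rewrite !inE.
have [-> [mG1 [G10 G1E]]] := sec m1 A mA.
have [-> [mG2 [G20 G2E]]] := sec m2 B mB.
have red (h : T2 -> \bar R) : measurable_fun setT h -> (forall y, (0 <= h y)%E) ->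
    (\int[Q]_y h y = \int[Q]_(y in D) h y)%E.
  move=> mh h0; have := @ge0_negligible_integral _ _ _ Q setT (~` D) h (measurableC mD)
    measurableT mh (fun y _ => h0 y) D0.
  by rewrite setDE setCK setTI.
rewrite -ge0_integralZl// red// [RHS]red//; last 2 first.
- exact: measurable_funeM.
- by move=> y; rewrite mule_ge0.
apply: eq_integral => y; rewrite inE => Dy.
by rewrite G1E G2E AB.
Qed.

End product_sections.

Section spectral_measure.
Context {R : realType} {d : nat}.
Local Notation V := 'rV[R]_d.
Variables (Theta : orvec R d) (i : 'I_d) (alpha : R).
Hypothesis alpha_gt0 : 0 < alpha.
Hypothesis Theta1 : law Theta (~` [set x | x ord0 i = 1]) = 0%E.

Let m1 : measurable [set x : V | x ord0 i = 1].
Proof.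
have := @measurable_coord R d i measurableT [set 1%R] (measurable_set1 _).
by rewrite setTI.
Qed.

Let scale_e (e : R) (z : R * V) : V := e *: scale2 z.

Let measurable_scale_e e : measurable_fun setT (scale_e e).
Proof. by apply: measurableT_comp; [exact: measurable_scale|exact: measurable_scale2]. Qed.

(** For almost every y one has y_i = 1, so z is the i-th coordinate of z y. Hence the section of the
    preimage of A at y lies in ]e, +oo[, where [kappa_pareto] applies. *)
Lemma kappa_prod (e : R) (A : set V) : 0 < e -> measurable A ->
  A `<=` [set x | e < x ord0 i] ->
  (kappa alpha \x law Theta)%E (scale2 @^-1` A) =
  ((e `^ (- alpha))%:E *
    ((pareto alpha \x law Theta)%E : probability _ R) (scale_e e @^-1` A))%E.
Proof.
move=> e0 mA Ae.
apply: (@prod_measure_section _ _ _ _ R (kappa alpha) (law Theta) (pareto alpha) _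
  [set x | x ord0 i = 1]) => //.
- exact: powR_ge0.
- by rewrite -[X in measurable X]setTI; exact: measurable_scale2.
- by rewrite -[X in measurable X]setTI; exact: measurable_scale_e.
move=> y /= y1.
have mS : measurable [set z : R | A (z *: y)].
  rewrite (_ : [set z | _] = ysection (scale2 @^-1` A) y); last by rewrite ysectionE.
  by apply: measurable_ysection; rewrite -[X in measurable X]setTI; exact: measurable_scale2.
transitivity (kappa alpha ([set z : R | A (z *: y)] `&` `]e, +oo[%classic)).
  congr (kappa alpha _); apply/seteqP; split => z /=; last by move=> [].
  rewrite /scale2/= => Az; split => //; rewrite in_itv/= andbT.
  by have := Ae _ Az; rewrite /= mxE y1 mulr1.
rewrite kappa_pareto//; congr (_ * pareto alpha _)%E.
by apply/seteqP; split => z /=; rewrite /scale_e /scale2/= scalerA.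
Qed.

Lemma spectral_measure_ex (c : R) : 0 < c -> exists nu : M0 R [set i]%SET,
  forall B, measurable B ->
    nu B = (c%:E * (kappa alpha \x law Theta)%E (scale2 @^-1` (B `&` S0 [set i]%SET)))%E.
Proof.
move=> c0; pose k : {nonneg R} := NngNum (ltW c0).
have mS := @measurable_S0 R d [set i]%SET.
pose mu : {measure set V -> \bar R} :=
  mrestr (mscale k (mpush (kappa alpha \x law Theta)%E (@measurable_scale2 R d))) mS.
have mu0 : mu (~` S0 [set i]%SET) = 0%E by rewrite /mu/= /mrestr setICl measure0.
have muf B e : measurable B -> 0 < e ->
    B `<=` orthant `&` [set x | e <= max_on [set i]%SET x] -> (mu B < +oo)%E.
  (* Half the level, because [kappa_prod] wants a strict inequality whereas points of B satisfy x_i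
     >= e. *)
  move=> mB e0 Be; have e20 : 0 < e / 2 by rewrite divr_gt0.
  have mBS : measurable (B `&` S0 [set i]%SET) by exact: measurableI.
  rewrite -[mu B]/(c%:E * (kappa alpha \x law Theta)%E (scale2 @^-1` (B `&` S0 [set i]%SET)))%E.
  rewrite (kappa_prod e20)//; last first.
    move=> x [Bx _] /=; have [_ /= ex] := Be x Bx.
    rewrite ltNge; apply/negP => xe; have : max_on [set i]%SET x <= e / 2.
      by rewrite max_on1_le// ltW.
    by move=> /(le_trans ex); rewrite leNgt ltr_pdivrMr// ltr_pMr// ltr1n.
  rewrite muleA -EFinM lte_mul_pinfty//.
    by rewrite lee_fin mulr_ge0// ?powR_ge0// ltW.
  by apply: (le_lt_trans (probability_le1 _ _)); rewrite ?ltry//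
    -[X in measurable X]setTI; exact: measurable_scale_e.
by exists (MkM0 mu0 muf).
Qed.

Variable (c : R) (nu : M0 R [set i]%SET).
Hypothesis c_gt0 : 0 < c.
Hypothesis nuE : forall B, measurable B ->
  nu B = (c%:E * (kappa alpha \x law Theta)%E (scale2 @^-1` (B `&` S0 [set i]%SET)))%E.

Lemma spectral_measure_gt (e : R) (A : set V) : 0 < e -> measurable A ->
  A `<=` [set x | e < x ord0 i] ->
  nu A = ((c * e `^ (- alpha))%:E *
    ((pareto alpha \x law Theta)%E : probability _ R) (scale_e e @^-1` A))%E.
Proof.
move=> e0 mA Ae; have mS := @measurable_S0 R d [set i]%SET.
have mO := @measurable_orthant R d.
have mAS : measurable (A `&` S0 [set i]%SET) by exact: measurableI.
rewrite nuE// (kappa_prod e0)//; last by move=> x [/Ae].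
rewrite muleA -EFinM; congr (_ * _)%E.
set P := ((pareto alpha \x law Theta)%E : probability _ R).
have P0 := pareto_prod_null Theta alpha_gt0.
have mN : measurable ([set u : R | 0 <= u] `*` (orthant : set V)).
  apply: measurableX => //.
  rewrite (_ : [set z | _] = `[0, +oo[%classic); first exact: measurable_itv.
  by apply/seteqP; split => x /=; rewrite in_itv/= andbT.
have mp B : measurable B -> measurable (scale_e e @^-1` B).
  by move=> mB; rewrite -[X in measurable X]setTI; exact: measurable_scale_e.
rewrite -[LHS](measure_setI_conull mN (mp _ mAS) P0) -[RHS](measure_setI_conull mN (mp _ mA) P0).
congr (P _); apply/seteqP; split => z /=; first by move=> [[? _] ?].
move=> [Az [z0 oz]]; split => //; split => //; rewrite S01E; split.
  by apply: orthant_scale; [exact: ltW|exact: orthant_scale].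
by apply: lt_trans e0 _; exact: Ae.
Qed.

(** The right-hand side mirrors b(t) P(X_i > e t) times a conditional expectation given X_i > e t:
    by [rv_tail], c e^(-alpha) is the limit of the first factor. *)
Lemma spectral_measure_integral (e : R) (g : V -> R) : 0 < e ->
  continuous g -> (exists M : R, forall x, `|g x| <= M) ->
  (forall x : V, x ord0 i <= e -> g x = 0) ->
  \int[nu]_x g x = c * e `^ (- alpha) *
    \int[(pareto alpha \x law Theta)%E]_z g (e *: scale2 z).
Proof.
move=> e0 cg bg g0.
have mg : measurable_fun setT g by exact: continuous_measurable_rV.
have k0 : 0 <= c * e `^ (- alpha) by rewrite mulr_ge0 ?powR_ge0 ?ltW.
pose k : {nonneg R} := NngNum k0.
have gD x : ~ [set x : V | e < x ord0 i] x -> g x = 0.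
  by move=> /= /negP; rewrite -leNgt; exact: g0.
rewrite (Rintegral_support _ gD).
pose P := ((pareto alpha \x law Theta)%E : probability _ R).
rewrite (eq_measure_Rintegral (nu := mscale k (mpush P (measurable_scale_e e)))); last first.
  by move=> A mA Ae; rewrite (spectral_measure_gt e0 mA Ae).
rewrite -(Rintegral_support _ gD).
have ig : P.-integrable setT (EFin \o (g \o scale_e e)).
  apply: prob_integrable => //; first exact: measurableT_comp.
  by move: bg => [M gM]; exists M => z; exact: gM.
rewrite Rintegral_mscale//; last first.
  apply: integrable_bounded => //; last by move: bg => [M gM]; exists M => z _; exact: gM.
  by apply: (le_lt_trans (probability_le1 P measurableT)); exact: ltry.
by rewrite Rintegral_mpush.
Qed.

End spectral_measure.

(** * Gluing limits in M0 *)

Section M0_limits.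
Context {R : realType} {d : nat}.
Local Notation V := 'rV[R]_d.
Variables (X : orvec R d) (b : R -> R).

Lemma le_max_on_set1 (J : {set 'I_d}) i (x : V) :
  i \in J -> max_on [set i]%SET x <= max_on J x.
Proof.
move=> iJ; rewrite max_on1_le ?max_on_ge0//; exact: le_max_on.
Qed.

Lemma max_on_setU1 (J : {set 'I_d}) i (x : V) :
  max_on (i |: J)%SET x = Num.max (max_on [set i]%SET x) (max_on J x).
Proof.
apply/eqP; rewrite eq_le; apply/andP; split.
  apply/max_on_leP; split; first by rewrite le_max max_on_ge0.
  move=> j; rewrite finset.in_setU1 le_max => /orP[/eqP ->|jJ].
    by rewrite le_max_on// finset.in_set1.
  by rewrite (le_max_on x jJ) orbT.
rewrite ge_max; apply/andP; split; apply/max_on_leP; split; try exact: max_on_ge0.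
  by move=> j /finset.set1P ->; apply: le_max_on; rewrite finset.setU11.
by move=> j jJ; apply: le_max_on; rewrite finset.in_setU1 jJ orbT.
Qed.

Lemma vanishing_test_sub (J K : {set 'I_d}) (g : V -> R) :
  (forall x : V, max_on J x <= max_on K x) -> vanishing_test J g -> vanishing_test K g.
Proof.
move=> JK [cg bg [e e0 g0]]; split => //; exists e => // x xe; apply: g0.
exact: le_trans xe.
Qed.

Lemma M0_conull (J : {set 'I_d}) (nu : M0 R J) (A : set V) : measurable A ->
  nu (A `&` S0 J) = nu A.
Proof.
by move=> mA; apply: measure_setI_conull => //; [exact: measurable_S0|exact: m0_carrier].
Qed.

(** A function vanishing where [min (max_on J) (max_on K)] is small is a test
    function for both spaces. *)
Lemma M0_limits_agree (J K : {set 'I_d}) (nu : M0 R J) (nu' : M0 R K) (B : set V) :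
  cvg_M0 X b nu -> cvg_M0 X b nu' -> measurable B ->
  nu (B `&` (S0 J `&` S0 K)) = nu' (B `&` (S0 J `&` S0 K)).
Proof.
move=> /cvg_M0P H /cvg_M0P H' mB.
pose w (x : V) := Num.min (max_on J x) (max_on K x).
have cw : continuous w by apply: cts_min; exact: max_on_continuous.
have mw (e : R) : measurable [set x | e < w x].
  apply: open_measurable_mx; apply: (@open_comp _ _ w [set y | e < y]); last exact: open_gt.
  by move=> x _; exact: cw.
have fin (L : {set 'I_d}) (mu : M0 R L) : (forall x, w x <= max_on L x) ->
    forall e, 0 < e -> (mu [set x | (e < w x)%R] < +oo)%E.
  move=> wL e e0; apply: le_lt_trans (m0_gt_fin mu e0).
  apply: le_measure; rewrite ?inE//; first exact: measurable_max_on_gt.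
  by move=> x /= /lt_le_trans; apply.
have wJ x : w x <= max_on J x by rewrite ge_min lexx.
have wK x : w x <= max_on K x by rewrite ge_min lexx orbT.
have key : forall C, measurable C ->
    nu (C `&` [set x | 0 < w x]) = nu' (C `&` [set x | 0 < w x]).
  apply: (measure_unique_continuous cw (fin _ nu wJ) (fin _ nu' wK)) => f cf f01 [e e0 f0].
  have bf : exists M : R, forall x, `|f x| <= M.
    by exists 1 => x; have /andP[? ?] := f01 x; rewrite ger0_norm.
  have tJ : vanishing_test J f.
    by split => //; exists e => // x xe; apply: f0; exact: le_trans xe.
  have tK : vanishing_test K f.
    by split => //; exists e => // x xe; apply: f0; exact: le_trans xe.
  exact: (cvg_unique _ (H f tJ) (H' f tK)).
have -> : B `&` (S0 J `&` S0 K) = (B `&` orthant) `&` [set x : V | 0 < w x].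
  apply/seteqP; split => x /=; rewrite /w lt_min; first by move=> [? [[? ?] [? ?]]]; split => //; apply/andP.
  by move=> [[? ?] /andP[? ?]].
by apply: key; apply: measurableI => //; exact: measurable_orthant.
Qed.

Lemma M0_limit_sub (J : {set 'I_d}) i (nu : M0 R J) (nui : M0 R [set i]%SET) (B : set V) :
  i \in J -> cvg_M0 X b nu -> cvg_M0 X b nui -> measurable B ->
  nui B = nu (B `&` S0 [set i]%SET).
Proof.
move=> iJ H Hi mB; rewrite -(M0_conull nui mB).
have SJ : S0 [set i]%SET = S0 J `&` S0 [set i]%SET :> set V.
  apply/seteqP; split => x /=; last by case.
  move=> [ox x0]; split => //; split => //=; apply: lt_le_trans x0 _.
  exact: le_max_on_set1.
by rewrite SJ; apply/esym; exact: M0_limits_agree.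
Qed.

Lemma M0_integral_sub (J K : {set 'I_d}) (nu : M0 R J) (nu' : M0 R K) (g : V -> R) :
  (forall x : V, max_on J x <= max_on K x) ->
  (forall A, measurable A -> nu A = nu' (A `&` S0 J)) -> vanishing_test J g ->
  \int[nu]_x g x = \int[nu']_x g x.
Proof.
move=> JK nuE [_ _ [e e0 g0]].
have gS x : ~ [set x : V | 0 < max_on J x] x -> g x = 0.
  by move=> /= /negP; rewrite -leNgt => x0; rewrite g0// (le_trans x0)// ltW.
have mS := @measurable_S0 R d J.
rewrite (Rintegral_support _ gS) [RHS](Rintegral_support _ gS).
apply: eq_measure_Rintegral => A mA Ai; rewrite nuE// -[RHS](M0_conull nu' mA).
rewrite -[LHS](M0_conull nu'); last exact: measurableI.
congr (nu' _); apply/seteqP; split => x /=; first by move=> [[]].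
by move=> [Ax [ox xJ]]; split => //; split => //; split => //; exact: Ai.
Qed.

(** [nu'] is [nui] on [S0 [set i]] and [nu] elsewhere. A test function [g] for
    [i |: J] is [g chi + g (1 - chi)], with a continuous cutoff [chi] of [x_i] that
    makes the two terms test functions for [i] and for [J]. *)
Lemma M0_merge (J : {set 'I_d}) i (nu : M0 R J) (nui : M0 R [set i]%SET) :
  cvg_M0 X b nu -> cvg_M0 X b nui ->
  exists nu' : M0 R (i |: J)%SET, cvg_M0 X b nu'.
Proof.
move=> HJ Hi; have mS := @measurable_S0 R d [set i]%SET.
have mSJ := @measurable_S0 R d J.
have mC : measurable (~` S0 [set i]%SET : set V) by exact: measurableC.
pose mu : {measure set V -> \bar R} := measure_add (mrestr nu mC) nui.
have muE A : mu A = (nu (A `&` ~` S0 [set i]%SET) + nui A)%E by exact: measure_addE.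
have S0U : S0 (i |: J)%SET = S0 [set i]%SET `|` S0 J :> set V.
  apply/seteqP; split => x /=; rewrite /S0/= max_on_setU1 lt_max.
    by move=> [ox /orP[]]; [left|right].
  by move=> [[ox x0]|[ox x0]]; rewrite x0 ?orbT.
have mu0 : mu (~` S0 (i |: J)%SET) = 0%E.
  rewrite muE S0U setCU.
  have -> : nu (~` S0 [set i]%SET `&` ~` S0 J `&` ~` S0 [set i]%SET) = 0%E.
    apply: (@subset_measure0 _ _ _ nu _ (~` S0 J)) => //.
    - by apply: measurableI => //; apply: measurableI => //; exact: measurableC.
    - exact: measurableC.
    - by move=> x [[]].
    - exact: m0_carrier.
  rewrite add0e; apply: (@subset_measure0 _ _ _ nui _ (~` S0 [set i]%SET)) => //.
  - by apply: measurableI => //; exact: measurableC.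
  - exact: m0_carrier.
have mui A : measurable A -> nui A = mu (A `&` S0 [set i]%SET).
  by move=> mA; rewrite muE -setIA setICr setI0 measure0 add0e M0_conull.
have muJ A : measurable A -> nu A = mu (A `&` S0 J).
  move=> mA; have mAJ : measurable (A `&` S0 J) by exact: measurableI.
  (* The two limits agree on the overlap, so nothing of [nu] is lost by letting [nui] take over all
     of [S0 [set i]]. *)
  have E : nui (A `&` S0 J) = nu (A `&` S0 J `&` S0 [set i]%SET).
    by rewrite -(M0_conull nui mAJ) -setIA -(M0_limits_agree HJ Hi mA) setIA.
  rewrite muE E -(M0_conull nu mA).
  rewrite -[in LHS](setIT (A `&` _)) -(setUv (S0 [set i]%SET)) setIUr measureU//.
  - by rewrite addeC.
  - exact: measurableI.
  - exact: measurableI.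
  - by rewrite setIACA setICr setI0.
have muf B e : measurable B -> 0 < e ->
    B `<=` orthant `&` [set x | e <= max_on (i |: J)%SET x] -> (mu B < +oo)%E.
  move=> mB e0 Be; have e20 : 0 < e / 2 by rewrite divr_gt0.
  have e2e : e / 2 < e by rewrite ltr_pdivrMr// ltr_pMr// ltr1n.
  pose W (K : {set 'I_d}) : set V := [set x | e / 2 < max_on K x].
  have mW K : measurable (W K) by exact: measurable_max_on_gt.
  (* As [max_on (i |: J)] is the larger of two maxima, B is covered by two sets, on each of which
     [mu] is one of the given measures; e / 2 provides the strict inequality of [m0_gt_fin]. *)
  apply: (@le_lt_trans _ _ (mu ((W [set i]%SET `&` S0 [set i]%SET) `|` (W J `&` S0 J)))).
    apply: le_measure; rewrite ?inE//.
      by apply: measurableU; exact: measurableI.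
    move=> x /Be[ox /= ex]; have : e / 2 < max_on (i |: J)%SET x by exact: lt_le_trans ex.
    by rewrite max_on_setU1 lt_max => /orP[x2|x2]; [left|right]; split => //; split => //=;
      exact: lt_trans x2.
  apply: le_lt_trans (measureU2 _ _ _) _; [exact: measurableI|exact: measurableI|].
  have [f1 f2] := (m0_gt_fin nui e20, m0_gt_fin nu e20).
  rewrite -/(W _) mui// in f1; rewrite -/(W _) muJ// in f2.
  exact: lte_add_pinfty f1 f2.
pose nu' : M0 R (i |: J)%SET := MkM0 mu0 muf; exists nu'.
apply/cvg_M0P => g [cg [M gM] [e e0 g0]].
(* [chi] rises linearly from 0 at x_i = e / 2 to 1 at x_i = e. Thus g (1 - chi) vanishes when
   [max_on J x] is at most e: either x_i > e and chi = 1, or [max_on (i |: J) x] is at most e and g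
   = 0. *)
pose chi (x : V) : R := Num.min 1 (Num.max 0 (2 / e * x ord0 i - 1)).
have cchi : continuous chi.
  apply: cts_min; first exact: cst_continuous.
  apply: cts_max; first exact: cst_continuous.
  apply: ctsB; last exact: cst_continuous.
  by apply: ctsM; [exact: cst_continuous|exact: coord_cts].
have chi01 (x : V) : 0 <= chi x <= 1.
  by rewrite le_min ler01 le_max lexx/= ge_min lexx.
have chi0 (x : V) : x ord0 i <= e / 2 -> chi x = 0.
  move=> xe; rewrite /chi max_l ?min_r//.
  rewrite subr_le0 mulrAC ler_pdivrMr// mul1r mulrC -ler_pdivlMr//.
have chi1 (x : V) : e < x ord0 i -> chi x = 1.
  move=> xe; rewrite /chi min_l// le_max; apply/orP; right.
  rewrite lerBrDr mulrAC ler_pdivlMr//; lra.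
have t1 : vanishing_test [set i]%SET (fun x => g x * chi x).
  split; first exact: ctsM.
  - exists M => x; have /andP[c0 c1] := chi01 x.
    by rewrite normrM (ger0_norm c0) (le_trans _ (gM x))// ler_piMr.
  - exists (e / 2); first by rewrite divr_gt0.
    by move=> x; rewrite max_on1_le ?divr_ge0// ?(ltW e0)// => xe; rewrite chi0 ?mulr0.
have t2 : vanishing_test J (fun x => g x * (1 - chi x)).
  split.
  - by apply: ctsM => //; apply: ctsB => //; exact: cst_continuous.
  - exists M => x; have /andP[c0 c1] := chi01 x.
    by rewrite normrM [`|1 - _|]ger0_norm ?subr_ge0// (le_trans _ (gM x))// ler_piMr// gerBl.
  - exists e => // x xe; have [xi|xi] := leP (x ord0 i) e; last by rewrite chi1// subrr mulr0.
    rewrite g0 ?mul0r// max_on_setU1 ge_max xe andbT max_on1_le//; exact: ltW.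
have le1 (x : V) : max_on [set i]%SET x <= max_on (i |: J)%SET x.
  by rewrite max_on_setU1 le_max lexx.
have le2 (x : V) : max_on J x <= max_on (i |: J)%SET x.
  by rewrite max_on_setU1 le_max lexx orbT.
have gE (x : V) : g x = g x * chi x + g x * (1 - chi x) by rewrite -mulrDr addrC subrK mulr1.
have -> : \int[nu']_x g x = \int[nui]_x (g x * chi x) + \int[nu]_x (g x * (1 - chi x)).
  rewrite (M0_integral_sub (nu' := nu') le1 mui t1) (M0_integral_sub (nu' := nu') le2 muJ t2).
  rewrite -RintegralD//.
  - by apply: eq_Rintegral => x _; exact: gE.
  - by apply: vanishing_integrable; exact: vanishing_test_sub t1.
  - by apply: vanishing_integrable; exact: vanishing_test_sub t2.
have : `|b t| * (\int[law X]_x (g (t^-1 *: x) * chi (t^-1 *: x))) +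
      `|b t| * (\int[law X]_x (g (t^-1 *: x) * (1 - chi (t^-1 *: x)))) @[t --> +oo] -->
    \int[nui]_x (g x * chi x) + \int[nu]_x (g x * (1 - chi x)).
  by apply: cvgD; [exact: ((cvg_M0P _ _ _).1 Hi _ t1)|exact: ((cvg_M0P _ _ _).1 HJ _ t2)].
apply: cvg_trans; apply: near_eq_cvg; near=> t => /=.
rewrite -mulrDr; congr (_ * _); rewrite -RintegralD//.
- by apply: eq_Rintegral => x _; rewrite -gE.
- apply: prob_integrable => //.
    apply: (measurableT_comp (f := fun x => g x * chi x)); last exact: measurable_scale.
    by apply: continuous_measurable_rV; case: t1.
  by have [_ [N tN] _] := t1; exists N => x; exact: tN.
- apply: prob_integrable => //.
    apply: (measurableT_comp (f := fun x => g x * (1 - chi x))); last exact: measurable_scale.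
    by apply: continuous_measurable_rV; case: t2.
  by have [_ [N tN] _] := t2; exists N => x; exact: tN.
Unshelve. all: by end_near. Qed.

(** Indices are added one at a time by [M0_merge]. The induction starts at the empty set, where
    [max_on] is 0, so that every test function vanishes and the zero measure is a limit. *)
Lemma M0_glue (I : {set 'I_d}) :
  (forall i, i \in I -> exists nui : M0 R [set i]%SET, cvg_M0 X b nui) ->
  exists nu : M0 R I, cvg_M0 X b nu.
Proof.
move=> H; suff : forall s : seq 'I_d, {subset s <= I} ->
    exists nu : M0 R [set x in s]%SET, cvg_M0 X b nu.
  move=> /(_ (enum I)); have -> : [set x in enum I]%SET = I.
    by apply/finset.setP => x; rewrite finset.inE mem_enum.
  by apply => x; rewrite mem_enum.
elim=> [_|i s IH sI].
  have S00 : S0 [set x in [::]]%SET = set0 :> set V.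
    apply/seteqP; split => // x [_ /= /max_on_gt0P[j]]; by rewrite finset.inE.
  have mu0 : (mzero : {measure set V -> \bar R}) (~` S0 [set x in [::] : seq 'I_d]%SET) = 0%E by [].
  have muf (B : set V) (e : R) : measurable B -> 0 < e ->
      B `<=` orthant `&` [set x | e <= max_on [set x in [::] : seq 'I_d]%SET x] ->
      ((mzero : {measure set V -> \bar R}) B < +oo)%E by move=> *; exact: ltry.
  exists (MkM0 mu0 muf); apply/cvg_M0P => g [_ _ [e e0 g0]].
  have gz x : g x = 0.
    apply: g0; apply/max_on_leP; split; first exact: ltW.
    by move=> j; rewrite finset.inE.
  have I0 (m : {measure set V -> \bar R}) (h : V -> V) : \int[m]_x g (h x) = 0.
    rewrite (@eq_Rintegral _ _ _ _ _ (cst 0)); last by move=> x _; exact: gz.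
    by rewrite Rintegral_cst// mul0r.
  have E : (fun t => `|b t| * \int[law X]_x g (t^-1 *: x)) = (fun=> 0).
    by apply/funext => t; rewrite (I0 _ (fun x => t^-1 *: x)) mulr0.
  by rewrite E (I0 _ id); exact: cvg_cst.
have [nu Hnu] : exists nu : M0 R [set x in s]%SET, cvg_M0 X b nu.
  by apply: IH => x xs; apply: sI; rewrite inE xs orbT.
have [nui Hi] := H i (sI i (mem_head _ _)).
have [nu' Hnu'] := M0_merge Hnu Hi.
have E : (i |: [set x in s])%SET = [set x in i :: s]%SET.
  by apply/finset.setP => x; rewrite !finset.inE.
by rewrite -E; exists nu'.
Qed.

End M0_limits.

(** * Self-normalized limits *)

Section self_normalized_limits.
Context {R : realType} {d : nat}.
Local Notation V := 'rV[R]_d.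
Variables (X : orvec R d) (i : 'I_d) (b : R -> R) (alpha c : R).
Hypotheses (alpha_gt0 : 0 < alpha) (b_rv : regularly_varying b alpha) (c_gt0 : 0 < c).
Hypothesis tails : b t * tail X i t @[t --> +oo] --> c.
Local Notation T := (tail X i).
Local Notation E t := [set x : V | t < x ord0 i].

Let tpos : \forall t \near +oo, 0 < T t := tail_gt0 b_rv c_gt0 tails.
Let bpos := rv_gt0 b_rv.

Lemma measurable_coord_eq1 : measurable [set x : V | x ord0 i = 1].
Proof.
have := @measurable_coord R d i measurableT [set 1%R] (measurable_set1 _).
by rewrite setTI.
Qed.

(** The test function min(1, |x_i - 1|) vanishes at X / X_i when X_i > t > 0; its integral in the
    limit is 0, and so it is 0 almost everywhere. *)
Lemma self_norm_limit_coord Theta : cvg_self_norm X i Theta ->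
  law Theta (~` [set x | x ord0 i = 1]) = 0%E.
Proof.
move=> /(cvg_self_normP tpos) HT.
pose f (x : V) : R := Num.min 1 `|x ord0 i - 1|.
have cf : continuous f.
  apply: cts_min; first exact: cst_continuous.
  have c1 : continuous (fun x : V => x ord0 i - 1).
    by apply: ctsB; [exact: coord_cts|exact: cst_continuous].
  by apply: (cts_comp c1); exact: (@norm_continuous _ R^o).
have f0 x : 0 <= f x by rewrite le_min ler01 normr_ge0.
have bf : exists M : R, forall x, `|f x| <= M.
  by exists 1 => x; rewrite ger0_norm// ge_min lexx.
have mf : measurable_fun setT f by exact: continuous_measurable_rV.
have int0 : \int[law Theta]_x f x = 0.
  apply: (cvg_unique _ (HT f cf bf)); first exact: Rhausdorff.
  apply: cvg_near_cst; near=> t.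
  have T0 : 0 < T t by near: t; exact: tpos.
  have t0 : 0 < t by near: t; exact: nbhs_pinfty_gt.
  rewrite Rintegral_cond_law//.
  rewrite (@eq_Rintegral _ _ _ _ _ (cst 0)); last first.
    move=> x; rewrite inE/= => tx; rewrite /f /self_norm /divs /Defs.coord mxE mulVf; last first.
      by rewrite gt_eqF// (lt_trans t0).
    by rewrite subrr normr0 min_r.
  by rewrite Rintegral_cst ?mul0r//; exact: measurable_coord_gt.
have ii : (law Theta).-integrable setT (EFin \o f) by exact: prob_integrable.
have I0 : (\int[law Theta]_x (f x)%:E = 0)%E.
  by rewrite -[LHS]fineK ?integrable_fin_num//; congr EFin.
have := (ae_eq_integral_abs (law Theta) measurableT (measurable_int _ ii)).1.
under eq_integral => x _ do rewrite /= ger0_norm//.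
move=> /(_ I0); case=> N [mN N0 sub].
apply: (@subset_measure0 _ _ _ (law Theta) _ N) => //.
  by apply: measurableC; exact: measurable_coord_eq1.
move=> x /= x1; apply: sub => /= /(_ I) [] /eqP; rewrite /f; apply/negP.
by rewrite gt_eqF// lt_min ltr01 normr_gt0 subr_eq0; apply/eqP.
Unshelve. all: by end_near. Qed.

Lemma polar_cvg_M0 Theta (nui : M0 R [set i]%SET) : cvg_polar X alpha i Theta ->
  law Theta (~` [set x | x ord0 i = 1]) = 0%E ->
  (forall B, measurable B ->
    nui B = (c%:E * (kappa alpha \x law Theta)%E (scale2 @^-1` (B `&` S0 [set i]%SET)))%E) ->
  cvg_M0 X b nui.
Proof.
move=> /(cvg_polarP tpos _ alpha_gt0) HP Th1 nuE.
apply/cvg_M0P => g [cg [M gM] [e e0 g0]].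
have g0' (x : V) : x ord0 i <= e -> g x = 0.
  by move=> xe; apply: g0; rewrite max_on1_le// ltW.
have bg : exists M : R, forall x, `|g x| <= M by exists M.
rewrite (spectral_measure_integral alpha_gt0 Th1 c_gt0 nuE e0 cg bg g0').
have ch : continuous (fun z : R * V => g (e *: scale2 z)).
  apply: (cts_comp (f := fun z : R * V => e *: scale2 z)) => //.
  by apply: cts_scale; [exact: cst_continuous|exact: continuous_scale2].
have bh : exists M : R, forall z : R * V, `|g (e *: scale2 z)| <= M by exists M => z.
(* Conditioning at level e t loses nothing, since g(x / t) = 0 for x_i <= e t; above that level, x /
   t is e times (x_i / (e t)) times x / x_i. *)
have : b t * T (e * t) * \int[cond_law X i (e * t) (polar i (e * t))]_z g (e *: scale2 z)
    @[t --> +oo] --> c * e `^ (- alpha) *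
      \int[(pareto alpha \x law Theta)%E]_z g (e *: scale2 z).
  apply: cvgM; first exact: rv_tail.
  exact: (cvg_comp _ _ (scaled_pinfty e0) (HP _ ch bh)).
apply: cvg_trans; apply: near_eq_cvg; near=> t => /=.
have T0 : 0 < T (e * t) by near: t; exact: (near_scaled (P := fun t => 0 < T t) e0 tpos).
have b0 : 0 < b t by near: t; exact: bpos.
have t0 : 0 < t by near: t; exact: nbhs_pinfty_gt.
rewrite (gtr0_norm b0) -mulrA; congr (_ * _).
rewrite Rintegral_cond_law//; last exact: continuous_measurable_prod.
rewrite mulrCA divff ?gt_eqF// mulr1.
rewrite (@Rintegral_support _ _ _ _ (E (e * t))); last first.
  move=> x /= /negP; rewrite -leNgt => xe; apply: g0'.
  by rewrite mxE mulrC ler_pdivrMr.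
apply: eq_Rintegral => x; rewrite inE/= => ex.
have x0 : 0 < x ord0 i by apply: lt_trans ex; rewrite mulr_gt0.
congr g; rewrite /scale2/= /self_norm /divs /Defs.coord !scalerA.
congr (_ *: _); field.
by rewrite !gt_eqF.
Unshelve. all: by end_near. Qed.

Section from_M0.
Variables (J : {set 'I_d}) (nu : M0 R J).
Hypotheses (iJ : i \in J) (Hnu : cvg_M0 X b nu).

Let fin1 : (nu (E 1%R) < +oo)%E.
Proof.
apply: le_lt_trans (m0_gt_fin nu ltr01); apply: le_measure; rewrite ?inE.
- exact: measurable_coord_gt.
- exact: measurable_max_on_gt.
- by move=> x /= x1; apply: lt_le_trans x1 _; exact: le_max_on.
Qed.

(** [ramp n] replaces the indicator of [x_i > 1]; the error is bounded through
    the tail of [X_i] on [t, (1 + 1/n) t], see [error_bound]. *)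
Let ramp (n : nat) (x : V) : R := Num.min 1 (n.+1%:R * Num.max 0 (x ord0 i - 1)).

Let ramp01 n (x : V) : 0 <= ramp n x <= 1.
Proof. by rewrite le_min ler01 mulr_ge0 ?le_max ?lexx//= ge_min lexx. Qed.

Let ramp0 n (x : V) : x ord0 i <= 1 -> ramp n x = 0.
Proof. by move=> x1; rewrite /ramp max_l ?subr_le0// mulr0 min_r. Qed.

Let ramp1 n (x : V) : 1 + n.+1%:R^-1 < x ord0 i -> ramp n x = 1.
Proof.
rewrite -ltrBrDl => x1; rewrite /ramp min_l// max_r; last first.
  by apply: ltW; apply: lt_trans x1; rewrite invr_gt0.
by rewrite mulrC -ler_pdivrMr// div1r ltW.
Qed.

Let ramp_continuous n : continuous (ramp n).
Proof.
apply: cts_min; first exact: cst_continuous.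
apply: ctsM; first exact: cst_continuous.
apply: cts_max; first exact: cst_continuous.
by apply: ctsB; [exact: coord_cts|exact: cst_continuous].
Qed.

Let ramp_cvg (x : V) : 1 < x ord0 i -> ramp n x @[n --> \oo] --> (1 : R).
Proof.
move=> x1; have x10 : 0 < Num.max 0 (x ord0 i - 1) by rewrite lt_max subr_gt0 x1 orbT.
have := cvg_minn1 (ltW x10); rewrite x10.
by rewrite -cvg_shiftS.
Qed.

Section test_function.
Variables (f : V -> R) (M : R).
Hypotheses (cf : continuous f) (fM : forall x, `|f x| <= M).

(** Where [ramp n] is non-zero, x_i > 1 and [cap_norm i x] equals x / x_i: a continuous substitute
    for f(x / x_i) on {x_i > 1}. *)
Let g n (x : V) : R := f (cap_norm i x) * ramp n x.

Let cg n : continuous (g n).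
Proof.
by apply: ctsM => //; apply: (cts_comp (f := cap_norm i)) => //; exact: cap_norm_continuous.
Qed.

Let gM n x : `|g n x| <= M.
Proof.
have /andP[r0 r1] := ramp01 n x.
by rewrite normrM (ger0_norm r0) (le_trans _ (fM (cap_norm i x)))// ler_piMr.
Qed.

Let tg n : vanishing_test J (g n).
Proof.
split; [exact: cg|by exists M|exists 1 => // x x1].
rewrite /g ramp0 ?mulr0//; exact: le_trans (le_max_on x iJ) x1.
Qed.

Let L : R := \int[nu]_(x in E 1) f (cap_norm i x).

Let cvg_int_g : \int[nu]_x g n x @[n --> \oo] --> L.
Proof.
have gE n : \int[nu]_x g n x = \int[nu]_(x in E 1) g n x.
  apply: Rintegral_support => x /= /negP; rewrite -leNgt => x1.
  by rewrite /g ramp0 ?mulr0.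
under eq_fun do rewrite gE.
apply: (@bounded_cvg_Rintegral _ _ _ nu (E 1) g _ M) => //.
- exact: measurable_coord_gt.
- by move=> n; apply: measurable_funTS; exact: continuous_measurable_rV.
- move=> x /= x1; rewrite -[X in _ --> X]mulr1; apply: cvgM; first exact: cvg_cst.
  exact: ramp_cvg.
Qed.

Let error_bound n t : 0 < t -> 0 < b t ->
  `|b t * (\int[law X]_(x in E t) f (self_norm i x)) -
    `|b t| * (\int[law X]_x g n (t^-1 *: x))| <=
  M * (b t * T t - b t * T ((1 + n.+1%:R^-1) * t)).
Proof.
move=> t0 b0; rewrite (gtr0_norm b0) -mulrBr -mulrBr mulrCA normrM (gtr0_norm b0).
rewrite ler_pM2l//.
set a := 1 + n.+1%:R^-1.
have mE s : measurable (E s) by exact: measurable_coord_gt.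
have a1 : 1 <= a by rewrite lerDl invr_ge0.
rewrite (@Rintegral_support _ _ _ _ (E t)); last first.
  move=> x /= /negP; rewrite -leNgt => xt; rewrite /g ramp0 ?mulr0//.
  by rewrite mxE mulrC ler_pdivrMr// mul1r.
have i1 : (law X).-integrable (E t) (EFin \o (fun x => f (self_norm i x))).
  apply: prob_integrable => //; last by exists M.
  apply: (measurableT_comp (f := f)); first exact: continuous_measurable_rV.
  exact: measurable_funP.
have i2 : (law X).-integrable (E t) (EFin \o (fun x => g n (t^-1 *: x))).
  apply: prob_integrable => //; last by exists M.
  apply: (measurableT_comp (f := g n)); first exact: continuous_measurable_rV.
  exact: measurable_scale.
rewrite -RintegralB//.
have mI : measurable_fun setT (\1_(E (a * t)) : V -> R) by exact: measurable_indic.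
(* The majorant of the difference: M for t < x_i <= a t, where the ramp at x / t may be below 1, and
   0 for x_i > a t. *)
have i3 : (law X).-integrable (E t) (EFin \o (fun x : V => M - M * \1_(E (a * t)) x)).
  apply: prob_integrable => //.
    by apply: measurable_funB => //; exact: measurable_funM.
  exists (`|M| + `|M|) => x; apply: le_trans (ler_normB _ _) _; rewrite lerD2l normrM indicE.
  by case: (_ \in _); rewrite ?normr1 ?mulr1// normr0 mulr0.
have -> : M * (T t - T (a * t)) = \int[law X]_(x in E t) (M - M * \1_(E (a * t)) x).
  rewrite RintegralB//; last 2 first.
  - apply: prob_integrable => //; by exists `|M|.
  - apply: prob_integrable => //; first exact: measurable_funM.
    exists `|M| => x; rewrite normrM indicE.
    by case: (_ \in _); rewrite ?normr1 ?mulr1// normr0 mulr0.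
  rewrite Rintegral_cst// mulrBr; congr (_ - _).
  rewrite RintegralZl//; last first.
    apply: prob_integrable => //; exists 1 => x; rewrite indicE.
    by case: (_ \in _); rewrite ?normr1 ?normr0.
  rewrite /Rintegral integral_indic//; congr (_ * fine (law X _)).
  apply/seteqP; split => x /=; last by case.
  move=> ax; split => //; apply: le_lt_trans ax; by rewrite ler_peMl// ltW.
apply: le_trans (le_normr_Rintegral _ _) _ => //.
  apply: prob_integrable => //; last first.
    exists (M + M) => x; apply: le_trans (ler_normB _ _) _; exact: lerD.
  apply: measurable_funB.
    apply: (measurableT_comp (f := f)); first exact: continuous_measurable_rV.
    exact: measurable_funP.
  apply: (measurableT_comp (f := g n)); first exact: continuous_measurable_rV.
  exact: measurable_scale.
apply: le_Rintegral => //.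
  apply: prob_integrable => //; last first.
    exists (M + M) => x; rewrite normr_id; apply: le_trans (ler_normB _ _) _; exact: lerD.
  apply: measurableT_comp => //; apply: measurable_funB.
    apply: (measurableT_comp (f := f)); first exact: continuous_measurable_rV.
    exact: measurable_funP.
  apply: (measurableT_comp (f := g n)); first exact: continuous_measurable_rV.
  exact: measurable_scale.
move=> x /= tx; rewrite /g -[t^-1 *: x]/(divs t x) cap_norm_self_norm//.
rewrite -[X in X - _]mulr1 -mulrBr normrM.
have /andP[r0 r1] := ramp01 n (divs t x).
rewrite [X in _ * X]ger0_norm ?subr_ge0// indicE.
have [ax|ax] := ltP (a * t) (x ord0 i).
  rewrite ramp1; last by rewrite mxE mulrC ltr_pdivlMr.
  by rewrite subrr mulr0 mem_set// mulr1 subrr.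
rewrite memNset ?mulr0 ?subr0; last by move=> /=; apply/negP; rewrite -leNgt.
rewrite (le_trans _ (fM (self_norm i x)))// ler_piMr//.
by rewrite gerBl.
Qed.

(** An e / 3 argument in which n is fixed before t: as t grows the error bound tends to M c (1 - (1
    + 1 / (n + 1))^(-alpha)), which is small for large n. *)
Lemma M0_tail_integral :
  b t * (\int[law X]_(x in E t) f (self_norm i x)) @[t --> +oo] --> L.
Proof.
apply/cvgrPdist_le => e e0; have e30 : 0 < e / 3 by rewrite divr_gt0.
have M0 : 0 <= M by exact: le_trans (fM 0).
have H1 : M * (c - c * (1 + n.+1%:R^-1) `^ (- alpha)) @[n --> \oo] --> (0 : R).
  have -> : (0 : R) = M * (c - c * 1 `^ (- alpha)) by rewrite powR1 mulr1 subrr mulr0.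
  apply: cvgM; first exact: cvg_cst.
  apply: cvgB; first exact: cvg_cst.
  apply: cvgM; first exact: cvg_cst.
  have cp : z `^ (- alpha) @[z --> (1 : R)] --> 1 `^ (- alpha).
    have : derivable (fun z : R => z `^ (- alpha)) 1 1.
      by apply: derivable_powR; rewrite in_itv/= ltr01.
    by move=> /derivable1_diffP/differentiable_continuous.
  have ch : 1 + n.+1%:R^-1 @[n --> \oo] --> (1 : R).
    rewrite -[X in _ --> X]addr0; apply: cvgD; first exact: cvg_cst.
    exact: cvg_harmonic.
  exact: (cvg_comp _ _ ch cp).
have [n [n1 n2]] : exists n, `|L - \int[nu]_x g n x| <= e / 3 /\
    M * (c - c * (1 + n.+1%:R^-1) `^ (- alpha)) < e / 3.
  have /cvgrPdist_le/(_ _ e30) A := cvg_int_g.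
  have B : \forall n \near \oo, M * (c - c * (1 + n.+1%:R^-1) `^ (- alpha)) < e / 3.
    exact: (cvgr_lt _ H1).
  have [n _ /(_ n (leqnn n))/= [? ?]] := filterI A B.
  by exists n.
have a0 : 0 < 1 + n.+1%:R^-1 :> R by rewrite addr_gt0// invr_gt0.
have H2 : M * (b t * T t - b t * T ((1 + n.+1%:R^-1) * t)) @[t --> +oo] -->
    M * (c - c * (1 + n.+1%:R^-1) `^ (- alpha)).
  apply: cvgM; first exact: cvg_cst.
  by apply: cvgB => //; exact: rv_tail.
have /cvgrPdist_le/(_ _ e30) H3 := (cvg_M0P _ _ _).1 Hnu _ (tg n).
near=> t.
have t0 : 0 < t by near: t; exact: nbhs_pinfty_gt.
have b0 : 0 < b t by near: t; exact: bpos.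
have k1 := error_bound n t0 b0.
have k2 : M * (b t * T t - b t * T ((1 + n.+1%:R^-1) * t)) < e / 3.
  by near: t; exact: (cvgr_lt _ H2).
have k3 : `|\int[nu]_x g n x - `|b t| * (\int[law X]_x g n (t^-1 *: x))| <= e / 3.
  by near: t; exact: H3.
move: n1 k1 k3; rewrite !ler_norml => /andP[? ?] /andP[? ?] /andP[? ?].
apply/andP; split; lra.
Unshelve. all: by end_near. Qed.

Lemma M0_self_norm_integral :
  \int[cond_law X i t (self_norm i)]_x f x @[t --> +oo] --> c^-1 * L.
Proof.
have c0 : c != 0 by rewrite gt_eqF.
have : (b t * T t)^-1 * (b t * (\int[law X]_(x in E t) f (self_norm i x))) @[t --> +oo]
    --> c^-1 * L.
  by apply: cvgM; [exact: cvgV|exact: M0_tail_integral].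
apply: cvg_trans; apply: near_eq_cvg; near=> t => /=.
have T0 : 0 < T t by near: t; exact: tpos.
have b0 : 0 < b t by near: t; exact: bpos.
rewrite Rintegral_cond_law//; [|exact: continuous_measurable_rV|by exists M].
by rewrite invfM mulrACA mulVf ?gt_eqF// mul1r mulrC.
Unshelve. all: by end_near. Qed.

End test_function.

(** The case f = 1, where the conditional laws have mass 1 for every t. *)
Lemma M0_mass : nu (E 1) = c%:E.
Proof.
have c0 : c != 0 by rewrite gt_eqF.
have mE : measurable (E 1) by exact: measurable_coord_gt.
have n1 : forall x : V, `|(fun=> 1 : R) x| <= 1 by move=> _; rewrite normr1.
have H := M0_self_norm_integral (@cst_continuous _ _ _) n1.
have : c^-1 * \int[nu]_(x in E 1) 1 = 1.
  apply: (cvg_unique _ H); first exact: Rhausdorff.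
  have E1 : (fun t => \int[cond_law X i t (self_norm i)]_x (1 : R)) = (fun=> 1).
    by apply/funext => t; exact: Rintegral_prob_cst.
  by rewrite /= E1; exact: cvg_cst.
rewrite Rintegral_cst// mul1r => /(congr1 (fun z => c * z)).
rewrite mulrA divff// mul1r mulr1 => <-.
by rewrite fineK// ge0_fin_numE.
Qed.

(** Theta receives the law of x / x_i under c^(-1) nu restricted to {x_i > 1}, a probability by
    [M0_mass]. *)
Lemma M0_self_norm : exists Theta : orvec R d, cvg_self_norm X i Theta.
Proof.
have mE : measurable (E 1) by exact: measurable_coord_gt.
have mO := @measurable_orthant R d.
pose N := mnormalize (mrestr nu mE) (law X).
have mT : mrestr nu mE setT = c%:E by rewrite -M0_mass /mrestr setTI.
have NE A : N A = (c^-1%:E * nu (A `&` E 1%R))%E.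
  by rewrite /N (mnormalizeE _ _ c_gt0 mT).
pose Q := distribution (mnormalize (mrestr nu mE) (law X)) [the {mfun V >-> V} of cap_norm i].
have Q0 : Q (~` orthant) = 0%E.
  rewrite -[LHS]/(N (cap_norm i @^-1` (~` orthant))) NE.
  suff -> : nu (cap_norm i @^-1` (~` orthant) `&` E 1) = 0%E by rewrite mule0.
  apply: (@subset_measure0 _ _ _ nu _ (~` S0 J)).
  - apply: measurableI => //; rewrite -[X in measurable X]setTI.
    by apply: measurable_funP => //; exact: measurableC.
  - by apply: measurableC; exact: measurable_S0.
  - by move=> y [/= H _] [oy _]; apply: H; exact: cap_norm_orthant.
  - exact: m0_carrier.
have [Th TE] := orvec_of_prob Q0; exists Th.
apply/(cvg_self_normP tpos) => f cf [M fM].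
have mf : measurable_fun setT f by exact: continuous_measurable_rV.
rewrite (eq_measure_Rintegral (nu := Q)); last by move=> B mB _; exact: TE.
rewrite Rintegral_distribution//; last by exists M.
have k0 : 0 <= c^-1 by rewrite invr_ge0 ltW.
pose k : {nonneg R} := NngNum k0.
rewrite (eq_measure_Rintegral (nu := mscale k (mrestr nu mE))); last first.
  by move=> A mA _; rewrite -[LHS]/(N A) NE.
have mfc : measurable_fun setT (fun x => f (cap_norm i x)).
  by apply: measurableT_comp => //; exact: measurable_funP.
rewrite Rintegral_mscale//; last first.
  apply: integrable_bounded => //; last by exists M.
  by rewrite -[X in (X < _)%E]/(nu (setT `&` E 1%R)) setTI M0_mass ltry.
rewrite Rintegral_mrestr//.
exact: M0_self_norm_integral fM.
Qed.

End from_M0.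

End self_normalized_limits.

(** * Identification of the limits *)

Section limit_identification.
Context {R : realType} {d : nat}.
Local Notation V := 'rV[R]_d.
Variables (X : orvec R d) (i : 'I_d) (b : R -> R) (alpha c : R).
Hypotheses (alpha_gt0 : 0 < alpha) (b_rv : regularly_varying b alpha) (c_gt0 : 0 < c).
Hypothesis tails : b t * tail X i t @[t --> +oo] --> c.
Local Notation E t := [set x : V | t < x ord0 i].
Variables (Theta Y : orvec R d).
Hypotheses (HP : cvg_polar X alpha i Theta) (HY : cvg_exceed X i Y).
Hypothesis Theta1 : law Theta (~` [set x | x ord0 i = 1]) = 0%E.
Local Notation P := ((pareto alpha \x law Theta)%E : probability _ R).

Let mscale2 (B : set V) : measurable B -> measurable (scale2 @^-1` B).
Proof. by move=> mB; rewrite -[X in measurable X]setTI; exact: measurable_scale2. Qed.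

(** Uniqueness of weak limits, as the case w = 1 of [measure_unique_continuous]: then {w > 0} is the
    whole space. *)
Lemma exceed_law B : measurable B -> law Y B = P (scale2 @^-1` B).
Proof.
move=> mB; pose Q := distribution P [the {mfun (R * V)%type >-> V} of scale2].
have c1 : continuous (fun _ : V => 1 : R) by exact: cst_continuous.
have fin (m : probability V R) (e : R) : 0 < e -> (m [set x : V | (e < 1)%R] < +oo)%E.
  move=> _; apply: (le_lt_trans (probability_le1 m _)); rewrite ?ltry//.
  by case: (e < 1); [rewrite (_ : [set _ | _] = setT)|rewrite (_ : [set _ | _] = set0)] => //;
    apply/seteqP; split.
have T1 : [set x : V | (0 < 1 :> R)%R] = setT by apply/seteqP; split => // x _; exact: ltr01.
suff : law Y (B `&` [set x : V | (0 < 1 :> R)%R]) = Q (B `&` [set x : V | (0 < 1 :> R)%R]).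
  by rewrite T1 setIT.
apply: (measure_unique_continuous c1 (fin _) (fin _)) => // f cf f01 _.
have bf : exists M : R, forall x, `|f x| <= M.
  by exists 1 => x; have /andP[? ?] := f01 x; rewrite ger0_norm.
rewrite [RHS]Rintegral_distribution//; last exact: continuous_measurable_rV.
apply: (cvg_unique _ ((cvg_exceedP (tail_gt0 b_rv c_gt0 tails) _).1 HY f cf bf)).
  exact: Rhausdorff.
exact: (polar_exceed alpha_gt0 b_rv c_gt0 tails HP cf bf).
Qed.

Let mD : measurable [set z : R * V | z.2 ord0 i = 1].
Proof.
rewrite (_ : [set _ | _] = setT `*` [set x : V | x ord0 i = 1]).
  by apply: measurableX => //; exact: measurable_coord_eq1.
by apply/seteqP; split => -[u y] //= [].
Qed.

Let P_D : P (~` [set z : R * V | z.2 ord0 i = 1]) = 0%E.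
Proof.
rewrite (_ : ~` _ = setT `*` ~` [set x : V | x ord0 i = 1]); last first.
  by apply/seteqP; split => -[u y] //= [].
rewrite prob_prodE//; last by apply: measurableC; exact: measurable_coord_eq1.
by rewrite Theta1 mule0.
Qed.

(** Because y_i = 1 for almost every y, the i-th coordinate of u y is u. *)
Lemma exceed_law_component A : measurable A -> law_component Y i A = pareto alpha A.
Proof.
move=> mA; have mA' : measurable ((fun x : V => x ord0 i) @^-1` A).
  by rewrite -[X in measurable X]setTI; exact: measurable_coord.
have -> : law_component Y i A = law Y ((fun x : V => x ord0 i) @^-1` A) by [].
rewrite exceed_law//.
rewrite -[LHS](measure_setI_conull mD (mscale2 mA') P_D).
have mAT : measurable (A `*` [set: V]) by exact: measurableX.
transitivity (P (A `*` [set: V])); last first.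
  by rewrite prob_prodE// probability_setT mule1.
rewrite -[RHS](measure_setI_conull mD mAT P_D); congr (P _).
apply/seteqP; split => -[u y] /=; rewrite /scale2/= mxE.
  by move=> [+ y1]; rewrite y1 mulr1.
by move=> [[Au _] y1]; rewrite y1 mulr1.
Qed.

Lemma exceed_law_prod B : measurable B ->
  law Y B = (law_component Y i \x law Theta)%E [set p : R * V | B (p.1 *: p.2)].
Proof.
(* The product measure of a set is the integral of its sections against the first factor, so
   equality of the first factors is enough. *)
move=> mB; rewrite exceed_law//; apply: eq_measure_integral => A mA _.
by apply/esym; exact: exceed_law_component.
Qed.

Section with_M0.
Variables (J : {set 'I_d}) (nu : M0 R J).
Hypotheses (iJ : i \in J) (Hnu : cvg_M0 X b nu).
Variable nuT : M0 R [set i]%SET.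
Hypothesis nuTE : forall B, measurable B ->
  nuT B = (c%:E * (kappa alpha \x law Theta)%E (scale2 @^-1` (B `&` S0 [set i]%SET)))%E.

(** The explicit measure [nuT] is itself a limit on [S0 [set i]], and limits agree there; thus [nu]
    is known explicitly on {x_i > 0}. *)
Let nuTnu (A : set V) : measurable A -> A `<=` [set x | 0 < x ord0 i] -> nu A = nuT A.
Proof.
move=> mA Ai; have HT := polar_cvg_M0 alpha_gt0 b_rv c_gt0 tails HP Theta1 nuTE.
rewrite (M0_limit_sub iJ Hnu HT mA) -[LHS](M0_conull nu mA).
have mS := @measurable_S0 R d [set i]%SET.
rewrite -[RHS](M0_conull nu); last exact: measurableI.
congr (nu _); apply/seteqP; split => x /=; last by move=> [[]].
by move=> [Ax xJ]; split => //; split => //; rewrite S01E; split; [case: xJ|exact: Ai].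
Qed.

(** The level e = 1 in [spectral_measure_gt], where the image of the product law is the law of Y.
    That law is carried by {x_i > 1}, its i-th component being Pareto. *)
Lemma exceed_law_M0 B : measurable B ->
  law Y B = (c^-1%:E * nu (B `&` E 1%R))%E.
Proof.
move=> mB; have mE : measurable (E 1) by exact: measurable_coord_gt.
have mBE : measurable (B `&` E 1) by exact: measurableI.
rewrite nuTnu//; last by move=> x [_ /=]; exact: lt_trans.
rewrite (spectral_measure_gt alpha_gt0 Theta1 nuTE ltr01 mBE); last exact: subIsetr.
rewrite powR1 mulr1 muleA -EFinM mulVf ?gt_eqF// mul1e.
have Y1 : law Y (~` E 1) = 0%E.
  have -> : law Y (~` E 1) = law_component Y i (~` `]1, +oo[%classic).
    congr (rv_prob Y _); apply/seteqP; split => w /=; by rewrite in_itv/= andbT.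
  rewrite exceed_law_component; last exact: measurableC.
  by rewrite probability_setC// pareto_gt// maxxx powR1 subee.
have <- := measure_setI_conull mE mB Y1.
transitivity (P (scale2 @^-1` (B `&` E 1))); first exact: exceed_law.
congr (P _).
by apply/seteqP; split => z /=; rewrite scale1r.
Qed.

Let kappa_le0 : kappa alpha `]-oo, 0]%classic = 0%E.
Proof.
have -> : kappa alpha `]-oo, 0]%classic = (\int[kappa alpha]_z (\1_(`]-oo, 0%R]%classic : set R) z)%:E)%E.
  by rewrite integral_indic// setIT.
rewrite ge0_integral_kappa//; last by apply: measurableT_comp => //; exact: measurable_indic.
apply: integral0_eq => z /=; rewrite in_itv/= andbT => z0.
by rewrite indicE memNset ?mul0e//= in_itv/=; apply/negP; rewrite -ltNge.
Qed.

(** Change of variables along [scale2], then Tonelli. Since z Theta lies in [S0 J] only outside a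
    null set, f is extended by 0. *)
Lemma polar_integral (f : V -> \bar R) :
  measurable_fun (S0 J) f -> (forall x, S0 J x -> (0 <= f x)%E) ->
  (\int[nu]_(x in S0 J) (f x * (\1_[set x : V | (0 < x ord0 i)%R] x)%:E) =
   c%:E * \int[rv_prob Theta]_w \int[lebesgue_measure]_(z in `]0%R, +oo[)
     ((f \_ (S0 J)) (z *: Theta w) * (alpha * z `^ (- alpha - 1))%:E))%E.
Proof.
move=> mf f0; have mS := @measurable_S0 R d [set i]%SET; have mSJ := @measurable_S0 R d J.
have Si_sub : S0 [set i]%SET `<=` (S0 J : set V).
  move=> x [ox x0]; split => //=; apply: lt_le_trans x0 _; exact: le_max_on_set1.
pose F := f \_ (S0 J).
have mF : measurable_fun setT F by exact/(measurable_restrictT _ _).1.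
have F0 x : (0 <= F x)%E by rewrite /F patchE; case: ifPn => // /set_mem/f0.
have SE : S0 J `&` [set x : V | 0 < x ord0 i] = S0 [set i]%SET.
  rewrite S01E; apply/seteqP; split => x /=; first by move=> [[]].
  by move=> [ox x0]; split => //; apply: Si_sub; rewrite S01E.
transitivity (\int[nu]_(x in S0 [set i]%SET) F x)%E.
  rewrite -SE [RHS]integral_mkcondr; apply: eq_integral => x xJ.
  rewrite patchE /F indicE patchE xJ; case: (x \in _); rewrite ?mule1// mule0//.
have ck : 0 <= c by exact: ltW.
pose k : {nonneg R} := NngNum ck.
rewrite (eq_measure_integral (mscale k (mpush (kappa alpha \x law Theta)%E
  (@measurable_scale2 R d)))); last first.
  move=> A mA Ai; rewrite nuTnu//; last by move=> x /Ai; rewrite S01E => -[].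
  by rewrite nuTE// setIidl.
rewrite ge0_integral_mscale//; last exact: measurable_funTS.
congr (_ * _)%E.
rewrite (ge0_integral_pushforward (@measurable_scale2 R d))//; last exact: measurable_funTS.
have mFs : measurable_fun setT (F \o scale2).
  by apply: measurableT_comp => //; exact: measurable_scale2.
transitivity (\int[(kappa alpha \x law Theta)%E]_z (F \o scale2) z)%E.
  apply/esym; have mSs := mscale2 mS.
  (* For y in the orthant with y_i = 1, hence for almost every y, z y misses [S0 [set i]] exactly
     when z <= 0, and [kappa] does not charge these z. *)
  have N0 : (kappa alpha \x law Theta)%E (~` (scale2 @^-1` S0 [set i]%SET)) = 0%E.
    have mO := @measurable_orthant R d.
    rewrite (@prod_measure_section _ _ _ _ R (kappa alpha) (law Theta) (kappa alpha) 0
      ([set x : V | x ord0 i = 1] `&` orthant) _ set0)//.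
    - by rewrite mul0e.
    - exact: measurableC.
    - by apply: measurableI => //; exact: measurable_coord_eq1.
    - apply/eqP; rewrite eq_le measure_ge0 andbT setCI.
      apply: le_trans (measureU2 _ _ _) _.
      + by apply: measurableC; exact: measurable_coord_eq1.
      + exact: measurableC.
      + rewrite [X in (X + _ <= _)%E](_ : _ = 0%E); last exact: Theta1.
        by rewrite add0e [X in (X <= _)%E](_ : _ = 0%E)//; exact: law_orthant.
    - move=> y [y1 oy]; rewrite mul0e -[RHS]kappa_le0; congr (kappa alpha _).
      apply/seteqP; split => z /=; rewrite S01E /scale2/= in_itv/=.
        move=> H; rewrite leNgt; apply/negP => z0; apply: H; split.
          by apply: orthant_scale => //; exact: ltW.
        by rewrite /= mxE y1 mulr1.
      by move=> z0 [_ /=]; rewrite mxE y1 mulr1 ltNge z0.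
  rewrite [LHS](@ge0_negligible_integral _ _ _ _ _ (~` (scale2 @^-1` S0 [set i]%SET)))//.
  - by rewrite setDE setCK setTI.
  - exact: measurableC.
  - by move=> z _; exact: F0.
rewrite fubini_tonelli2//; last by move=> z; exact: F0.
rewrite /law ge0_integral_distribution//; last 2 first.
- by apply: measurable_fun_fubini_tonelli_G => // z; exact: F0.
- by move=> y; apply: integral_ge0 => z _; exact: F0.
apply: eq_integral => w _; rewrite /= /fubini_G/=.
rewrite ge0_integral_kappa//.
have mpair : measurable_fun setT (fun z : R => (z, Theta w)) by exact: measurable_pair2.
exact: (measurableT_comp mFs mpair).
Qed.

End with_M0.

End limit_identification.
Unset Implicit Arguments.

Theorem theorem3p1 (R : realType) (d : nat) (X : orvec R d) (I : {set 'I_d})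
  (b : R -> R) (alpha : R) (c : 'I_d -> R)
  (I_neq0 : I != finset.set0)
  (alpha_gt0 : 0 < alpha)
  (b_rv : regularly_varying b alpha)
  (c_gt0 : forall i, i \in I -> 0 < c i)
  (tails : forall i, i \in I ->
     b t * survival X i t @[t --> +oo] --> c i) :
  [<-> forall i, i \in I -> exists Theta : orvec R d, cvg_self_norm X i Theta;
       forall i, i \in I -> exists Theta : orvec R d, cvg_polar X alpha i Theta;
       forall i, i \in I -> exists Y : orvec R d, cvg_exceed X i Y;
       forall i, i \in I -> exists nui : M0 R [set i]%SET, cvg_M0 X b nui;
       exists nu : M0 R I, cvg_M0 X b nu] /\
  (forall nu : M0 R I, cvg_M0 X b nu ->
   forall i, i \in I ->
   (forall Theta : orvec R d,
      cvg_self_norm X i Theta <-> cvg_polar X alpha i Theta) /\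
   forall (Theta Y : orvec R d) (nui : M0 R [set i]%SET),
     cvg_self_norm X i Theta -> cvg_exceed X i Y -> cvg_M0 X b nui ->
   [/\ (forall A : set R, measurable A -> law_component Y i A = pareto alpha A) /\
       (forall B : set 'rV[R]_d, measurable B ->
          law Y B = (law_component Y i \x law Theta)%E
                      [set p : R * 'rV[R]_d | B (p.1 *: p.2)]),
       forall B : set 'rV[R]_d, measurable B ->
         nui B = nu (B `&` S0 [set i]%SET),
       forall B : set 'rV[R]_d, measurable B ->
         law Y B = (((c i)^-1)%:E * nu (B `&` [set x : 'rV[R]_d | (1 < x ord0 i)%R]))%E &
       forall f : 'rV[R]_d -> \bar R,
         measurable_fun (S0 I) f -> (forall x, S0 I x -> (0 <= f x)%E) ->
         (\int[nu]_(x in S0 I) (f x * (\1_[set x : 'rV[R]_d | (0 < x ord0 i)%R] x)%:E) =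
          (c i)%:E * \int[rv_prob Theta]_w
            \int[lebesgue_measure]_(z in `]0%R, +oo[)
              ((f \_ (S0 I)) (z *: Theta w) *
               (alpha * z `^ (- alpha - 1))%:E))%E ]).
Proof.
have tl i : i \in I -> b t * tail X i t @[t --> +oo] --> c i.
  by move=> /tails; under eq_fun do rewrite survivalE.
split.
  tfae.
  - move=> H i iI; have [Th HTh] := H i iI; exists Th.
    exact: (self_norm_polar alpha_gt0 b_rv (c_gt0 i iI) (tl i iI)).
  - move=> H i iI; have [Th HTh] := H i iI.
    exact: (polar_exceed_ex alpha_gt0 b_rv (c_gt0 i iI) (tl i iI) HTh).
  (* The limit measure is built from Theta_i, so Theta_i is first recovered from Y_i. *)
  - move=> H i iI; have [Y HY] := H i iI.
    have [Th HTh] := exceed_self_norm b_rv (c_gt0 i iI) (tl i iI) HY.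
    have HP := self_norm_polar alpha_gt0 b_rv (c_gt0 i iI) (tl i iI) HTh.
    have Th1 := self_norm_limit_coord b_rv (c_gt0 i iI) (tl i iI) HTh.
    have [nui nuiE] := spectral_measure_ex alpha_gt0 Th1 (c_gt0 i iI).
    by exists nui; exact: (polar_cvg_M0 alpha_gt0 b_rv (c_gt0 i iI) (tl i iI) HP Th1 nuiE).
  - exact: M0_glue.
  - move=> [nu Hnu] i iI.
    exact: (M0_self_norm b_rv (c_gt0 i iI) (tl i iI) iI Hnu).
move=> nu Hnu i iI.
have [ci ti] := (c_gt0 i iI, tl i iI).
split=> [Th|Th Y nui HTh HY Hnui].
  by split; [exact: (self_norm_polar alpha_gt0 b_rv ci ti)|
    exact: (polar_self_norm alpha_gt0 b_rv ci ti)].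
have HP := self_norm_polar alpha_gt0 b_rv ci ti HTh.
have Th1 := self_norm_limit_coord b_rv ci ti HTh.
(* An explicit limit on [S0 [set i]]; comparing [nu] with it yields (iii) and (iv). *)
have [nuT nuTE] := spectral_measure_ex alpha_gt0 Th1 ci.
split.
- split=> B mB.
    exact: (exceed_law_component alpha_gt0 b_rv ci ti HP HY Th1).
  exact: (exceed_law_prod alpha_gt0 b_rv ci ti HP HY Th1).
- by move=> B mB; exact: (M0_limit_sub iI Hnu Hnui mB).
- by move=> B mB; exact: (exceed_law_M0 alpha_gt0 b_rv ci ti HP HY Th1 iI Hnu nuTE).
- by move=> f mf f0; exact: (polar_integral alpha_gt0 b_rv ci ti HP Th1 iI Hnu nuTE).
Qed.
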